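(* (Tensor Product Criterion) Let $\Gamma$ be a forest fusion graph. If there exist a (finite) group $H$ and a forest fusion graph $\widetilde\Gamma$ of a subfactorizable fusion bialgebra with exchange relations such that $\Gamma\cong\Gamma_H\otimes\widetilde\Gamma$, then $\Gamma$ originates from (i.e. is isomorphic to the fusion graph of) a subfactorizable fusion bialgebra with exchange relations.
   Context: Fusion bialgebra: a unital $*$-algebra over $\mathbb C$ with a linear basis $\{x_0=1,x_1,\dots,x_n\}$ with $x_jx_k=\sum_s\widetilde N_{j,k}^sx_s$, $\widetilde N_{j,k}^s\ge0$, and an involution $*$ on indices with $x_k^*=x_{k^*}$, $\widetilde N_{j,k}^0=\delta_{j,k^*}$. It is subfactorizable if it can be realized as the 2-box space $\mathcal P_{2,+}$ (abelian) of an irreducible subfactor planar algebra $\mathcal P$, with convolution as product, $180^\circ$ rotation as involution on basis elements, and $x_j=\sqrt{\delta/d_j}\,p_j$, where $p_0,\dots,p_n$ are the minimal projections of $\mathcal P_{2,+}$, $p_0$ is the Jones projection, $\delta$ the circle value and $d_j\delta$ the unnormalized Markov trace of $p_j$. The convolution $p_k*p_j=\sum_iN_{kj}^ip_i$ places $p_k$ to the left of $p_j$ and joins the right-hand points of $p_k$ with the left-hand points of $p_j$ (upper to upper, lower to lower). In $\mathcal P_{3,+}$, stacking left factors on top: $E_1(i,j)=(p_i\otimes1)(1\otimes\mathfrak F_s(p_j))$, $E_2(s,t)=(p_s\otimes1)U(p_t\otimes1)$, $E_3(\ell,m)=(1\otimes\mathfrak F_s(p_\ell))(p_m\otimes1)$;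 here $x\otimes1$ is $x$ with a through strand added on the right, $1\otimes\mathfrak F_s(x)$ is the $90^\circ$ counterclockwise rotation of $x$ on strands 2,3 with a through strand on the left, and $U$ is through strand 1 with the cup-cap on strands 2,3. $\mathcal P$ is an exchange relation planar algebra if it is generated by $\mathcal P_2$ and each $E_1(i,j)$ is a linear combination of the $E_2(s,t)$ and $E_3(\ell,m)$; $\mathcal B$ has exchange relations if it is the 2-box space of an exchange relation planar algebra. Fusion graph: a family $\Gamma=\{\Gamma_k:0\le k\le n\}$ of bipartite graphs, where $\Gamma_k$ has white vertices $0,\dots,n$ and black vertices $0,\dots,n$ and an edge between white $i$ and black $j$ iff $N_{kj}^i\neq0$. It is a forest fusion graph if every $\Gamma_k$ is acyclic. $\Gamma_H$ is the fusion graph of the group planar algebra of $H$: indices are elements of $H$ and in the graph of $g$ white $h'$ is joined to black $h$ iff $h'=gh$. $\Gamma_H\otimes\widetilde\Gamma$ is the matrix tensor product of fusion matrices: indices are pairs $(h,i)$, and in the graph of $(g,k)$ white $(h',i)$ is joined to black $(h,j)$ iff $h'=gh$ and white $i$ is joined to black $j$ in $\widetilde\Gamma_k$. Two fusion graphs are isomorphic if they agree after a bijection of index sets preserving the unit index $0$ and the dual operation $i\mapsto\overline i$. *)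

(* Defs.v *)
From HB Require Import structures.
From mathcomp Require Import all_boot all_order all_fingroup all_algebra.
From mathcomp Require Import falgebra.
From mathcomp Require Import reals complex.

Set Implicit Arguments.
Unset Strict Implicit.
Unset Printing Implicit Defensive.

Import Order.TTheory GRing.Theory Num.Theory.
Local Open Scope ring_scope.

(** * Labelled planar tangles

  Isotopy classes of labelled shaded planar tangles are presented by diagrams
  in standard (Morse) form.  The outer disc is a rectangle with its marked
  interval on the left; a diagram is the list, read from top to bottom, of its
  local extrema of strings and of its input discs, placed at distinct heights.
  An input disc labelled by an element of [V n e] is drawn as a rectangle with
  its marked interval on the left, [n] strings above and [n] strings below.
  The boolean [e] is the shading of the region touching the marked interval:
  [V n false] is the space written V_{n,+} and [V n true] is V_{n,-}.
  In each constructor [i] is the number of strings passing on the left.       *)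

Section Tangles.
Variables (C : numClosedFieldType) (V : nat -> bool -> vectType C).

Inductive piece : Type :=
  | Cap of nat  (* a local maximum: two strings start below it *)
  | Cup of nat  (* a local minimum: two strings end above it *)
  | Box (i n : nat) (e : bool) of V n e.

Definition diagram := seq piece.

Definition piece_pos (p : piece) : nat :=
  match p with Cap i | Cup i => i | @Box i _ _ _ => i end.

Definition strings_above (p : piece) : nat :=
  match p with Cap _ => 0 | Cup _ => 2 | @Box _ n _ _ => n end.

Definition strings_below (p : piece) : nat :=
  match p with Cap _ => 2 | Cup _ => 0 | @Box _ n _ _ => n end.

Definition shift (d : nat) (p : piece) : piece :=
  match p with
  | Cap i => Cap (d + i)
  | Cup i => Cup (d + i)
  | @Box i _ _ x => Box (d + i) x
  end.

(* [s] is the shading of the leftmost region; crossing a string changes it. *)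
Definition shading_ok (s : bool) (p : piece) : bool :=
  if p is @Box i _ e _ then e == s (+) odd i else true.

(* [well_typed s m w m']: the diagram [w] has [m] strings at the top, [m'] at
   the bottom, and the shading of every label agrees with its position. *)
Fixpoint well_typed (s : bool) (m : nat) (w : diagram) (m' : nat) : bool :=
  if w is p :: w' then
    [&& (piece_pos p + strings_above p <= m)%N, shading_ok s p
      & well_typed s (m - strings_above p + strings_below p) w' m']
  else m == m'.

(* Tangles with outer disc of type (n, s): 2n boundary points. *)
Definition tangle (n : nat) (s : bool) (w : diagram) : bool :=
  well_typed s n w n.

(* [n] nested maxima (resp. minima), the outermost one starting at [i]. *)
Definition caps (i n : nat) : diagram := [seq Cap j | j <- iota i n].
Definition cups (i n : nat) : diagram := rev [seq Cup j | j <- iota i n].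

(* A label turned by half a turn, clockwise and counterclockwise; the turned
   disc occupies the strings i, ..., i + n - 1. *)
Definition half_turn_cw (i n : nat) (e : bool) (x : V n e) : diagram :=
  caps (i + n) n ++ Box (i + n) x :: cups i n.
Definition half_turn_ccw (i n : nat) (e : bool) (x : V n e) : diagram :=
  caps i n ++ Box (i + n) x :: cups (i + n) n.

(* Generating moves of planar isotopy of diagrams in standard form: exchange
   of the heights of two pieces lying side by side, straightening of a string,
   and a full turn of an input disc. *)
Inductive isotopy_move : diagram -> diagram -> Prop :=
  | Exchange_heights (p q : piece) :
      isotopy_move [:: p; shift (piece_pos p + strings_below p) q]
                   [:: shift (piece_pos p + strings_above p) q; p]
  | Straighten_left (i : nat) : isotopy_move [:: Cap i; Cup i.+1] [::]
  | Straighten_right (i : nat) : isotopy_move [:: Cap i.+1; Cup i] [::]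
  | Full_turn (i n : nat) (e : bool) (x : V n e) :
      isotopy_move (half_turn_cw i x) (half_turn_ccw i x).

(* Reflection in a horizontal line, [st] being applied to the labels. *)
Definition reflect_piece (st : forall n e, V n e -> V n e) (p : piece) :=
  match p with
  | Cap i => Cup i
  | Cup i => Cap i
  | @Box i _ _ x => Box i (st _ _ x)
  end.
Definition reflect (st : forall n e, V n e -> V n e) (w : diagram) : diagram :=
  rev [seq reflect_piece st p | p <- w].

Definition two_box_labels (w : diagram) : bool :=
  all (fun p => if p is @Box _ n _ _ then n == 2%N else true) w.

End Tangles.

Arguments Cap {C V}.
Arguments Cup {C V}.
Arguments Box {C V} i {n e}.

(** * Planar algebras *)

(* [act n s w] is the value of the labelled tangle [w]; it is meaningful only
   when [tangle n s w] holds. *)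
Record planar_algebra (C : numClosedFieldType) := PlanarAlgebra {
  space :> nat -> bool -> vectType C;
  act : forall n s, diagram space -> space n s;
  act_isotopy : forall n s (a b w w' : diagram space),
    isotopy_move w w' ->
    tangle n s (a ++ w ++ b) -> tangle n s (a ++ w' ++ b) ->
    act n s (a ++ w ++ b) = act n s (a ++ w' ++ b);
  act_linear : forall n s (a b : diagram space) i k e (c : C)
      (x y : space k e),
    tangle n s (a ++ Box i x :: b) ->
    act n s (a ++ Box i (c *: x + y) :: b) =
      c *: act n s (a ++ Box i x :: b) + act n s (a ++ Box i y :: b);
  act_id : forall n s (x : space n s), act n s [:: Box 0 x] = x;
  (* naturality with respect to composition of tangles *)
  act_comp : forall n s (a b : diagram space) i k e (w : diagram space),
    tangle k e w ->
    tangle n s (a ++ Box i (act k e w) :: b) ->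
    act n s (a ++ Box i (act k e w) :: b) =
      act n s (a ++ map (shift i) w ++ b)
}.

Section PlanarAlgebraOps.
Variables (C : numClosedFieldType) (P : planar_algebra C).

Definition pmul n s (x y : P n s) : P n s := act n s [:: Box 0 x; Box 0 y].

(* The coordinate of [z] on the empty tangle, which spans [P 0 s] when that
   space has dimension 1. *)
Definition scalar_of s (z : P 0%N s) : C :=
  coord [tuple act (p := P) 0 s [::]] ord0 z.

(* The unnormalized Markov trace: the strings are closed up on the right. *)
Definition ptrace n s (x : P n s) : C :=
  scalar_of (act 0 s (caps P 0 n ++ Box 0 x :: cups P 0 n)).

Definition circle_value : C :=
  scalar_of (act (p := P) 0 false [:: Cap 0; Cup 0]).

(* [x] is placed to the left of [y]; its right-hand points are joined with the
   left-hand points of [y]. *)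
Definition convolution (x y : P 2%N false) : P 2%N false :=
  act 2 false [:: Cap 1; Box 0 x; Box 2 y; Cup 1].

Definition rotation180 (x : P 2%N false) : P 2%N false :=
  act 2 false (half_turn_cw 0 x).

Definition jones_projection : P 2%N false :=
  circle_value^-1 *: act (p := P) 2 false [:: Cup 0; Cap 0].

(* 1 (x) F_s(x) in P_{3,+}: the upper right point of [x] is the upper left
   point of its counterclockwise quarter turn. *)
Definition fourier_right (x : P 2%N false) : diagram P :=
  [:: Cap 1; Box 2 x; Cup 3].

Definition E1 (x y : P 2%N false) : P 3%N false :=
  act 3 false (Box 0 x :: fourier_right y).
Definition E2 (x y : P 2%N false) : P 3%N false :=
  act 3 false [:: Box 0 x; Cup 1; Cap 1; Box 0 y].
Definition E3 (x y : P 2%N false) : P 3%N false :=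
  act 3 false (fourier_right x ++ [:: Box 0 y]).

Definition generated_by_two_boxes : Prop :=
  forall n s (x : P n s), exists ws : seq (diagram P),
    all (fun w => tangle n s w && two_box_labels w) ws
    /\ x \in <<[seq act n s w | w <- ws]>>%VS.

Definition exchange_relation (I : finType) (p : I -> P 2%N false) : Prop :=
  forall i j, exists a b : I -> I -> C,
    E1 (p i) (p j) =
      \sum_s \sum_t a s t *: E2 (p s) (p t)
      + \sum_l \sum_m b l m *: E3 (p l) (p m).

End PlanarAlgebraOps.

Record subfactor_planar_algebra (C : numClosedFieldType) :=
  SubfactorPlanarAlgebra {
  spa :> planar_algebra C;
  pstar : forall n s, spa n s -> spa n s;
  pstar_semilinear : forall n s (c : C) (x y : spa n s),
    pstar (c *: x + y) = c^* *: pstar x + pstar y;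
  pstarK : forall n s, involutive (@pstar n s);
  pstar_act : forall n s (w : diagram spa), tangle n s w ->
    pstar (act n s w) = act n s (reflect pstar w);
  dim_zero_boxes : forall s, \dim {: spa 0%N s} = 1%N;
  (* moving a string of a closed diagram across the point at infinity *)
  spherical : forall s (x : spa 1%N s),
    scalar_of (act 0 s [:: Cap 0; Box 0 x; Cup 0]) =
    scalar_of (act 0 (~~ s) [:: Cap 0; Box 1 x; Cup 0]);
  ptrace_positive : forall n s (x : spa n s), x != 0 ->
    0 < ptrace (pmul (pstar x) x)
}.

Section MinimalProjections.
Variables (C : numClosedFieldType) (P : subfactor_planar_algebra C).

Definition irreducible_spa : Prop := \dim {: P 1%N false} = 1%N.

Definition projection n s (q : P n s) : Prop :=
  pmul q q = q /\ pstar q = q.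

Definition minimal_projection n s (q : P n s) : Prop :=
  [/\ projection q, q != 0 &
      forall r : P n s, projection r -> pmul q r = r -> r = 0 \/ r = q].

(* p_0, ..., p_n are the minimal projections of P_{2,+}, without repetition. *)
Definition minimal_projections_of_two_boxes n (p : 'I_n.+1 -> P 2%N false) :=
  [/\ injective p,
      forall q : P 2%N false, minimal_projection q <-> exists j, q = p j
    & p ord0 = jones_projection P].

End MinimalProjections.

(** * Fusion bialgebras *)

Record fusion_bialgebra (C : numClosedFieldType) := FusionBialgebra {
  carrier :> falgType C;
  fstar : carrier -> carrier;
  fstar_semilinear : forall (c : C) (a b : carrier),
    fstar (c *: a + b) = c^* *: fstar a + fstar b;
  fstarM : forall a b : carrier, fstar (a * b) = fstar b * fstar a;
  fstarK : involutive fstar;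
  frank : nat;
  fbasis : 'I_frank.+1 -> carrier;
  fbasisP : basis_of {: carrier} [tuple fbasis j | j < frank.+1];
  fbasis0 : fbasis ord0 = 1;
  fcoef : 'I_frank.+1 -> 'I_frank.+1 -> 'I_frank.+1 -> C;
  fbasisM : forall j k,
    fbasis j * fbasis k = \sum_s fcoef j k s *: fbasis s;
  fcoef_ge0 : forall j k s, 0 <= fcoef j k s;
  fdual : 'I_frank.+1 -> 'I_frank.+1;
  fdualK : involutive fdual;
  fstar_fbasis : forall k, fstar (fbasis k) = fbasis (fdual k);
  fcoef0 : forall j k, fcoef j k ord0 = (j == fdual k)%:R
}.

Section Subfactorizable.
Variable C : numClosedFieldType.

(* [B] is the 2-box space of [P], with p_0, ..., p_n as minimal projections. *)
Definition realizes (P : subfactor_planar_algebra C) (B : fusion_bialgebra C)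
    (p : 'I_(frank B).+1 -> P 2%N false) : Prop :=
  [/\ irreducible_spa P,
      forall x y : P 2%N false, pmul x y = pmul y x,
      minimal_projections_of_two_boxes p
    & exists phi : {linear B -> P 2%N false},
      [/\ bijective phi,
          forall a b : B, phi (a * b) = convolution (phi a) (phi b),
          forall j, phi (fstar (fbasis j)) = rotation180 (phi (fbasis j))
        & forall j, let delta := circle_value P in
            let d := ptrace (p j) / delta in
            phi (fbasis j) = sqrtC (delta / d) *: p j]].

Definition subfactorizable (B : fusion_bialgebra C) : Prop :=
  exists (P : subfactor_planar_algebra C) (p : 'I_(frank B).+1 -> P 2%N false),
    realizes p.

Definition has_exchange_relations (B : fusion_bialgebra C) : Prop :=
  exists (P : subfactor_planar_algebra C) (p : 'I_(frank B).+1 -> P 2%N false),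
    [/\ realizes p, generated_by_two_boxes P & exchange_relation p].

End Subfactorizable.

(** * Fusion graphs *)

(* [edge k i j]: in the graph with index [k], the white vertex [i] is joined
   to the black vertex [j]. *)
Record graph_family := GraphFamily {
  gindex : finType;
  unit_index : gindex;
  dual_index : gindex -> gindex;
  edge : gindex -> gindex -> gindex -> bool
}.

Definition graph_family_iso (G G' : graph_family) : Prop :=
  exists f : gindex G -> gindex G',
    [/\ bijective f,
        f (unit_index G) = unit_index G',
        forall i, f (dual_index i) = dual_index (f i)
      & forall k i j, edge k i j = edge (f k) (f i) (f j)].

(* The x_j being positive multiples of the p_j, the structure constants of the
   two families vanish simultaneously. *)
Definition fusion_graph (C : numClosedFieldType) (B : fusion_bialgebra C) :=
  GraphFamily (ord0 : 'I_(frank B).+1) (@fdual _ B)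
    (fun k i j => fcoef k j i != 0).

Definition is_fusion_graph (C : numClosedFieldType) (G : graph_family) :=
  exists B : fusion_bialgebra C, graph_family_iso G (fusion_graph B).

(* Adjacency of the bipartite graph: white vertices are [inl i], black ones
   are [inr j]. *)
Definition bipartite_adj (I : finType) (e : I -> I -> bool) : rel (I + I) :=
  fun u v => match u, v with
             | inl i, inr j | inr j, inl i => e i j
             | _, _ => false
             end.

Definition acyclic_graph (T : finType) (r : rel T) : Prop :=
  forall c : seq T, (2 < size c)%N -> ~~ (uniq c && path.cycle r c).

Definition forest (G : graph_family) : Prop :=
  forall k : gindex G, acyclic_graph (bipartite_adj (edge k)).

Definition group_graph (H : finGroupType) : graph_family :=
  GraphFamily (1%g : H) (fun g => g^-1)%g (fun g h' h => h' == (g * h)%g).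

Definition tensor_graph (G G' : graph_family) : graph_family :=
  GraphFamily (unit_index G, unit_index G')
    (fun u => (dual_index u.1, dual_index u.2))
    (fun u v w => edge u.1 v.1 w.1 && edge u.2 v.2 w.2).

(* Main.v *)
Require Import Defs.
From HB Require Import structures.
From mathcomp Require Import all_boot all_order all_fingroup all_algebra.
From mathcomp Require Import falgebra zify ring.
From mathcomp Require Import boolp reals complex.

Set Implicit Arguments.
Unset Strict Implicit.
Unset Printing Implicit Defensive.

Import Order.TTheory GRing.Theory Num.Theory.
Import Defs.
Local Open Scope ring_scope.

(** The witness is the fusion bialgebra of the tensor product of the planar
algebra of the group H with a planar algebra P realizing the given bialgebra.
No tensor product of vector spaces is formed: the planar algebra of H is the
H-invariant part of a spin model, so that an n-box of the product is a
P-valued function of the colours of the regions around the box.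

Colour by elements of H the unshaded regions of a diagram and leave the shaded
ones uncoloured.  An n-box of the spin extension of P is a function sending each
colouring of the regions around a disc with 2n boundary points to an n-box of
P, and the value of a labelled diagram on a boundary colouring is the sum, over
the colourings of the interior regions, of the values in P of the diagrams
obtained by evaluating every label on the colours around it
([state_sum], [spin_act]).  Each local maximum or minimum carries a weight
m or 1/m, with m the fourth root of the order of H ([piece_weight]).  The two
weights cancel when a string is straightened, and a closed curve without labels
contributes the square root of the order of H whichever side of it is shaded.
Isotopy invariance ([state_sum_isotopy]), naturality for composition
([spin_act_comp]) and compatibility with the adjoint ([state_sum_reflect]) hold
because the sum is local: a piece of a diagram sees only the regions it touches.

H acts on colourings by left translation, and state sums commute with this
action ([state_sum_translate]).  The planar subalgebra generated by the
invariant 2-boxes ([tensor_planar]) therefore consists of invariant functions,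
is generated by 2-boxes by construction, and contains every invariant 2-box.
Invariance makes its 0-box spaces one-dimensional, transports irreducibility
from P, and gives sphericality because summing over one free colour costs
m^4.  Traces are sums of traces in P, whence positivity
([ptrace_tensor], [tensor_positive]).

A 2-box of the product is a function g |-> x_g from H to the 2-boxes of P, the
variable being the quotient of the colours on its two sides ([fibre]).
Multiplication is pointwise, convolution is convolution over H, half rotation
inverts g, and the Jones projection is concentrated at 1.  Hence the minimal
projections are the pairs (g, p_i), and the bialgebra is the group algebra of H
with coefficients in the given bialgebra: its fusion graph is the tensor product
of the two graphs.

The exchange relation survives because for the group factor the three families
E_1, E_2, E_3 coincide up to relabelling.  On a boundary with coloured regions
a, b, c the boxes of E_1((g,i),(h,j)) see the quotients a^-1 b = g and
c^-1 b = h, those of E_2 see a^-1 b and a^-1 c, and those of E_3 see c^-1 b and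
a^-1 c.  Any two of the three quotients determine the third, so the relation
for (i, j) in P lifts word for word, the new group index being g h^-1
([exchange_group_tensor]). *)

(** * Shapes of diagrams *)

Section Shapes.
Variable C : numClosedFieldType.

(** All that typing, shading and isotopy moves retain of a piece.  Diagrams over
different families of box spaces are compared through it. *)
Definition piece_shape (V : nat -> bool -> vectType C) (p : piece V) :
    nat + nat + nat * nat * bool :=
  match p with
  | Cap i => inl (inl i)
  | Cup i => inl (inr i)
  | @Box _ _ i n e _ => inr (i, n, e)
  end.

Section TwoFamilies.
Variables V V' : nat -> bool -> vectType C.
Implicit Types (p : piece V) (q : piece V').

Lemma eq_shape_pos p q : piece_shape p = piece_shape q -> piece_pos p = piece_pos q.
Proof. by case: p q => [?|?|????] [?|?|????] //= [] //. Qed.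

Lemma eq_shape_above p q : piece_shape p = piece_shape q -> strings_above p = strings_above q.
Proof. by case: p q => [?|?|????] [?|?|????] //= [] //. Qed.

Lemma eq_shape_below p q : piece_shape p = piece_shape q -> strings_below p = strings_below q.
Proof. by case: p q => [?|?|????] [?|?|????] //= [] //. Qed.

Lemma eq_shape_shading s p q : piece_shape p = piece_shape q -> shading_ok s p = shading_ok s q.
Proof. by case: p q => [?|?|????] [?|?|????] //= [-> _ ->]. Qed.

Lemma eq_shape_typed s m (w : diagram V) (w' : diagram V') m' :
  map (@piece_shape V) w = map (@piece_shape V') w' ->
  well_typed s m w m' = well_typed s m w' m'.
Proof.
elim: w w' m => [|p w IH] [|q w'] //= m [pq ww'].
by rewrite (eq_shape_pos pq) (eq_shape_above pq) (eq_shape_below pq)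
  (eq_shape_shading s pq) (IH w').
Qed.

Lemma eq_shape_shift d p q : piece_shape p = piece_shape q -> piece_shape (shift d p) = piece_shape (shift d q).
Proof. by case: p q => [?|?|????] [?|?|????] //= [] // -> //; move=> -> ->. Qed.

End TwoFamilies.

Variable V : nat -> bool -> vectType C.
Implicit Types (p : piece V) (w : diagram V).

Lemma shift_pos d p : piece_pos (shift d p) = (d + piece_pos p)%N.
Proof. by case: p. Qed.
Lemma shift_above d p : strings_above (shift d p) = strings_above p.
Proof. by case: p. Qed.
Lemma shift_below d p : strings_below (shift d p) = strings_below p.
Proof. by case: p. Qed.
Lemma shift_shading s d p : shading_ok s (shift d p) = shading_ok (s (+) odd d) p.
Proof. by case: p => //= i n e _; rewrite oddD addbA. Qed.

Definition strings_after m w := foldl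
  (fun m p => m - strings_above p + strings_below p)%N m w.

Lemma well_typed_cat s m w1 w2 m' :
  well_typed s m (w1 ++ w2) m' =
  well_typed s m w1 (strings_after m w1) && well_typed s (strings_after m w1) w2 m'.
Proof.
elim: w1 m => [|p w IH] m /=; first by rewrite eqxx.
by rewrite IH !andbA.
Qed.

Lemma well_typed_after s m w m' : well_typed s m w m' -> strings_after m w = m'.
Proof. by elim: w m => [|p w IH] m /=; [move/eqP | case/and3P=> _ _ /IH]. Qed.

(** Juxtaposing [d] strings on the left and [r] strings on the right of a
diagram. *)
Lemma well_typed_shift s d k m r w :
  well_typed (s (+) odd d) k w m ->
  well_typed s (d + k + r) (map (shift d) w) (d + m + r).
Proof.
elim: w k => [|p w IH] k /=; first by move/eqP->.
case/and3P=> h1 h2 h3.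
rewrite shift_pos shift_above shift_below shift_shading h2 /=.
have -> : (d + piece_pos p + strings_above p <= d + k + r)%N.
  by move: h1; lia.
have -> : (d + k + r - strings_above p + strings_below p =
           d + (k - strings_above p + strings_below p) + r)%N.
  by move: h1; lia.
by rewrite IH.
Qed.

Lemma tangle_insert n s (a b : diagram V) i k e w (x : V k e) :
  tangle k e w -> tangle n s (a ++ Box i x :: b) ->
  tangle n s (a ++ map (shift i) w ++ b).
Proof.
rewrite /tangle => wk; rewrite !well_typed_cat /= => /andP[-> /=].
set m := strings_after n a => /and3P[im /eqP ee hb].
have wt := @well_typed_shift s i k k (m - (i + k)) w.
rewrite -ee subnKC // in wt.
move/(_ wk): wt => wt.
rewrite (well_typed_after wt) wt /=.
by rewrite subnK // in hb; apply: leq_trans im; rewrite leq_addl.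
Qed.

End Shapes.

(** * Colourings of the regions met by a horizontal slice *)

Section Colourings.
Variable H : finGroupType.
Implicit Types (s e : bool) (t u v : seq H) (a c h : H).

(** A slice crossing [n] strings meets [n.+1] regions of alternating shading, the
leftmost having shading [s].  Shaded regions carry no colour, which is encoded
by the forced colour 1, so that all regions are listed uniformly. *)
Fixpoint admissible s t : bool :=
  if t is a :: t' then (s ==> (a == 1%g)) && admissible (~~ s) t' else true.

Definition colours s : seq H := if s then [:: 1%g] else enum H.

Definition colouring s m t := (size t == m.+1) && admissible s t.

(** Colourings of the slices just above and just below a rectangle of leftmost
shading [e] with [n] strings on top and [m] strings at the bottom: the regions
on its left and on its right are met by both slices.  Taking [n] and [m]
different treats maxima and minima as rectangles with no string on one side. *)
Definition boundary e n m u v :=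
  [&& colouring e n u, colouring e m v,
      head 1%g u == head 1%g v & last 1%g u == last 1%g v].

Fixpoint translate s h t : seq H :=
  if t is a :: t' then (if s then a else (h * a)%g) :: translate (~~ s) h t'
  else [::].

Lemma mem_colours s c : (c \in colours s) = (s ==> (c == 1%g)).
Proof. by case: s; rewrite /= ?inE // mem_enum. Qed.

Lemma colours_uniq s : uniq (colours s).
Proof. by case: s; rewrite /= ?enum_uniq. Qed.

Lemma admissible_cat s t u :
  admissible s (t ++ u) = admissible s t && admissible (s (+) odd (size t)) u.
Proof.
elim: t s => [|a t IH] s /=; first by rewrite addbF.
by rewrite IH andbA addNb addbN.
Qed.

Lemma admissible_rev s t :
  admissible s (rev t) = admissible (s (+) ~~ odd (size t)) t.
Proof.
elim: t s => [|a t IH] s //=.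
rewrite rev_cons -cats1 admissible_cat IH /= size_rev andbT negbK.
by rewrite andbC addbN.
Qed.

Lemma size_translate s h t : size (translate s h t) = size t.
Proof. by elim: t s => //= a t IH s; rewrite IH. Qed.

Lemma translate_cat s h t u :
  translate s h (t ++ u) = translate s h t ++ translate (s (+) odd (size t)) h u.
Proof.
elim: t s => [|a t IH] s /=; first by rewrite addbF.
by rewrite IH addNb addbN.
Qed.

Lemma translate_adm s h t : admissible s t -> admissible s (translate s h t).
Proof. by elim: t s => //= a t IH [] /=; [case/andP=> -> |]; apply: IH. Qed.

Lemma translateK s h t : translate s h^-1%g (translate s h t) = t.
Proof. by elim: t s => //= a t IH s; rewrite IH; case: s; rewrite ?mulKg. Qed.

Lemma colouring_translate s m h t : colouring s m t -> colouring s m (translate s h t).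
Proof. by case/andP=> h1 h2; rewrite /colouring size_translate h1 translate_adm. Qed.

Lemma head_translate s h t : t != [::] ->
  head 1%g (translate s h t) = if s then head 1%g t else (h * head 1%g t)%g.
Proof. by case: t. Qed.

Lemma last_translate s h m t : size t = m.+1 ->
  last 1%g (translate s h t) =
  if s (+) odd m then last 1%g t else (h * last 1%g t)%g.
Proof.
elim: m s t => [|m IH] s [|a [|b t]] //=; first by rewrite addbF.
by case=> st; rewrite addbN -addNb -(IH _ (b :: t)) //= st.
Qed.

Lemma boundary_sym e n m u v : boundary e n m u v = boundary e m n v u.
Proof. by rewrite /boundary andbCA eq_sym [last _ _ == _]eq_sym. Qed.

(** Equal parities give the rightmost region the same shading on both slices, so
that it is translated in the same way. *)
Lemma boundary_translate e n m h u v : odd n = odd m ->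
  boundary e n m u v -> boundary e n m (translate e h u) (translate e h v).
Proof.
move=> nm /and4P[cu cv /eqP h1 /eqP h2].
rewrite /boundary !colouring_translate //=.
case/andP: cu => /eqP su _; case/andP: cv => /eqP sv _.
rewrite !head_translate -?size_eq0 ?su ?sv //.
by rewrite (last_translate _ _ su) (last_translate _ _ sv) h1 h2 nm !eqxx.
Qed.

Fixpoint colourings_from e n a : seq (seq H) :=
  if n is n'.+1 then [seq a :: u | c <- colours (~~ e), u <- colourings_from (~~ e) n' c]
  else [:: [:: a]].

Lemma mem_colourings_from e n a u : e ==> (a == 1%g) ->
  (u \in colourings_from e n a) = colouring e n u && (head 1%g u == a).
Proof.
elim: n e a u => [|n IH] e a u ea /=.
  rewrite inE; apply/eqP/idP=> [->|]; first by rewrite /colouring /= ea !eqxx.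
  by case: u => [|b []] //= /andP[_ /eqP->].
apply/allpairsPdep/idP=> [[c [v [/= cc vv ->]]]|].
  rewrite mem_colours in cc; move: vv; rewrite IH // /colouring /= ea eqSS eqxx.
  by case/andP=> ->.
case: u => [|b [|c u]] //=.
case/andP=> h1 /eqP ab; rewrite ab in h1; move: h1; rewrite {b}ab.
rewrite /colouring /= eqSS => /and3P[h1 h2 /andP[h3 h4]].
exists c, (c :: u); rewrite mem_colours h3 IH //; split=> //=.
by rewrite /colouring /= h1 h3 h4 eqxx.
Qed.

Lemma colourings_from_head e n a u : u \in colourings_from e n a -> head 1%g u = a.
Proof.
by case: n => [|n] /=; [rewrite inE => /eqP-> | case/allpairsPdep=> [c [v [_ _ ->]]]].
Qed.

Lemma colourings_from_uniq e n a : uniq (colourings_from e n a).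
Proof.
elim: n e a => [|n IH] e a //=.
apply: allpairs_uniq_dep => [||]; rewrite ?colours_uniq //.
move=> x y /allpairsPdep[c [v [_ hv ->]]] /allpairsPdep[d [w [_ hw ->]]] /= [vw].
by rewrite vw -(colourings_from_head hv) vw (colourings_from_head hw).
Qed.

(** A maximum, a minimum and a box have the same rule for the slice that follows:
it agrees with [u] on the leftmost and on the rightmost region, and is
otherwise free. *)
Definition next_slices e n m u : seq (seq H) :=
  [seq v <- colourings_from e m (head 1%g u) | boundary e n m u v].

Lemma mem_next_slices e n m u v : (v \in next_slices e n m u) = boundary e n m u v.
Proof.
rewrite mem_filter; apply/andb_idr=> /and4P[/andP[su au] cv /eqP hh _].
rewrite mem_colourings_from ?cv ?hh //= -hh.
by case: u su au {hh} => //= a u _ /andP[].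
Qed.

Lemma next_slices_uniq e n m u : uniq (next_slices e n m u).
Proof. by rewrite filter_uniq ?colourings_from_uniq. Qed.

(** Cuts out of a slice the regions seen by a piece occupying the strings
[i, ..., i + k - 1].  There are [k.+1] of them, and neighbouring pieces share
the regions at the ends. *)
Lemma colouring_cat s m t i k : colouring s m t -> (i + k <= m)%N ->
  exists l u r, [/\ t = l ++ u ++ r, size l = i, colouring (s (+) odd i) k u
    & size r = (m - (i + k))%N].
Proof.
case/andP=> /eqP st at_ ikm.
exists (take i t), (take k.+1 (drop i t)), (drop k.+1 (drop i t)).
have il : size (take i t) = i by rewrite size_takel // st; lia.
rewrite !cat_take_drop.
split=> //; last by rewrite !size_drop st; lia.
rewrite /colouring size_takel ?size_drop ?st ?eqxx /=; last by lia.
move: at_; rewrite -[X in admissible _ X](cat_take_drop i t).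
rewrite -[X in admissible _ (_ ++ X)](cat_take_drop k.+1 (drop i t)).
by rewrite !admissible_cat il => /and3P[].
Qed.

End Colourings.

Section MoreBoundary.
Variable H : finGroupType.
Implicit Types (s e : bool) (t u v l r : seq H).

Lemma boundary_refl s m t : boundary s m m t t = colouring s m t.
Proof. by rewrite /boundary !eqxx !andbT andbb. Qed.

Lemma boundary_trans s m1 m2 m3 t u v :
  boundary s m1 m2 t u -> boundary s m2 m3 u v -> boundary s m1 m3 t v.
Proof.
rewrite /boundary => /and4P[-> _ /eqP-> /eqP->] /and4P[_ -> /eqP-> /eqP->].
by rewrite !eqxx.
Qed.

Lemma boundary_insert s m n k l u v r : odd n = odd k ->
  colouring s m (l ++ u ++ r) -> boundary (s (+) odd (size l)) n k u v ->
  boundary s m (m - n + k) (l ++ u ++ r) (l ++ v ++ r).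
Proof.
move=> nk cm /and4P[/andP[/eqP su au] /andP[/eqP sv av] /eqP huv /eqP luv].
rewrite /boundary cm /=.
case/andP: cm; rewrite /colouring !admissible_cat au av !size_cat su sv.
move=> /eqP sm /and3P[-> _]; rewrite /= nk => -> /=.
rewrite andbT; apply/and3P; split; first by apply/eqP; lia.
  by case: l {sm au av} => //=; case: u v su sv huv {luv} => [|a u] [|b v] //= _ _ ->.
by rewrite !last_cat; case: u v su sv luv {au av huv sm} => [|a u] [|b v] //= _ _ ->.
Qed.

End MoreBoundary.

Lemma odd_above_below (C : numClosedFieldType) (V : nat -> bool -> vectType C)
  (p : piece V) : odd (strings_above p) = odd (strings_below p).
Proof. by case: p. Qed.

(** * State sums *)

Section Spin.
Variables (C : numClosedFieldType) (H : finGroupType).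

Definition disc_boundary n e : finType :=
  {k : n.+1.-tuple H * n.+1.-tuple H | boundary e n n k.1 k.2}.

Definition spin (P : nat -> bool -> vectType C) n e : vectType C :=
  {ffun disc_boundary n e -> P n e}.

Section Entries.
Variables (P : nat -> bool -> vectType C) (n : nat) (e : bool).
Implicit Types (x y : spin P n e) (u v : seq H).

(** Entries are indexed by bare sequences and vanish outside the boundary
colourings, which spares the dependent pairs of [disc_boundary]. *)
Definition entry x u v : P n e :=
  if [pick k : disc_boundary n e | (tval (val k).1 == u) && (tval (val k).2 == v)]
  is Some k then x k else 0.

Definition of_entries (F : seq H -> seq H -> P n e) : spin P n e :=
  ([ffun k : disc_boundary n e => F (val k).1 (val k).2] : {ffun disc_boundary n e -> P n e}).

Lemma entry_val x (k : disc_boundary n e) : entry x (val k).1 (val k).2 = x k.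
Proof.
rewrite /entry; case: pickP => [k' /andP[/eqP h1 /eqP h2]|/(_ k)]; last by rewrite !eqxx.
congr (x _); apply: val_inj; apply/eqP; rewrite -pair_eqE; apply/andP.
by split; apply/eqP/val_inj.
Qed.

Lemma boundary_disc u v : boundary e n n u v ->
  exists k : disc_boundary n e, tval (val k).1 = u /\ tval (val k).2 = v.
Proof.
move=> b; case/and4P: (b) => /andP[su _] /andP[sv _] _ _.
by exists (@exist _ (fun k : n.+1.-tuple H * n.+1.-tuple H => boundary e n n k.1 k.2)
  (Tuple su, Tuple sv) b).
Qed.

Lemma entry_of F u v : boundary e n n u v -> entry (of_entries F) u v = F u v.
Proof. by case/boundary_disc=> k [<- <-]; rewrite entry_val ffunE. Qed.

Lemma spin_ext x y :
  (forall u v, boundary e n n u v -> entry x u v = entry y u v) -> x = y.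
Proof.
move=> xy; apply/ffunP=> k; rewrite -!entry_val; exact: xy (valP k).
Qed.

Lemma entryP c x y u v : entry (c *: x + y) u v = c *: entry x u v + entry y u v.
Proof.
by rewrite /entry; case: pickP => [k _|_]; rewrite ?ffunE // scaler0 addr0.
Qed.

Lemma entry0 u v : entry 0 u v = 0.
Proof. by have := entryP (-1) 0 0 u v; rewrite scaler0 addr0 scaleN1r addNr. Qed.

End Entries.

(** The fourth root of the order of H: a closed curve has one maximum and one
minimum, whose weights multiply to the square root of the order. *)
Definition spin_weight : C := sqrtC (sqrtC #|H|%:R).

(** The outer region of the extremum has shading [s (+) odd i].  If that
region is shaded, the inner one is coloured and brings a sum over H, which the
inverse weight compensates. *)
Definition piece_weight (V : nat -> bool -> vectType C) s (p : piece V) : C :=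
  match p with
  | Cap i | Cup i => if s (+) odd i then spin_weight^-1 else spin_weight
  | Box _ _ _ _ => 1
  end.

Definition weight (V : nat -> bool -> vectType C) s (w : diagram V) : C :=
  \prod_(p <- w) piece_weight s p.

Lemma card_gt0C : (0 : C) < #|H|%:R.
Proof. by rewrite ltr0n; apply/card_gt0P; exists 1%g. Qed.

Lemma spin_weight_gt0 : 0 < spin_weight.
Proof. by rewrite !sqrtC_gt0 card_gt0C. Qed.

Lemma spin_weight_neq0 : spin_weight != 0.
Proof. by rewrite gt_eqF ?spin_weight_gt0. Qed.

Lemma piece_weight_gt0 V s (p : piece V) : 0 < piece_weight s p.
Proof.
by case: p => [i|i|????] /=; rewrite ?ltr01 //; case: ifP; rewrite ?invr_gt0 ?spin_weight_gt0.
Qed.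

Lemma weight_gt0 V s (w : diagram V) : 0 < weight s w.
Proof. by rewrite /weight; elim/big_rec: _ => // p x _; apply: mulr_gt0; apply: piece_weight_gt0. Qed.

Lemma weight_cat V s (w1 w2 : diagram V) :
  weight s (w1 ++ w2) = weight s w1 * weight s w2.
Proof. exact: big_cat. Qed.

Lemma weight_shift V s d (w : diagram V) :
  weight s (map (shift d) w) = weight (s (+) odd d) w.
Proof.
rewrite /weight big_map; apply: eq_bigr => p _.
by case: p => //= i; rewrite oddD addbA.
Qed.

Variable P : planar_algebra C.
Local Notation Q := (spin P).
Implicit Types (s e : bool) (t u v l r b : seq H).

Definition component (p : piece Q) u v : piece P :=
  match p with
  | Cap i => Cap i
  | Cup i => Cup i
  | @Box _ _ i n e x => Box i (entry x u v)
  end.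

Lemma shape_component p u v : piece_shape (component p u v) = piece_shape p.
Proof. by case: p. Qed.

Section StateSum.
Variable W : lmodType C.

(** The sum runs over the colourings of the successive slices below [t].  The
continuation [F] receives the diagram over [P] selected by a colouring and the
last slice; working with continuations lets the diagram be evaluated inside any
larger one. *)
Fixpoint state_sum s (w : diagram Q) t (F : diagram P -> seq H -> W) : W :=
  if w is p :: w' then
    let i := piece_pos p in let a := strings_above p in
    let u := take a.+1 (drop i t) in
    \sum_(v <- next_slices (s (+) odd i) a (strings_below p) u)
      state_sum s w' (take i t ++ v ++ drop a.+1 (drop i t))
        (fun d b => F (component p u v :: d) b)
  else F [::] t.

Lemma state_sum_cons s p w l u r F :
  size l = piece_pos p -> size u = (strings_above p).+1 ->
  state_sum s (p :: w) (l ++ u ++ r) F =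
  \sum_(v <- next_slices (s (+) odd (piece_pos p)) (strings_above p) (strings_below p) u)
    state_sum s w (l ++ v ++ r) (fun d b => F (component p u v :: d) b).
Proof.
move=> sl su /=; rewrite -sl drop_size_cat // take_size_cat //.
by rewrite -su take_size_cat // drop_size_cat.
Qed.

(** Extensionality restricted to what can occur: diagrams of the shape of [w] and
slices compatible with [t]. *)
Lemma eq_state_sum s m m' w t F G :
  colouring s m t -> well_typed s m w m' ->
  (forall d b, map (@piece_shape C P) d = map (@piece_shape C Q) w ->
     boundary s m m' t b -> F d b = G d b) ->
  state_sum s w t F = state_sum s w t G.
Proof.
elim: w m t F G => [|p w IH] m t F G ct.
  by move/eqP=> <- FG; apply: FG; rewrite ?boundary_refl.
case/and3P=> fits _ wt FG.
have [l [u [r [tE sl cu sr]]]] := colouring_cat ct fits.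
rewrite tE !state_sum_cons //; try by case/andP: cu => /eqP.
apply: eq_big_seq => v; rewrite mem_next_slices => bv; rewrite tE in ct.
rewrite -sl in bv; have bt := boundary_insert (odd_above_below p) ct bv.
apply: (IH _ _ _ _ _ wt) => [|d b db bb]; first by case/and4P: bt.
apply: FG; rewrite /= ?shape_component ?db // tE.
exact: boundary_trans bt bb.
Qed.

Lemma state_sum_cat s w1 w2 t F :
  state_sum s (w1 ++ w2) t F =
  state_sum s w1 t (fun d1 b1 => state_sum s w2 b1 (fun d2 b2 => F (d1 ++ d2) b2)).
Proof.
elim: w1 t F => [|p w1 IH] t F //=.
by apply: eq_bigr => v _; rewrite IH.
Qed.

Lemma state_sum0 s w t : state_sum s w t (fun _ _ => 0) = 0.
Proof. by elim: w t => //= p w IH t; apply: big1. Qed.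

Lemma exchange_state_sum (I : Type) (k : seq I) s w t (F : I -> diagram P -> seq H -> W) :
  \sum_(i <- k) state_sum s w t (F i) =
  state_sum s w t (fun d b => \sum_(i <- k) F i d b).
Proof.
elim: w t F => [|p w IH] t F //=.
by rewrite exchange_big /=; apply: eq_bigr => v _; rewrite IH.
Qed.

Lemma state_sum_fubini s w t s' w' t' (F : diagram P -> seq H -> diagram P -> seq H -> W) :
  state_sum s w t (fun d b => state_sum s' w' t' (F d b)) =
  state_sum s' w' t' (fun d' b' => state_sum s w t (fun d b => F d b d' b')).
Proof.
elim: w t F => [|p w IH] t F //=.
by rewrite -exchange_state_sum; apply: eq_bigr => v _; rewrite IH.
Qed.

Lemma state_sumP c s w t (F G : diagram P -> seq H -> W) :
  state_sum s w t (fun d b => c *: F d b + G d b) =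
  c *: state_sum s w t F + state_sum s w t G.
Proof.
elim: w t F G => [|p w IH] t F G //=.
by rewrite scaler_sumr -big_split; apply: eq_bigr => v _; rewrite IH.
Qed.

(** Locality: strings placed on the left and on the right of a diagram do not
take part in the sum. *)
Lemma state_sum_shift s w l t r m m' F :
  colouring (s (+) odd (size l)) m t -> well_typed (s (+) odd (size l)) m w m' ->
  state_sum s (map (shift (size l)) w) (l ++ t ++ r) F =
  state_sum (s (+) odd (size l)) w t (fun d b => F (map (shift (size l)) d) (l ++ b ++ r)).
Proof.
elim: w m t F => [|p w IH] m t F ct //; case/and3P=> fits _ wt.
have [l1 [u [r1 [tE sl cu sr]]]] := colouring_cat ct fits.
have su : size u = (strings_above p).+1 by case/andP: cu => /eqP.
rewrite tE state_sum_cons // map_cons.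
have -> : l ++ (l1 ++ u ++ r1) ++ r = (l ++ l1) ++ u ++ (r1 ++ r) by rewrite -!catA.
rewrite state_sum_cons ?size_cat ?sl ?shift_pos ?shift_above // shift_below.
rewrite oddD addbA; apply: eq_big_seq => v; rewrite mem_next_slices => bv.
have -> : (l ++ l1) ++ v ++ r1 ++ r = l ++ (l1 ++ v ++ r1) ++ r by rewrite -!catA.
rewrite -sl tE in bv ct.
have /and4P[_ cv _ _] := boundary_insert (odd_above_below p) ct bv.
by rewrite (IH _ _ _ cv wt); case: p {fits wt sl cu su bv cv sr ct}.
Qed.

End StateSum.

Lemma state_sum_additive (W W' : lmodType C) (f : W -> W') s w t F :
  (forall x y, f (x + y) = f x + f y) ->
  f (state_sum s w t F) = state_sum s w t (fun d b => f (F d b)).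
Proof.
move=> lf; have f0 : f 0 = 0.
  by have := lf 0 0; rewrite addr0 => /esym/eqP; rewrite -subr_eq0 addrK => /eqP.
elim: w t F => [|p w IH] t F //=.
rewrite (big_morph f (id1 := 0) (op1 := +%R)) //.
by apply: eq_bigr => v _; rewrite IH.
Qed.

(** The matrix coefficient of the state sum between the slices [t] and [b]. *)
Definition amplitude n s w t b : P n s :=
  state_sum s w t (fun d b' => if b' == b then act n s d else 0).

Definition spin_act n s (w : diagram Q) : Q n s :=
  of_entries (fun t b => weight s w *: amplitude n s w t b).

Lemma entry_spin_act n s w t b : boundary s n n t b ->
  entry (spin_act n s w) t b = weight s w *: amplitude n s w t b.
Proof. exact: entry_of. Qed.

End Spin.
Arguments state_sum {C H P W} s w t F : simpl never.

(** * Invariance of state sums under isotopy *)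

Section Isotopy.
Variables (C : numClosedFieldType) (H : finGroupType) (P : planar_algebra C).
Local Notation Q := (spin H P).
Implicit Types (s e : bool) (t u v l r b : seq H).

Lemma big_next_slices_cap (W : nmodType) e (a : H) (F : seq H -> W) :
  e ==> (a == 1%g) ->
  \sum_(v <- next_slices e 0 2 [:: a]) F v = \sum_(c <- colours H (~~ e)) F [:: a; c; a].
Proof.
move=> ea; rewrite -(big_map (fun c => [:: a; c; a]) predT F).
apply: perm_big; apply: uniq_perm; rewrite ?next_slices_uniq //.
  by rewrite map_inj_uniq ?colours_uniq // => x y [].
move=> v; rewrite mem_next_slices; apply/idP/mapP => [|[c cc ->]].
  case: v => [|x [|c [|y [|z v]]]]; rewrite /boundary /colouring /= ?andbF //.
  case/and4P=> _ /and4P[_ hc _ _] /eqP <- /eqP <-; exists c => //.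
  by rewrite mem_colours.
rewrite mem_colours in cc.
by rewrite /boundary /colouring /= ea cc negbK ea !eqxx.
Qed.

Lemma big_next_slices_cup (W : nmodType) e (a c b : H) (F : seq H -> W) :
  colouring e 2 [:: a; c; b] ->
  \sum_(v <- next_slices e 2 0 [:: a; c; b]) F v = if a == b then F [:: a] else 0.
Proof.
move=> cu; have -> : (if a == b then F [:: a] else 0) =
    \sum_(v <- if a == b then [:: [:: a]] else [::]) F v.
  by case: ifP; rewrite ?big_seq1 ?big_nil.
apply: perm_big; apply: uniq_perm; rewrite ?next_slices_uniq //; first by case: ifP.
move=> v; rewrite mem_next_slices /boundary cu /=; move: cu; rewrite /colouring /= => /andP[ea _].
apply/idP/idP.
  case: v => [|x [|y v]] //; case/and3P=> _ /= /eqP-> /eqP->.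
  by rewrite eqxx inE.
by case: eqP => [<- |] //; rewrite inE => /eqP-> /=; rewrite /colouring /= ea eqxx.
Qed.

Section Local.
Variables (W : lmodType C).
Implicit Type K : diagram P -> seq H -> W.

(** The only surviving colour of the region inside the maximum is the one that
the minimum identifies with its right-hand neighbour. *)
Lemma state_sum_straighten_left s m i t K :
  well_typed s m [:: Cap (V := Q) i; Cup i.+1] m -> colouring s m t ->
  K [:: Cap i; Cup i.+1] t = K [::] t ->
  state_sum s [:: Cap (V := Q) i; Cup i.+1] t K = K [::] t.
Proof.
rewrite /= => /andP[fits /andP[fits2 _]] ct <-.
have i1 : (i + 1 <= m)%N by lia.
have [l [u [r [tE sl cu sr]]]] := colouring_cat ct i1.
case: u cu tE => [|a [|b [|]]] //; rewrite /colouring /= => /and3P[ea eb _] tE.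
have tE' : t = l ++ [:: a] ++ ([:: b] ++ r) by rewrite tE.
rewrite [in LHS]tE' state_sum_cons //.
rewrite big_next_slices_cap //.
have big1E (c : H) : c \in colours H (~~ (s (+) odd i)) ->
   state_sum s [:: Cup i.+1] (l ++ [:: a; c; a] ++ [:: b] ++ r)
    (fun d b0 => K (component (Cap (V := Q) i) [:: a] [:: a; c; a] :: d) b0) =
   if c == b then K [:: Cap i; Cup i.+1] t else 0.
  rewrite mem_colours => hc.
  have -> : l ++ [:: a; c; a] ++ [:: b] ++ r = (l ++ [:: a]) ++ [:: c; a; b] ++ r.
    by rewrite -!catA.
  rewrite state_sum_cons ?size_cat ?sl ?addn1 //= addbN big_next_slices_cup //.
    by rewrite tE -catA; case: eqP => // ->.
  by rewrite /colouring /= hc negbK ea eb.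
rewrite (eq_big_seq _ big1E) (bigD1_seq b) ?colours_uniq ?mem_colours //= eqxx.
by rewrite big1 ?addr0 // => c /negPf->.
Qed.

Lemma state_sum_straighten_right s m i t K :
  well_typed s m [:: Cap (V := Q) i.+1; Cup i] m -> colouring s m t ->
  K [:: Cap i.+1; Cup i] t = K [::] t ->
  state_sum s [:: Cap (V := Q) i.+1; Cup i] t K = K [::] t.
Proof.
move=> /andP[/= fits _] ct <-.
have i1 : (i + 1 <= m)%N by lia.
have [l [u [r [tE sl cu sr]]]] := colouring_cat ct i1.
case: u cu tE => [|a [|b [|]]] //; rewrite /colouring /= => /and3P[ea eb _] tE.
have tE' : t = (l ++ [:: a]) ++ [:: b] ++ r by rewrite tE -catA.
have sla : size (l ++ [:: a]) = i.+1 by rewrite size_cat sl addn1.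
rewrite [in LHS]tE' state_sum_cons //= addbN big_next_slices_cap // negbK.
have big1E (c : H) : c \in colours H (s (+) odd i) ->
   state_sum s [:: Cup i] ((l ++ [:: a]) ++ [:: b, c, b & r])
    (fun d b0 => K (Cap i.+1 :: d) b0) =
   if c == a then K [:: Cap i.+1; Cup i] t else 0.
  rewrite mem_colours => hc.
  have -> : (l ++ [:: a]) ++ [:: b, c, b & r] = l ++ [:: a; b; c] ++ (b :: r).
    by rewrite -!catA.
  rewrite state_sum_cons ?sl //= big_next_slices_cup //.
    by rewrite tE eq_sym; case: eqP => // ->.
  by rewrite /colouring /= negbK hc eb ea.
rewrite (eq_big_seq _ big1E) (bigD1_seq a) ?colours_uniq ?mem_colours //= eqxx.
by rewrite big1 ?addr0 // => c /negPf->.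
Qed.

(** Pieces lying side by side change disjoint sets of regions, so the two sums
commute. *)
Lemma state_sum_exchange s m m' p q t K :
  let w := [:: p; shift (piece_pos p + strings_below p) q] in
  let w' := [:: shift (piece_pos p + strings_above p) q; p] in
  well_typed s m w m' -> colouring s m t ->
  (forall d d' b, isotopy_move d d' ->
    map (@piece_shape C P) d = map (@piece_shape C Q) w ->
    map (@piece_shape C P) d' = map (@piece_shape C Q) w' ->
    boundary s m m' t b -> K d b = K d' b) ->
  state_sum s w t K = state_sum s w' t K.
Proof.
move=> w w' wt ct KE; have wt' := wt.
move: wt' => /and3P[fits1 _ /and3P[fits2 _ _]].
rewrite shift_pos shift_above in fits2.
(* [p] sees the regions [u] and [q] those of [u2]; the last region of [u] may be
   the first of [u2], but neither piece changes it. *)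
have [l [u [r [tE sl cu sr]]]] := colouring_cat ct fits1.
have su : size u = (strings_above p).+1 by case/andP: cu => /eqP.
case/lastP: u su cu tE => [|u0 x] //; rewrite size_rcons => -[su] cu tE.
have cz : colouring (s (+) odd (piece_pos p + strings_above p))
    (m - (piece_pos p + strings_above p)) (x :: r).
  rewrite /colouring /= sr eqxx /=; case/andP: ct => _.
  rewrite tE -cats1 !admissible_cat size_cat /= sl su addn1 oddD !addbA.
  by rewrite andbT /= addbN => /and3P[_ /andP[_ ->] ->].
have fits2' : (piece_pos q + strings_above q <= m - (piece_pos p + strings_above p))%N.
  by move: fits1 fits2; lia.
have [l2 [u2 [r2 [zE sl2 cu2 _]]]] := colouring_cat cz fits2'.
have su2 : size u2 = (strings_above q).+1 by case/andP: cu2 => /eqP.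
have xz v2 : boundary (s (+) odd (piece_pos p) (+) odd (strings_above p) (+) odd (piece_pos q))
    (strings_above q) (strings_below q) u2 v2 ->
    l2 ++ v2 ++ r2 = x :: behead (l2 ++ v2 ++ r2).
  rewrite -sl2 -[s (+) _ (+) odd (strings_above p)]addbA -oddD.
  rewrite zE in cz; move/(boundary_insert (odd_above_below q) cz) => /and4P[_ /andP[sz _] /eqP hz _].
  by rewrite -zE /= in hz; rewrite hz; case: (l2 ++ v2 ++ r2) sz.
rewrite {1}tE state_sum_cons ?size_rcons ?su //.
transitivity (\sum_(v <- next_slices (s (+) odd (piece_pos p)) (strings_above p)
    (strings_below p) (rcons u0 x))
  \sum_(v2 <- next_slices (s (+) odd (piece_pos p + strings_above p + piece_pos q))
      (strings_above q) (strings_below q) u2)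
  K [:: component p (rcons u0 x) v; shift (piece_pos p + strings_below p) (component q u2 v2)]
     (l ++ v ++ behead (l2 ++ v2 ++ r2))).
  apply: eq_big_seq => v; rewrite mem_next_slices => bv.
  case/lastP: v bv => [|v0 y] bv; first by case/and4P: bv.
  have yx : y = x by case/and4P: bv => _ _ _; rewrite !last_rcons => /eqP.
  have sv : size v0 = strings_below p.
    by case/and4P: bv => _ /andP[]; rewrite size_rcons eqSS => /eqP.
  rewrite {}yx in bv *.
  have -> : l ++ rcons v0 x ++ r = (l ++ v0 ++ l2) ++ u2 ++ r2.
    by rewrite cat_rcons zE -!catA.
  rewrite state_sum_cons ?shift_pos ?shift_above ?size_cat ?sl ?sv ?sl2 ?addnA //.
  rewrite shift_below !oddD !addbA -(odd_above_below p) -!addbA.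
  apply: eq_big_seq => v2; rewrite mem_next_slices !addbA => bv2.
  rewrite /state_sum; congr (K _ _); first by case: (q).
  by rewrite -!catA [l2 ++ _](xz _ bv2) cat_rcons.
rewrite exchange_big /=.
have tE2 : t = (l ++ u0 ++ l2) ++ u2 ++ r2 by rewrite tE cat_rcons zE -!catA.
rewrite [in RHS]tE2 state_sum_cons ?shift_pos ?shift_above ?size_cat ?sl ?su ?sl2 ?addnA //.
rewrite shift_below !oddD !addbA; apply: eq_big_seq => v2; rewrite mem_next_slices => bv2.
have -> : (l ++ u0 ++ l2) ++ v2 ++ r2 = l ++ rcons u0 x ++ behead (l2 ++ v2 ++ r2).
  by rewrite -!catA [in LHS](xz _ bv2) cat_rcons.
rewrite state_sum_cons ?size_rcons ?su //.
apply: eq_big_seq => v; rewrite mem_next_slices => bv.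
rewrite /state_sum.
have -> : component (shift (piece_pos p + strings_above p) q) u2 v2 =
          shift (piece_pos p + strings_above p) (component q u2 v2) by case: (q).
have sh := shape_component p (rcons u0 x) v.
rewrite -(eq_shape_pos sh) -(eq_shape_below sh) -(eq_shape_above sh).
have shq := shape_component q u2 v2.
apply: KE; first exact: Exchange_heights.
- by rewrite /= (eq_shape_pos sh) (eq_shape_below sh) sh (eq_shape_shift _ shq).
- by rewrite /= (eq_shape_pos sh) (eq_shape_above sh) sh (eq_shape_shift _ shq).
have ct1 := ct; rewrite tE2 in ct1.
have s1 : size (l ++ u0 ++ l2) = (piece_pos p + strings_above p + piece_pos q)%N.
  by rewrite !size_cat sl su sl2 addnA.
have b1 : boundary s m (m - strings_above q + strings_below q) t
    (l ++ rcons u0 x ++ behead (l2 ++ v2 ++ r2)).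
  rewrite tE2 cat_rcons -(xz _ bv2).
  have -> : l ++ u0 ++ l2 ++ v2 ++ r2 = (l ++ u0 ++ l2) ++ v2 ++ r2 by rewrite -!catA.
  by apply: boundary_insert ct1 _; rewrite ?odd_above_below // s1 !oddD !addbA.
apply: (boundary_trans b1); case/and4P: b1 => _ c1 _ _.
rewrite -sl in bv; have b2 := boundary_insert (odd_above_below p) c1 bv.
have -> : m' = (m - strings_above q + strings_below q - strings_above p + strings_below p)%N.
  by move: (well_typed_after wt) fits1 fits2'; rewrite /= shift_above shift_below; lia.
exact: b2.
Qed.

(** Nested maxima opened in a region of colour [a] insert a palindrome: a path [u]
of colours going in, then the same path coming out. *)
Lemma state_sum_caps s i n l a r K : size l = i -> s (+) odd i ==> (a == 1%g) ->
  state_sum s (caps Q i n) (l ++ a :: r) K =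
  \sum_(u <- colourings_from (s (+) odd i) n a)
    K (caps P i n) (l ++ u ++ behead (rev u) ++ r).
Proof.
elim: n i l a r K => [|n IH] i l a r K sl ea; first by rewrite big_seq1.
rewrite -/([:: a] ++ r) state_sum_cons ?sl // big_next_slices_cap //.
rewrite big_allpairs_dep /=; apply: eq_big_seq => c; rewrite mem_colours => ec.
rewrite -/(caps Q i.+1 n).
have -> : l ++ [:: a, c, a & r] = rcons l a ++ c :: a :: r by rewrite cat_rcons.
have h : s (+) odd i.+1 ==> (c == 1%g) by rewrite /= addbN.
rewrite IH ?size_rcons ?sl //= addbN; apply: eq_big_seq => u hu.
rewrite cat_rcons; congr (K _ (l ++ a :: u ++ _)).
have : rev u != [::].
  have := colourings_from_head hu; case: (u) hu => [|x v _ _].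
    by rewrite mem_colourings_from // /colouring.
  by rewrite -size_eq0 size_rev.
by rewrite rev_cons; case: (rev u) => //= x v _; rewrite cat_rcons.
Qed.

Lemma cups_recl (V : nat -> bool -> vectType C) i n :
  cups V i n.+1 = cups V i.+1 n ++ [:: Cup i].
Proof. by rewrite /cups /= rev_cons -cats1. Qed.

(** Nested minima survive only on palindromes, which they close up to their first
colour. *)
Lemma state_sum_cups s i n l u v r K :
  size l = i -> size u = n.+1 -> size v = n ->
  admissible (s (+) odd i) (u ++ v) ->
  state_sum s (cups Q i n) (l ++ u ++ v ++ r) K =
  if v == behead (rev u) then K (cups P i n) (l ++ head 1%g u :: r) else 0.
Proof.
elim: n i l u v r K => [|n IH] i l u v r K sl.
  by case: u v => [|a []] // [].
case: u => // a u; case/lastP: v => // v b [su]; rewrite size_rcons => -[sv] auv.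
have -> : l ++ (a :: u) ++ rcons v b ++ r = rcons l a ++ u ++ v ++ (b :: r).
  by rewrite !cat_rcons.
have auv' : admissible (s (+) odd i.+1) (u ++ v).
  by move: auv; rewrite /= addbN -rcons_cat -cats1 admissible_cat => /and3P[].
rewrite cups_recl state_sum_cat IH ?size_rcons ?sl //.
case: u su auv' auv => // c u [su] auv' auv.
have -> : (rcons v b == behead (rev [:: a, c & u])) =
   (v == behead (rev (c :: u))) && (b == a).
  have : rev (c :: u) != [::] by rewrite -size_eq0 size_rev.
  by rewrite [rev [:: a, c & u]]rev_cons; case: (rev (c :: u)) => //= x w _;
    rewrite eqseq_rcons.
case: eqP => //= vE.
rewrite cat_rcons -/([:: a; c; b] ++ r) state_sum_cons //=.
rewrite big_next_slices_cup; last first.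
  move: auv; rewrite /colouring /= => /and3P[-> -> ] /=.
  rewrite -cats1 catA admissible_cat /= size_cat su sv addnn odd_double addbF.
  by case/andP.
rewrite eq_sym; case: eqP => // _.
by rewrite /state_sum cups_recl.
Qed.

Lemma colourings_fromP e n (a : H) u :
  e ==> (a == 1%g) -> u \in colourings_from e n a ->
  [/\ size u = n.+1, admissible e u & head 1%g u = a].
Proof. by move=> ea; rewrite mem_colourings_from // => /andP[/andP[/eqP ? ?] /eqP]. Qed.

Lemma head_rev (u : seq H) : head 1%g (rev u) = last 1%g u.
Proof. by case/lastP: u => // u x; rewrite rev_rcons last_rcons. Qed.

Lemma last_rev (u : seq H) : last 1%g (rev u) = head 1%g u.
Proof. by rewrite -head_rev revK. Qed.

Lemma big_seq_if_eq (T : eqType) (rs : seq T) w (X : W) : uniq rs ->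
  \sum_(v <- rs) (if v == w then X else 0) = if w \in rs then X else 0.
Proof.
move=> us; case: ifP => [wr|/negP wr].
  by rewrite (bigD1_seq w) //= eqxx big1 ?addr0 // => v /negPf->.
by apply: big1_seq => v /= vr; case: eqP => // vw; rewrite -vw in wr.
Qed.

Lemma colouring_rev e n u : colouring e n (rev u) = colouring (e (+) odd n) n u.
Proof.
rewrite /colouring size_rev; case: eqP => //= su.
by rewrite admissible_rev su /= negbK.
Qed.

Lemma boundary_rev e n u v :
  boundary e n n (rev u) (rev v) = boundary (e (+) odd n) n n u v.
Proof.
rewrite /boundary !colouring_rev !head_rev !last_rev; congr [&& _, _ & _].
exact: andbC.
Qed.

Lemma big_next_slices_rev e n u (F : seq H -> W) :
  \sum_(c <- next_slices e n n (rev u)) F (rev c) = \sum_(b <- next_slices (e (+) odd n) n n u) F b.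
Proof.
rewrite -(big_map rev predT F); apply: perm_big; apply: uniq_perm.
- by rewrite (map_inj_uniq (inv_inj revK)) next_slices_uniq.
- exact: next_slices_uniq.
move=> v; rewrite -{1}[v]revK (mem_map (inv_inj revK)) !mem_next_slices.
by rewrite -boundary_rev.
Qed.

(** A half turn carries the slice [u] to any compatible slice [b] and shows the
box both slices upside down and in reverse order.  The counterclockwise half
turn has the same expression, which is invariance under a full turn. *)
Lemma state_sum_half_turn_cw s i n e (x : Q n e) m l u r K :
  size l = i -> e = s (+) odd (i + n) -> colouring s m (l ++ u ++ r) ->
  size u = n.+1 ->
  state_sum s (half_turn_cw i x) (l ++ u ++ r) K =
  \sum_(b <- next_slices (s (+) odd i) n n u)
    K (half_turn_cw i (entry x (rev b) (rev u))) (l ++ b ++ r).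
Proof.
move=> sl ee cm su; have adm : admissible (s (+) odd i) u.
  by case/andP: cm => _; rewrite !admissible_cat sl => /and3P[].
have sne (w : seq H) : size w = n.+1 -> w != [::] by case: w.
have admz : e ==> (last 1%g u == 1%g).
  case/lastP: u su adm {cm} => // u z; rewrite size_rcons => -[su].
  rewrite last_rcons -cats1 admissible_cat su /= andbT => /andP[_ h].
  rewrite ee oddD addbA; exact: h.
set z := last 1%g u in admz *.
have uE : u = rcons (take n u) z.
  rewrite /z; case/lastP: u su {adm admz cm z} => // u y; rewrite size_rcons => -[su].
  by have := take_size_cat [:: y] su; rewrite last_rcons cats1 => ->.
have su0 : size (take n u) = n by rewrite size_takel // su.
have -> : l ++ u ++ r = (l ++ take n u) ++ z :: r by rewrite {1}uE cat_rcons catA.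
rewrite /half_turn_cw state_sum_cat state_sum_caps -?ee ?size_cat ?sl ?su0 //.
transitivity (\sum_(c <- colourings_from e n z | boundary e n n c (rev u))
  K (half_turn_cw i (entry x c (rev u))) (l ++ rev c ++ r)).
  rewrite [RHS]big_mkcond; apply: eq_big_seq => c /(colourings_fromP admz)[sc ac hc].
  rewrite state_sum_cons ?size_cat ?sl ?su0 //= -ee.
  transitivity (\sum_(v <- next_slices e n n c) if v == rev u then
      K (half_turn_cw i (entry x c (rev u))) (l ++ rev c ++ r) else 0).
    apply: eq_big_seq => v; rewrite mem_next_slices => bv.
    have [/andP[/eqP sv av] hv lv] : [/\ colouring e n v, head 1%g v = z & last 1%g v = last 1%g c].
      by case/and4P: bv => _ cv /eqP <- /eqP ->; split.
    have vE : v = z :: behead v by rewrite -hv; case: (v) sv.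
    have rc : rev c != [::] by rewrite sne ?size_rev.
    have -> : (l ++ take n u) ++ v ++ behead (rev c) ++ r =
      l ++ u ++ (behead v ++ behead (rev c)) ++ r.
      by rewrite {1}vE -!catA; congr (_ ++ _); rewrite [in RHS]uE cat_rcons.
    rewrite -[(behead v ++ _) ++ r]catA state_sum_cups ?size_behead ?sv //; last first.
      have : admissible (s (+) odd i) (take n u ++ v).
        rewrite admissible_cat su0 -addbA -oddD -ee av andbT.
        by move: adm; rewrite {1}uE -cats1 admissible_cat => /andP[].
      by rewrite vE -cat_rcons -uE.
    have ruE : rev u = z :: behead (rev u).
      have : rev u != [::] by rewrite sne ?size_rev.
      by rewrite /z -head_rev; case: (rev u).
    have -> : (behead v == behead (rev u)) = (v == rev u).
      by rewrite vE ruE eqseq_cons eqxx.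
    case: eqP => // vu; rewrite /half_turn_cw vu; congr (K _ (_ ++ _)).
    rewrite -last_rev -vu lv -head_rev; by case: (rev c) rc.
  rewrite big_seq_if_eq ?next_slices_uniq // mem_next_slices.
  by [].
(* The slice [c] created by the maxima lies on top of the box; the box is seen with
   [rev u] at its bottom, and [rev c] is the final slice. *)
pose G b := K (half_turn_cw i (entry x (rev b) (rev u))) (l ++ b ++ r).
transitivity (\sum_(c <- next_slices e n n (rev u)) G (rev c)).
  rewrite [RHS]big_filter /z head_rev /G.
  by apply: eq_big => [c|c _]; rewrite ?revK // boundary_sym.
rewrite big_next_slices_rev; congr (\sum_(b <- next_slices _ n n u) _).
by rewrite ee oddD -!addbA addbb addbF.
Qed.

Lemma state_sum_half_turn_ccw s i n e (x : Q n e) m l u r K :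
  size l = i -> e = s (+) odd (i + n) -> colouring s m (l ++ u ++ r) ->
  size u = n.+1 ->
  state_sum s (half_turn_ccw i x) (l ++ u ++ r) K =
  \sum_(b <- next_slices (s (+) odd i) n n u)
    K (half_turn_ccw i (entry x (rev b) (rev u))) (l ++ b ++ r).
Proof.
move=> sl ee cm su; have adm : admissible (s (+) odd i) u.
  by case/andP: cm => _; rewrite !admissible_cat sl => /and3P[].
case: u su adm cm => // a u su adm cm.
have adma : s (+) odd i ==> (a == 1%g) by case/andP: adm.
rewrite /half_turn_ccw state_sum_cat state_sum_caps ?sl //.
rewrite [RHS]big_filter [RHS]big_mkcond.
apply: eq_big_seq => c /(colourings_fromP adma)[sc ac hc].
have [c0 [y cE]] : exists c0 y, c = rcons c0 y.
  by case/lastP: c sc {ac hc} => // c0 y _; exists c0, y.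
have sc0 : size c0 = n by move: sc; rewrite cE size_rcons => -[].
have rcE : rev c = y :: behead (rev c) by rewrite cE rev_rcons.
have -> : l ++ c ++ behead (rev c) ++ u ++ r = (l ++ c0) ++ rev c ++ (u ++ r).
  by rewrite {1}cE rcE -!catA cat_rcons.
rewrite state_sum_cons ?size_cat ?sl ?sc0 ?size_rev //= -ee.
transitivity (\sum_(v <- next_slices e n n (rev c)) if v == rev (a :: u) then
    K (half_turn_ccw i (entry x (rev c) (rev (a :: u)))) (l ++ c ++ r) else 0).
  apply: eq_big_seq => v; rewrite mem_next_slices => bv.
  have [/andP[/eqP sv av] hv lv] : [/\ colouring e n v, head 1%g v = y & last 1%g v = a].
    case/and4P: bv => _ cv /eqP <- /eqP <-; split=> //; first by rewrite rcE.
    by rewrite last_rev hc.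
  have su' : size u = n by case: su.
  rewrite -/(cups Q (i + n) n) state_sum_cups ?size_cat ?sl ?sc0 //; last first.
    rewrite -ee; case/lastP: v {bv} sv av hv lv => // v b; rewrite size_rcons => -[sv].
    rewrite last_rcons => + _ ba; rewrite ba cat_rcons -cats1 !admissible_cat sv.
    by case/andP=> -> _; rewrite ee oddD -!addbA addbb addbF.
  have -> : (u == behead (rev v)) = (v == rev (a :: u)).
    have rvE : rev v = a :: behead (rev v).
      have : rev v != [::] by rewrite -size_eq0 size_rev sv.
      by rewrite -lv -head_rev; case: (rev v).
    by rewrite -{2}[v]revK (inj_eq (inv_inj revK)) rvE eqseq_cons eqxx eq_sym.
  by case: eqP => // <-; rewrite hv cE -!catA cat_rcons.
rewrite big_seq_if_eq ?next_slices_uniq // mem_next_slices boundary_rev boundary_sym.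
have -> : e (+) odd n = s (+) odd i by rewrite ee oddD -!addbA addbb addbF.
by [].
Qed.

Lemma well_typed_caps (V : nat -> bool -> vectType C) s m j n (w : diagram V) m' :
  well_typed s m (caps V j n ++ w) m' ->
  (0 < n -> j <= m)%N /\ well_typed s (m + n.*2) w m'.
Proof.
elim: n j m => [|n IH] j m /=; first by rewrite addn0.
case/andP; rewrite addn0 => jm; rewrite -/(caps V j.+1 n) => /IH[_].
by rewrite subn0 -addnA doubleS add2n.
Qed.

Lemma shape_caps (V : nat -> bool -> vectType C) i n :
  map (@piece_shape C V) (caps V i n) = [seq inl (inl j) | j <- iota i n].
Proof. by rewrite -map_comp. Qed.

Lemma shape_cups (V : nat -> bool -> vectType C) i n :
  map (@piece_shape C V) (cups V i n) = rev [seq inl (inr j) | j <- iota i n].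
Proof. by rewrite /cups map_rev -map_comp. Qed.

Lemma strings_after_cups (V : nat -> bool -> vectType C) m i n :
  strings_after m (cups V i n) = (m - n.*2)%N.
Proof.
elim: n i m => [|n IH] i m; first by rewrite subn0.
rewrite cups_recl /strings_after foldl_cat /=.
have := IH i.+1 m; rewrite /strings_after => ->; rewrite doubleS; lia.
Qed.

(** One generating move inside a context [K] that is itself invariant under
isotopy of the diagram over [P]. *)
Lemma state_sum_isotopy s m w w' m' t K :
  isotopy_move w w' -> well_typed s m w m' -> well_typed s m w' m' ->
  colouring s m t ->
  (forall d d' b, isotopy_move d d' ->
    map (@piece_shape C P) d = map (@piece_shape C Q) w ->
    map (@piece_shape C P) d' = map (@piece_shape C Q) w' ->
    boundary s m m' t b -> K d b = K d' b) ->
  state_sum s w t K = state_sum s w' t K.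
Proof.
case: w w' / => [p q|i|i|i n e x] w1 w2 ct KE.
- exact: state_sum_exchange w1 ct KE.
- have mm : m = m' by apply/eqP: w2.
  rewrite -mm in w1 KE; rewrite (state_sum_straighten_left w1 ct) //.
  by apply: KE => //; [apply: Straighten_left | rewrite boundary_refl].
- have mm : m = m' by apply/eqP: w2.
  rewrite -mm in w1 KE; rewrite (state_sum_straighten_right w1 ct) //.
  by apply: KE => //; [apply: Straighten_right | rewrite boundary_refl].
have [im /and3P[im2 /eqP ee wt]] := well_typed_caps w1.
have inm : (i + n <= m)%N.
  have im2' : (i + n + n <= m + n.*2)%N := im2.
  by case: (posnP n) => [n0|/im //]; move: im2'; rewrite n0; lia.
have [l [u [r [tE sl cu sr]]]] := colouring_cat ct inm.
have su : size u = n.+1 by case/andP: cu => /eqP.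
rewrite tE in ct *.
rewrite (state_sum_half_turn_cw x K sl ee ct su) (state_sum_half_turn_ccw x K sl ee ct su).
apply: eq_big_seq => b; rewrite mem_next_slices => bb; apply: KE; first exact: Full_turn.
- by rewrite !map_cat /= !shape_caps !shape_cups.
- by rewrite !map_cat /= !shape_caps !shape_cups.
have mm' : m' = m.
  rewrite -(well_typed_after wt) strings_after_cups /=; lia.
rewrite -sl in bb; have := boundary_insert erefl ct bb; rewrite mm'.
have nm : (n <= m)%N by lia.
by rewrite subnK // tE.
Qed.

End Local.
End Isotopy.

(** * The spin extension of a planar algebra *)

Section SpinPlanar.
Variables (C : numClosedFieldType) (H : finGroupType).

Lemma weight_cons (V : nat -> bool -> vectType C) s p (w : diagram V) :
  weight H s (p :: w) = piece_weight H s p * weight H s w.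
Proof. exact: big_cons. Qed.

(** Straightening pairs one maximum with one minimum whose outer regions have
opposite shadings; the two half turns of a box have the same extrema. *)
Lemma weight_isotopy (V : nat -> bool -> vectType C) s (w w' : diagram V) :
  isotopy_move w w' -> weight H s w = weight H s w'.
Proof.
have caps_w j n : weight H s (caps V j n) = \prod_(k <- iota j n) piece_weight H s (Cap (V := V) k).
  by rewrite /weight big_map.
have cups_w j n : weight H s (cups V j n) = weight H s (caps V j n).
  by rewrite /weight /cups -map_rev !big_map; apply: perm_big; rewrite perm_rev.
case: w w' / => [p q|i|i|i n e x].
- rewrite !weight_cons mulrCA; congr (_ * (_ * _)).
  by case: q => //= i; rewrite !oddD (odd_above_below p).
- rewrite !weight_cons /weight !big_nil /= mulr1 addbN.
  by case: (s (+) odd i); rewrite /= ?mulfV ?mulVf ?spin_weight_neq0.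
- rewrite !weight_cons /weight !big_nil /= mulr1 addbN.
  by case: (s (+) odd i); rewrite /= ?mulfV ?mulVf ?spin_weight_neq0.
- rewrite !weight_cat !weight_cons /= !cups_w !mul1r; exact: mulrC.
Qed.

(** A diagram can be read from the bottom: this recovers the number of strings
after a subdiagram replaced by an isotopic one. *)
Lemma well_typed_inj (V : nat -> bool -> vectType C) s m1 m2 (w : diagram V) m :
  well_typed s m1 w m -> well_typed s m2 w m -> m1 = m2.
Proof.
elim: w m1 m2 => [|p w IH] m1 m2 /=; first by move=> /eqP-> /eqP->.
case/and3P=> h1 _ w1 /and3P[h2 _ w2]; have := IH _ _ w1 w2; lia.
Qed.

Lemma eq_shape_tangle (V V' : nat -> bool -> vectType C) n s
    (w : diagram V) (w' : diagram V') :
  map (@piece_shape C V) w = map (@piece_shape C V') w' ->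
  tangle n s w = tangle n s w'.
Proof. exact: eq_shape_typed. Qed.

Variable P : planar_algebra C.
Local Notation Q := (spin H P).

Lemma amplitude_context n s (a w c : diagram Q) t b :
  amplitude n s (a ++ w ++ c) t b =
  state_sum s a t (fun d1 t1 => state_sum s w t1 (fun d t2 =>
    state_sum s c t2 (fun d2 b' => if b' == b then act n s (d1 ++ d ++ d2) else 0))).
Proof.
rewrite /amplitude state_sum_cat; congr (state_sum _ _ _ _).
by apply: funext => d1; apply: funext => t1; rewrite state_sum_cat.
Qed.

Lemma spin_act_isotopy n s (a b w w' : diagram Q) :
  isotopy_move w w' ->
  tangle n s (a ++ w ++ b) -> tangle n s (a ++ w' ++ b) ->
  spin_act n s (a ++ w ++ b) = spin_act n s (a ++ w' ++ b).
Proof.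
move=> ww' t1 t2; apply: spin_ext => t c tc.
rewrite !entry_spin_act // !weight_cat (weight_isotopy s ww'); congr (_ *: _).
rewrite !amplitude_context.
move: t1 t2; rewrite /tangle !well_typed_cat => /andP[ta /andP[tw tb]] /andP[_ /andP[tw' tb']].
set m := strings_after n a in ta tw tb tw' tb' *.
have ct : colouring s n t by case/and4P: tc.
apply: (eq_state_sum ct ta) => d1 t1 sh1 bt1.
have ct1 : colouring s m t1 by case/and4P: bt1.
rewrite (well_typed_inj tb' tb) in tw'.
apply: (state_sum_isotopy ww' tw tw' ct1) => d d' t2 dd' shd shd' bt2.
have ct2 : colouring s (strings_after m w) t2 by case/and4P: bt2.
apply: (eq_state_sum ct2 tb) => d2 b' sh2 _; case: eqP => // _.
have tan (d0 : diagram P) w0 : map (@piece_shape C P) d0 = map (@piece_shape C Q) w0 ->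
    well_typed s m w0 (strings_after m w) -> tangle n s (d1 ++ d0 ++ d2).
  move=> sh0 tw0; rewrite (@eq_shape_tangle _ _ _ _ _ (a ++ w0 ++ b)) ?map_cat ?sh1 ?sh0 ?sh2 //.
  by rewrite /tangle well_typed_cat ta -/m well_typed_cat (well_typed_after tw0) tw0.
apply: act_isotopy dd' _ _; [exact: tan shd tw | exact: tan shd' tw'].
Qed.

Section OneLabel.
Variables (n : nat) (s : bool) (a b : diagram Q) (i k : nat) (e : bool) (t c : seq H).
Implicit Types (f g : seq H -> seq H -> P k e).

(** The amplitude as a function of the matrix of entries of a single label.  It
reduces linearity and naturality in that label to the same properties in
[P]. *)
Definition label_sum f : P n s :=
  state_sum s a t (fun d1 t1 =>
    let u := take k.+1 (drop i t1) in
    \sum_(v <- next_slices (s (+) odd i) k k u)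
      state_sum s b (take i t1 ++ v ++ drop k.+1 (drop i t1)) (fun d2 b' =>
        if b' == c then act n s (d1 ++ Box i (f u v) :: d2) else 0)).

Lemma amplitude_box (x : Q k e) :
  amplitude n s (a ++ Box i x :: b) t c = label_sum (entry x).
Proof. by rewrite /amplitude state_sum_cat. Qed.

Hypotheses (tab : tangle n s (a ++ Box i (0 : Q k e) :: b)) (ct : colouring s n t).

Lemma eq_label_sum f (G : diagram P -> diagram P -> seq H -> seq H -> P n s) :
  (forall d1 d2 u v, boundary e k k u v ->
    (forall w (x : P k e), tangle k e w -> tangle n s (d1 ++ Box i x :: d2) ->
      act n s (d1 ++ Box i (act k e w) :: d2) = act n s (d1 ++ map (shift i) w ++ d2)) ->
    (forall x : P k e, tangle n s (d1 ++ Box i x :: d2)) ->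
    act n s (d1 ++ Box i (f u v) :: d2) = G d1 d2 u v) ->
  label_sum f = state_sum s a t (fun d1 t1 =>
    let u := take k.+1 (drop i t1) in
    \sum_(v <- next_slices (s (+) odd i) k k u)
      state_sum s b (take i t1 ++ v ++ drop k.+1 (drop i t1)) (fun d2 b' =>
        if b' == c then G d1 d2 u v else 0)).
Proof.
move=> fG; move: tab; rewrite /tangle well_typed_cat => /andP[ta /and3P[fits /eqP ee tb]].
apply: (eq_state_sum ct ta) => d1 t1 sh1 bt1.
have ct1 : colouring s (strings_after n a) t1 by case/and4P: bt1.
have [l [u [r [tE sl cu sr]]]] := colouring_cat ct1 fits; rewrite /= in sl.
have su : size u = k.+1 by case/andP: cu => /eqP.
rewrite tE drop_size_cat // take_size_cat // drop_size_cat // take_size_cat //=.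
apply: eq_big_seq => v; rewrite mem_next_slices -ee => bv.
have ct2 : colouring s (strings_after n a - k + k) (l ++ v ++ r).
  rewrite ee -sl in bv; rewrite tE in ct1.
  by have /and4P[] := boundary_insert erefl ct1 bv.
apply: (eq_state_sum ct2 tb) => d2 b' sh2 _; case: eqP => // _.
have tan (x : P k e) : tangle n s (d1 ++ Box i x :: d2).
  by rewrite (@eq_shape_tangle _ _ _ _ _ (a ++ Box i (0 : Q k e) :: b)) // !map_cat /= sh1 sh2.
by apply: fG => // w x tw _; apply: act_comp.
Qed.

Lemma label_sumP z f g :
  label_sum (fun u v => z *: f u v + g u v) = z *: label_sum f + label_sum g.
Proof.
rewrite (eq_label_sum (G := fun d1 d2 u v =>
  z *: act n s (d1 ++ Box i (f u v) :: d2) + act n s (d1 ++ Box i (g u v) :: d2))).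
  rewrite -state_sumP; congr (state_sum _ _ _ _); apply: funext => d1; apply: funext => t1 /=.
  rewrite scaler_sumr -big_split; apply: eq_bigr => v _ /=.
  rewrite -state_sumP; congr (state_sum _ _ _ _); apply: funext => d2; apply: funext => b' /=.
  by case: ifP => // _; rewrite scaler0 addr0.
by move=> d1 d2 u v _ _ tan; rewrite act_linear.
Qed.

Lemma eq_label_sum_entries f g :
  (forall u v, boundary e k k u v -> f u v = g u v) -> label_sum f = label_sum g.
Proof.
move=> fg; apply: (eq_label_sum (G := fun d1 d2 u v => act n s (d1 ++ Box i (g u v) :: d2))).
by move=> d1 d2 u v buv _ _; rewrite fg.
Qed.

Lemma label_sumZ z f : label_sum (fun u v => z *: f u v) = z *: label_sum f.
Proof.
have h0 := label_sumP (-1) f f.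
have := label_sumP z f (fun u v => -1 *: f u v + f u v).
rewrite h0 scaleN1r addNr addr0 => <-; apply: eq_label_sum_entries => u v _.
by rewrite scaleN1r addNr addr0.
Qed.

(** Naturality: colouring first the interior of an inserted diagram, then the rest,
is colouring the whole diagram. *)
Lemma label_sum_amplitude (w : diagram Q) : tangle k e w ->
  label_sum (amplitude k e w) = amplitude n s (a ++ map (shift i) w ++ b) t c.
Proof.
move=> tw; pose S d1 d2 u v := state_sum e w u (fun d b' =>
  if b' == v then act n s (d1 ++ map (shift i) d ++ d2) else 0).
rewrite (eq_label_sum (G := S)); last first.
  move=> d1 d2 u v buv comp tan.
  have lin z (x y : P k e) : act n s (d1 ++ Box i (z *: x + y) :: d2) =
      z *: act n s (d1 ++ Box i x :: d2) + act n s (d1 ++ Box i y :: d2).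
    by rewrite act_linear.
  have cu : colouring e k u by case/and4P: buv.
  rewrite /amplitude (@state_sum_additive _ _ _ _ _ (fun x => act n s (d1 ++ Box i x :: d2))); last first.
    by move=> x y; have := lin 1 x y; rewrite !scale1r.
  apply: (eq_state_sum cu tw) => d b' shd _; case: eqP => _.
    by apply: (comp d 0) => //; rewrite (@eq_shape_tangle _ _ _ _ _ w).
  have := lin (-1) 0 0; rewrite scaler0 addr0 => ->.
  by rewrite scaleN1r addNr.
rewrite amplitude_context.
move: tab; rewrite /tangle well_typed_cat => /andP[ta /and3P[fits /eqP ee tb]].
apply: (eq_state_sum ct ta) => d1 t1 sh1 bt1.
have ct1 : colouring s (strings_after n a) t1 by case/and4P: bt1.
have [l [u [r [tE sl cu sr]]]] := colouring_cat ct1 fits; rewrite /= in sl cu.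
have su : size u = k.+1 by case/andP: cu => /eqP.
rewrite tE drop_size_cat // take_size_cat // drop_size_cat // take_size_cat //= {1}/S.
rewrite -ee in cu *; rewrite -[in RHS]sl.
have es : s (+) odd (size l) = e by rewrite sl.
rewrite (@state_sum_shift _ _ _ _ _ _ _ _ _ k k) ?es //.
(* The sum over the slice [v] below the box is absorbed by the last slice [b0] of
   the inserted diagram. *)
transitivity (\sum_(v <- next_slices e k k u) state_sum e w u (fun d b0 =>
    state_sum s b (l ++ v ++ r) (fun d2 b' =>
    if b' == c then if b0 == v then act n s (d1 ++ map (shift i) d ++ d2) else 0 else 0))).
  apply: eq_bigr => v _; rewrite -state_sum_fubini; congr (state_sum _ _ _ _).
  apply: funext => d2; apply: funext => b'.
  by case: ifP => //; rewrite state_sum0.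
rewrite exchange_state_sum; apply: (eq_state_sum cu tw) => d b0 shd bb.
rewrite (bigD1_seq b0) ?next_slices_uniq ?mem_next_slices //= eqxx sl big1 ?addr0 // => v /negPf vb.
rewrite -[RHS](@state_sum0 C H P (P n s) s b (l ++ v ++ r)); congr (state_sum _ _ _ _).
by apply: funext => d2; apply: funext => b'; rewrite [b0 == v]eq_sym vb; case: ifP.
Qed.

End OneLabel.

Lemma spin_act_linear n s (a b : diagram Q) i k e (c : C) (x y : Q k e) :
  tangle n s (a ++ Box i x :: b) ->
  spin_act n s (a ++ Box i (c *: x + y) :: b) =
    c *: spin_act n s (a ++ Box i x :: b) + spin_act n s (a ++ Box i y :: b).
Proof.
move=> ta; apply: spin_ext => t d td.
have ta0 : tangle n s (a ++ Box i (0 : Q k e) :: b).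
  by rewrite (@eq_shape_tangle _ _ _ _ _ (a ++ Box i x :: b)) // !map_cat.
have ct : colouring s n t by case/and4P: td.
rewrite entryP !entry_spin_act // !weight_cat !weight_cons /= !mul1r.
move: (weight H s a * weight H s b) => wt; rewrite scalerA [c * _]mulrC -scalerA -scalerDr; congr (_ *: _).
rewrite !amplitude_box -label_sumP //; congr (label_sum _ _ _ _ _ _ _).
by apply: funext => u; apply: funext => v; rewrite entryP.
Qed.

Lemma spin_act_comp n s (a b : diagram Q) i k e (w : diagram Q) :
  tangle k e w -> tangle n s (a ++ Box i (spin_act k e w) :: b) ->
  spin_act n s (a ++ Box i (spin_act k e w) :: b) =
  spin_act n s (a ++ map (shift i) w ++ b).
Proof.
move=> tw ta; apply: spin_ext => t d td.
have ta0 : tangle n s (a ++ Box i (0 : Q k e) :: b).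
  by rewrite (@eq_shape_tangle _ _ _ _ _ (a ++ Box i (spin_act k e w) :: b)) // !map_cat.
have ct : colouring s n t by case/and4P: td.
rewrite !entry_spin_act // amplitude_box.
rewrite (@eq_label_sum_entries _ _ _ _ _ _ _ _ _ ta0 ct _
  (fun u v => weight H e w *: amplitude k e w u v)); last first.
  by move=> u v buv; rewrite entry_spin_act.
rewrite label_sumZ // label_sum_amplitude // scalerA; congr (_ *: _).
rewrite !weight_cat weight_cons /= mul1r weight_shift -mulrA; congr (_ * _).
rewrite mulrC; congr (_ * _); congr (weight _ _ _).
by move: ta; rewrite /tangle well_typed_cat => /and4P[_ _ /eqP].
Qed.

Lemma spin_act_id n s (x : Q n s) : spin_act n s [:: Box 0 x] = x.
Proof.
apply: spin_ext => t d td; rewrite entry_spin_act // weight_cons /weight big_nil /= !mul1r scale1r.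
have st : size t = n.+1 by case/and4P: td => /andP[/eqP].
rewrite /amplitude -[t in LHS]cats0 -[t ++ [::]]cat0s state_sum_cons //= addbF.
rewrite (bigD1_seq d) ?next_slices_uniq ?mem_next_slices //= big1 => [|v /negPf vd].
  by rewrite /state_sum /= cats0 eqxx addr0 act_id.
by rewrite /state_sum /= cats0 vd.
Qed.

Definition spin_planar : planar_algebra C :=
  PlanarAlgebra spin_act_isotopy spin_act_linear spin_act_id spin_act_comp.

End SpinPlanar.

(** * Planar subalgebras generated by boxes *)

(** The span of an arbitrary family in a finite-dimensional space is the span of
finitely many members: adding members outside the current span terminates. *)
Lemma finite_spanning_seq (K : fieldType) (vT : vectType K) (T : Type)
    (good : T -> bool) (g : T -> vT) :
  exists ws : seq T, all good ws /\ forall w, good w -> g w \in <<map g ws>>%VS.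
Proof.
suff main k : forall ws, all good ws ->
    (\dim {: vT} <= k + \dim <<map g ws>>)%N ->
    exists ws : seq T, all good ws /\ forall w, good w -> g w \in <<map g ws>>%VS.
  by apply: (main (\dim {: vT}) [::]) => //; rewrite leq_addr.
elim: k => [|k IH] ws gws dk.
  exists ws; split=> // w _; have -> : <<map g ws>>%VS = {: vT}%VS; last exact: memvf.
  by apply/eqP; rewrite eqEdim subvf.
have [sp|nsp] := EM (forall w, good w -> g w \in <<map g ws>>%VS); first by exists ws.
have [w /not_implyP[gw nw]] := (existsNP _).2 nsp.
apply: (IH (w :: ws)); first by rewrite /= gw.
apply: leq_trans dk _; rewrite /= span_cons addSnnS leq_add2l.
have sub : (<<map g ws>> <= <[g w]> + <<map g ws>>)%VS by rewrite addvSr.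
rewrite ltn_neqAle dimvS // andbT; apply/negP=> /eqP de.
apply: nw; apply/negPn/negP => nw; case/negP: nw.
have /eqP -> : <<map g ws>>%VS == (<[g w]> + <<map g ws>>)%VS by rewrite eqEdim sub de leqnn.
by rewrite (subvP (addvSl _ _)) // memv_line.
Qed.

Lemma span_ind (K : fieldType) (vT : vectType K) (T : Type) (good : T -> bool)
    (g : T -> vT) ws (Pr : vT -> Prop) x :
  all good ws -> Pr 0 -> (forall c y z, Pr y -> Pr z -> Pr (c *: y + z)) ->
  (forall w, good w -> Pr (g w)) -> x \in <<map g ws>>%VS -> Pr x.
Proof.
move=> gws P0 PD Pg; elim: ws gws x => [_ x|w ws IH /= /andP[gw gws] x].
  by rewrite span_nil memv0 => /eqP->.
rewrite span_cons => /memv_addP[y /vlineP[c ->] [z hz ->]].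
by apply: PD; [apply: Pg | apply: IH].
Qed.

Section PlanarSubalgebra.
Variables (C : numClosedFieldType) (Q : planar_algebra C).

Definition labels_satisfy (X : forall n e, pred (Q n e)) (w : diagram Q) : bool :=
  all (fun p => if p is @Box _ _ _ _ _ x then X _ _ x else true) w.

Lemma labels_satisfy_cat X w1 w2 :
  labels_satisfy X (w1 ++ w2) = labels_satisfy X w1 && labels_satisfy X w2.
Proof. exact: all_cat. Qed.

Lemma labels_satisfy_shift X d w :
  labels_satisfy X (map (shift d) w) = labels_satisfy X w.
Proof. by rewrite /labels_satisfy all_map; apply: eq_all => -[]. Qed.

(** Subspaces stable under all labelled tangles form a planar algebra. *)
Section Sub.
Variable U : forall n e, {vspace Q n e}.
Hypothesis U_closed : forall n s w,
  tangle n s w -> labels_satisfy (fun n e x => x \in U n e) w -> act n s w \in U n s.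

Definition sub_space n e : vectType C := subvs_of (U n e).

Definition incl n e (x : sub_space n e) : Q n e := vsval x.
Arguments incl : simpl never.

Definition incl_piece (p : piece sub_space) : piece Q :=
  match p with Cap i => Cap i | Cup i => Cup i
  | @Box _ _ i n e x => Box i (incl x) end.

Lemma incl_inj n e : injective (@incl n e).
Proof. exact: val_inj. Qed.

Lemma inclP n e (c : C) (x y : sub_space n e) : incl (c *: x + y) = c *: incl x + incl y.
Proof. by rewrite /incl linearP. Qed.

Lemma incl_mem n e (x : sub_space n e) : incl x \in U n e.
Proof. exact: subvsP. Qed.

Lemma shape_incl p : piece_shape (incl_piece p) = piece_shape p.
Proof. by case: p. Qed.

Lemma map_incl_shift d w : map incl_piece (map (shift d) w) = map (shift d) (map incl_piece w).
Proof. by rewrite -!map_comp; apply: eq_map => -[]. Qed.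

Lemma tangle_incl n s w : tangle n s (map incl_piece w) = tangle n s w.
Proof. by apply: eq_shape_tangle; rewrite -map_comp; apply: eq_map => p /=; rewrite shape_incl. Qed.

Lemma labels_incl w : labels_satisfy (fun n e x => x \in U n e) (map incl_piece w).
Proof. by rewrite /labels_satisfy; elim: w => //= -[i|i|i n e x] w //= ->; rewrite incl_mem. Qed.

Definition sub_act n s (w : diagram sub_space) : sub_space n s :=
  vsproj (U n s) (act n s (map incl_piece w)).

Lemma incl_sub_act n s w : tangle n s w -> incl (sub_act n s w) = act n s (map incl_piece w).
Proof.
by move=> tw; rewrite /incl vsprojK // U_closed ?tangle_incl ?labels_incl.
Qed.

Lemma isotopy_incl w w' : isotopy_move w w' -> isotopy_move (map incl_piece w) (map incl_piece w').
Proof.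
case: w w' / => [p q|i|i|i n e x].
- have -> : map incl_piece [:: p; shift (piece_pos p + strings_below p) q] =
    [:: incl_piece p; shift (piece_pos (incl_piece p) + strings_below (incl_piece p)) (incl_piece q)].
    by case: p q => [?|?|????] [].
  have -> : map incl_piece [:: shift (piece_pos p + strings_above p) q; p] =
    [:: shift (piece_pos (incl_piece p) + strings_above (incl_piece p)) (incl_piece q); incl_piece p].
    by case: p q => [?|?|????] [].
  exact: Exchange_heights.
- exact: Straighten_left.
- exact: Straighten_right.
- have := Full_turn i (incl x); rewrite /half_turn_cw /half_turn_ccw !map_cat /=.
  by rewrite /caps /cups !map_rev -!map_comp.
Qed.

Lemma sub_act_isotopy n s (a b w w' : diagram sub_space) :
  isotopy_move w w' ->
  tangle n s (a ++ w ++ b) -> tangle n s (a ++ w' ++ b) ->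
  sub_act n s (a ++ w ++ b) = sub_act n s (a ++ w' ++ b).
Proof.
move=> ww' t1 t2; apply: incl_inj; rewrite !incl_sub_act // !map_cat.
by apply: act_isotopy (isotopy_incl ww') _ _; rewrite -!map_cat tangle_incl.
Qed.

Lemma sub_act_linear n s (a b : diagram sub_space) i k e (c : C) (x y : sub_space k e) :
  tangle n s (a ++ Box i x :: b) ->
  sub_act n s (a ++ Box i (c *: x + y) :: b) =
    c *: sub_act n s (a ++ Box i x :: b) + sub_act n s (a ++ Box i y :: b).
Proof.
move=> ta; apply: incl_inj.
have ta' z : tangle n s (a ++ Box i (z : sub_space k e) :: b).
  by rewrite (@eq_shape_tangle _ _ _ _ _ _ (a ++ Box i x :: b)) // !map_cat.
rewrite inclP !incl_sub_act // !map_cat /= inclP act_linear //.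
by have := ta' x; rewrite -tangle_incl map_cat.
Qed.

Lemma sub_act_id n s (x : sub_space n s) : sub_act n s [:: Box 0 x] = x.
Proof.
apply: incl_inj; rewrite incl_sub_act ?act_id //.
by rewrite /tangle /= add0n leqnn addbF eqxx subnn add0n eqxx.
Qed.

Lemma sub_act_comp n s (a b : diagram sub_space) i k e (w : diagram sub_space) :
  tangle k e w -> tangle n s (a ++ Box i (sub_act k e w) :: b) ->
  sub_act n s (a ++ Box i (sub_act k e w) :: b) =
  sub_act n s (a ++ map (shift i) w ++ b).
Proof.
move=> tw ta; apply: incl_inj.
rewrite !incl_sub_act ?(tangle_insert tw ta) // !map_cat /= incl_sub_act // map_incl_shift.
apply: act_comp; rewrite ?tangle_incl //.
by move: ta; rewrite -tangle_incl map_cat /= incl_sub_act.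
Qed.

Definition planar_subalgebra : planar_algebra C :=
  PlanarAlgebra sub_act_isotopy sub_act_linear sub_act_id sub_act_comp.

End Sub.

Section Generated.
Variable X : forall n e, pred (Q n e).

Definition generating_tangle n s (w : diagram Q) : bool :=
  tangle n s w && labels_satisfy X w.

Definition spanning_tangles n s : seq (diagram Q) :=
  proj1_sig (cid (finite_spanning_seq (generating_tangle n s) (act n s))).

Definition generated_space n s : {vspace Q n s} :=
  <<map (act n s) (spanning_tangles n s)>>%VS.

Lemma spanning_tangles_generating n s : all (generating_tangle n s) (spanning_tangles n s).
Proof.
by have [] := proj2_sig (cid (finite_spanning_seq (generating_tangle n s) (act n s))).
Qed.

Lemma mem_generated n s w : generating_tangle n s w -> act n s w \in generated_space n s.
Proof.
move=> gw; have [_] := proj2_sig (cid (finite_spanning_seq (generating_tangle n s) (act n s))).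
exact.
Qed.

Lemma generated_box n s x : X x -> x \in generated_space n s.
Proof.
move=> Xx; rewrite -[x]act_id; apply: mem_generated.
by rewrite /generating_tangle /tangle /= Xx add0n leqnn addbF eqxx subnn add0n eqxx.
Qed.

Lemma generated_ind n s (Pr : Q n s -> Prop) x :
  Pr 0 -> (forall c y z, Pr y -> Pr z -> Pr (c *: y + z)) ->
  (forall w, generating_tangle n s w -> Pr (act n s w)) ->
  x \in generated_space n s -> Pr x.
Proof. move=> P0 PD Pg; exact: span_ind (spanning_tangles_generating n s) P0 PD Pg. Qed.

(** Labels are expanded one at a time as combinations of tangles labelled by
generators, and the inner tangles are then glued in; [a] is the part of the
diagram already treated. *)
Lemma generated_closed n s w : tangle n s w ->
  labels_satisfy (fun n e x => x \in generated_space n e) w ->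
  act n s w \in generated_space n s.
Proof.
suff main (b a : diagram Q) : labels_satisfy X a ->
    labels_satisfy (fun n e x => x \in generated_space n e) b ->
    tangle n s (a ++ b) -> act n s (a ++ b) \in generated_space n s.
  by move=> tw lw; apply: (main w [::]).
elim: b a => [|p b IH] a la.
  by rewrite cats0 => _ ta; apply: mem_generated; rewrite /generating_tangle ta.
rewrite /=; case: p => [i|i|i k e x].
- by rewrite -cat_rcons => lb; apply: IH => //; rewrite -cats1 labels_satisfy_cat la.
- by rewrite -cat_rcons => lb; apply: IH => //; rewrite -cats1 labels_satisfy_cat la.
case/andP=> xU lb ta.
have ta' y : tangle n s (a ++ Box i (y : Q k e) :: b).
  by rewrite (@eq_shape_tangle _ _ _ _ _ _ (a ++ Box i x :: b)) // !map_cat.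
have lin c y z := act_linear c z (ta' y).
apply: (generated_ind (Pr := fun y => act n s (a ++ Box i y :: b) \in generated_space n s) _ _ _ xU).
- have := lin (-1) 0 0; rewrite scaler0 addr0 scaleN1r addNr => ->; exact: mem0v.
- by move=> c y z hy hz; rewrite lin; apply: rpredD => //; apply: rpredZ.
move=> w' /andP[tw lw]; rewrite act_comp // catA.
apply: IH => //; first by rewrite labels_satisfy_cat la labels_satisfy_shift.
by rewrite -catA; apply: tangle_insert (ta' 0).
Qed.

Definition generated_subalgebra : planar_algebra C :=
  planar_subalgebra generated_closed.

Lemma generated_by_generators n s (x : generated_subalgebra n s) :
  exists ws : seq (diagram generated_subalgebra),
    all (fun w => tangle n s w &&
       all (fun p => if p is @Box _ _ _ _ _ x then X (incl x) else true) w) ws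
    /\ x \in <<[seq act n s w | w <- ws]>>%VS.
Proof.
pose lift (p : piece Q) : piece (sub_space generated_space) :=
  match p with Cap i => Cap i | Cup i => Cup i
  | @Box _ _ i n e y => Box i (vsproj (generated_space n e) y) end.
have liftK w : labels_satisfy X w -> map (@incl_piece generated_space) (map lift w) = w.
  elim: w => //= -[i|i|i k e y] w IH /=; [by move/IH-> | by move/IH-> |].
  by case/andP=> Xy /IH->; rewrite /incl vsprojK ?generated_box.
(* The spanning tangles have generators as labels, so they lift to the
   subalgebra without changing their values. *)
exists (map (map lift) (spanning_tangles n s)); split.
  rewrite all_map; apply: sub_all (spanning_tangles_generating n s) => w /andP[tw lw] /=.
  rewrite -tangle_incl liftK // tw /=.
  have : labels_satisfy X (map (@incl_piece generated_space) (map lift w)) by rewrite liftK.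
  by rewrite /labels_satisfy all_map; apply: sub_all => -[].
have -> : [seq act (p := generated_subalgebra) n s w | w <- map (map lift) (spanning_tangles n s)] =
    map (linfun (vsproj (generated_space n s))) (map (act n s) (spanning_tangles n s)).
  rewrite -!map_comp; elim: (spanning_tangles n s) (spanning_tangles_generating n s) => //=.
  move=> w ws IH /andP[/andP[tw lw] /IH->]; congr (_ :: _).
  by rewrite lfunE /= /sub_act liftK.
rewrite -limg_span -[x]vsvalK -lfunE memv_img //; exact: subvsP.
Qed.

End Generated.

End PlanarSubalgebra.

(** * Translation invariance and the tensor product with a group *)

Section Invariance.
Variables (C : numClosedFieldType) (H : finGroupType) (P : planar_algebra C).
Local Notation Q := (spin_planar H P).
Implicit Types (s e : bool) (t u v l r b : seq H) (h : H).

Definition translation_invariant n e (x : Q n e) : bool :=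
  [forall h : H, [forall k : disc_boundary H n e,
    entry (P := P) x (translate e h (val k).1) (translate e h (val k).2) ==
    entry (P := P) x (val k).1 (val k).2]].

Lemma invariantP n e (x : Q n e) :
  Bool.reflect (forall h u v, boundary e n n u v ->
     entry (P := P) x (translate e h u) (translate e h v) = entry (P := P) x u v)
    (translation_invariant x).
Proof.
apply: (iffP idP) => [ix h u v /boundary_disc[k [<- <-]]|ix].
  by move/forallP: ix => /(_ h)/forallP/(_ k)/eqP.
by apply/forallP=> h; apply/forallP=> k; apply/eqP/ix/(valP k).
Qed.

Lemma invariant0 n e : translation_invariant (0 : Q n e).
Proof. by apply/invariantP=> h u v _; rewrite !entry0. Qed.

Lemma invariant_lin n e (c : C) (x y : Q n e) :
  translation_invariant x -> translation_invariant y -> translation_invariant (c *: x + y).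
Proof.
move=> /invariantP ix /invariantP iy; apply/invariantP=> h u v buv.
by rewrite !entryP ix ?iy.
Qed.

Lemma big_next_slices_translate (W : nmodType) e n m h u (F : seq H -> W) : odd n = odd m ->
  \sum_(v <- next_slices e n m (translate e h u)) F v =
  \sum_(v <- next_slices e n m u) F (translate e h v).
Proof.
move=> nm; rewrite -(big_map (translate e h) predT F).
have inj : injective (translate e h) by apply: (can_inj (translateK e h)).
have trKV v : translate e h (translate e h^-1%g v) = v.
  by have := translateK e h^-1%g v; rewrite invgK.
apply: perm_big; apply: uniq_perm; rewrite ?map_inj_uniq ?next_slices_uniq //.
move=> v; rewrite -{2}[v]trKV (mem_map inj) !mem_next_slices; apply/idP/idP.
  by move/(boundary_translate h^-1%g nm); rewrite translateK.
by move/(boundary_translate h nm); rewrite trKV.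
Qed.

(** Left translation permutes the colourings, and invariant labels do not see
it. *)
Lemma state_sum_translate (W : lmodType C) s m m' h (w : diagram Q) t
    (F : diagram P -> seq H -> W) :
  colouring s m t -> well_typed s m w m' -> labels_satisfy translation_invariant w ->
  state_sum s w (translate s h t) F =
  state_sum s w t (fun d b => F d (translate s h b)).
Proof.
elim: w m t F => [|p w IH] m t F ct //; case/and3P=> fits sh wt /andP[ip lw].
have [l [u [r [tE sl cu sr]]]] := colouring_cat ct fits.
have su : size u = (strings_above p).+1 by case/andP: cu => /eqP.
rewrite tE !translate_cat sl !state_sum_cons ?size_translate //.
rewrite big_next_slices_translate ?odd_above_below //.
apply: eq_big_seq => v; rewrite mem_next_slices => bv.
have sv : size v = (strings_below p).+1 by case/and4P: bv => _ /andP[/eqP].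
have <- : translate s h (l ++ v ++ r) = translate s h l ++
    translate (s (+) odd (piece_pos p)) h v ++
    translate (s (+) odd (piece_pos p) (+) odd (size u)) h r.
  by rewrite !translate_cat sl sv su /= odd_above_below.
have -> : component p (translate (s (+) odd (piece_pos p)) h u)
    (translate (s (+) odd (piece_pos p)) h v) = component p u v.
  case: p sh ip bv {fits wt sl cu sr su sv} => //= i n e x /eqP ee /invariantP ix bv.
  by rewrite -ee in bv *; rewrite ix.
have /and4P[_ ct1 _ _] : boundary s m (m - strings_above p + strings_below p)
    (l ++ u ++ r) (l ++ v ++ r).
  by rewrite tE in ct; rewrite -sl in bv; apply: boundary_insert ct bv; apply: odd_above_below.
exact: IH ct1 wt lw.
Qed.

Lemma spin_actE n s (w : diagram Q) : act n s w = spin_act n s w.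
Proof. by []. Qed.

Lemma invariant_act n s (w : diagram Q) :
  tangle n s w -> labels_satisfy translation_invariant w -> translation_invariant (act n s w).
Proof.
move=> tw lw; apply/invariantP=> h u v buv.
rewrite spin_actE !entry_spin_act ?boundary_translate //; congr (_ *: _).
have cu : colouring s n u by case/and4P: buv.
rewrite /amplitude (state_sum_translate h _ cu tw lw).
congr (state_sum _ _ _ _); apply: funext => d; apply: funext => b.
by rewrite (inj_eq (can_inj (translateK s h))).
Qed.

Definition invariant_two_box n e (x : Q n e) : bool := (n == 2) && translation_invariant x.

(** The tensor product of the planar algebra of H with [P], cut down to what its
2-boxes generate. *)
Definition tensor_planar : planar_algebra C :=
  generated_subalgebra (Q := Q) (@invariant_two_box).

Lemma tensor_invariant n e (x : tensor_planar n e) : translation_invariant (incl x).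
Proof.
apply: (generated_ind (Q := Q) (Pr := fun y => translation_invariant y)) (incl_mem x) => [|c y z|w /andP[tw lw]].
- exact: invariant0.
- exact: invariant_lin.
apply: invariant_act => //; apply: sub_all lw => -[] //= i k f y.
by case/andP.
Qed.

Definition tensor_entry n e (x : tensor_planar n e) : seq H -> seq H -> P n e :=
  entry (P := P) (incl x).

Lemma tensor_ext n e (x y : tensor_planar n e) :
  (forall u v, boundary e n n u v -> tensor_entry x u v = tensor_entry y u v) -> x = y.
Proof. by move=> xy; apply: incl_inj; apply: spin_ext. Qed.

Lemma tensor_entryP n e (c : C) (x y : tensor_planar n e) u v :
  tensor_entry (c *: x + y) u v = c *: tensor_entry x u v + tensor_entry y u v.
Proof. by rewrite /tensor_entry inclP entryP. Qed.

Lemma tensor_entry0 n e u v : tensor_entry (0 : tensor_planar n e) u v = 0.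
Proof. by have := tensor_entryP (-1) (0 : tensor_planar n e) 0 u v; rewrite scaler0 addr0 scaleN1r addNr. Qed.

Lemma tensor_entryZ n e (c : C) (x : tensor_planar n e) u v :
  tensor_entry (c *: x) u v = c *: tensor_entry x u v.
Proof. by have := tensor_entryP c x 0 u v; rewrite tensor_entry0 !addr0. Qed.

Lemma tensor_entryD n e (x y : tensor_planar n e) u v :
  tensor_entry (x + y) u v = tensor_entry x u v + tensor_entry y u v.
Proof. by have := tensor_entryP 1 x y u v; rewrite !scale1r. Qed.

Lemma tensor_entry_sum n e (I : Type) (r : seq I) (F : I -> tensor_planar n e) u v :
  tensor_entry (\sum_(i <- r) F i) u v = \sum_(i <- r) tensor_entry (F i) u v.
Proof.
apply: (big_morph (fun x => tensor_entry x u v)) => [x y|]; last exact: tensor_entry0.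
exact: tensor_entryD.
Qed.

Lemma tensor_entry_translate n e h (x : tensor_planar n e) u v : boundary e n n u v ->
  tensor_entry x (translate e h u) (translate e h v) = tensor_entry x u v.
Proof. by move/invariantP: (tensor_invariant x) => ix; apply: ix. Qed.

Local Notation incl_d := (map (@incl_piece C Q (generated_space (Q := Q) (@invariant_two_box)))).

Lemma tensor_entry_act n s (w : diagram tensor_planar) t b :
  tangle n s w -> boundary s n n t b ->
  tensor_entry (act n s w) t b =
  weight H s w *: amplitude (P := P) n s (incl_d w) t b.
Proof.
move=> tw tb; rewrite /tensor_entry (incl_sub_act (@generated_closed _ Q _)) // spin_actE entry_spin_act //.
congr (_ *: _); rewrite /weight big_map; apply: eq_bigr => p _; by case: p.
Qed.

End Invariance.

(** * Adjoints *)

Section Reflection.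
Variable C : numClosedFieldType.

Section Family.
Variables (V : nat -> bool -> vectType C) (st : forall n e, V n e -> V n e).

Lemma reflect_cons p (w : diagram V) : reflect st (p :: w) = rcons (reflect st w) (reflect_piece st p).
Proof. by rewrite /reflect /= rev_cons. Qed.

Lemma reflect_rcons p (w : diagram V) : reflect st (rcons w p) = reflect_piece st p :: reflect st w.
Proof. by rewrite /reflect map_rcons rev_rcons. Qed.

Lemma reflect_pos p : piece_pos (reflect_piece st p) = piece_pos p.
Proof. by case: p. Qed.
Lemma reflect_above p : strings_above (reflect_piece st p) = strings_below p.
Proof. by case: p. Qed.
Lemma reflect_below p : strings_below (reflect_piece st p) = strings_above p.
Proof. by case: p. Qed.
Lemma reflect_shading s p : shading_ok s (reflect_piece st p) = shading_ok s p.
Proof. by case: p. Qed.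

Lemma reflectK (w : diagram V) : (forall n e, involutive (@st n e)) ->
  reflect st (reflect st w) = w.
Proof.
move=> stK; rewrite /reflect map_rev revK -map_comp.
by elim: w => //= -[i|i|i n e x] w -> //=; rewrite stK.
Qed.

Lemma well_typed_reflect s m (w : diagram V) m' :
  well_typed s m w m' -> well_typed s m' (reflect st w) m.
Proof.
elim: w m => [|p w IH] m; first by rewrite /= eq_sym.
case/and3P=> fits sh wt; rewrite reflect_cons -cats1 well_typed_cat.
have wt' := IH _ wt; rewrite (well_typed_after wt') wt' /=.
rewrite reflect_pos reflect_above reflect_below reflect_shading sh /=.
by apply/andP; split; [|apply/eqP]; lia.
Qed.

Lemma weight_reflect (H : finGroupType) s (w : diagram V) : weight H s (reflect st w) = weight H s w.
Proof.
elim: w => // p w IH; rewrite reflect_cons -cats1 weight_cat !weight_cons IH mulrC.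
by rewrite /weight big_nil mulr1; congr (_ * _); case: p.
Qed.

End Family.

Lemma weight_conj (H : finGroupType) (V : nat -> bool -> vectType C) s (w : diagram V) :
  (weight H s w)^* = weight H s w.
Proof. by rewrite geC0_conj // ltW ?weight_gt0. Qed.

Variables (H : finGroupType) (P : subfactor_planar_algebra C).
Local Notation Q := (spin_planar H P).
Implicit Types (s e : bool) (t u v l r b : seq H) (h : H).

Definition spin_star n e (x : Q n e) : Q n e :=
  of_entries (P := P) (fun u v => pstar (entry (P := P) x v u)).

Lemma entry_star n e (x : Q n e) u v :
  boundary e n n u v -> entry (P := P) (spin_star x) u v = pstar (entry (P := P) x v u).
Proof. exact: entry_of. Qed.

Lemma pstar0 n e : pstar (0 : P n e) = 0.
Proof. by have := pstar_semilinear (-1) (0 : P n e) 0; rewrite scaler0 addr0 rmorphN1 scaleN1r addNr. Qed.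

Lemma pstarD n e (x y : P n e) : pstar (x + y) = pstar x + pstar y.
Proof. by have := pstar_semilinear 1 x y; rewrite rmorph1 !scale1r. Qed.

Lemma pstarZ n e c (x : P n e) : pstar (c *: x) = c^* *: pstar x.
Proof. by have := pstar_semilinear c x 0; rewrite !addr0 pstar0 addr0. Qed.

Lemma spin_star_semilinear n e (c : C) (x y : Q n e) :
  spin_star (c *: x + y) = c^* *: spin_star x + spin_star y.
Proof.
apply: spin_ext => u v buv.
by rewrite entryP !entry_star // entryP pstar_semilinear.
Qed.

Lemma spin_starK n e : involutive (@spin_star n e).
Proof.
move=> x; apply: spin_ext => u v buv.
by rewrite !entry_star ?pstarK // boundary_sym.
Qed.

Lemma reflect_component s (p : piece Q) u v : shading_ok s p ->
  boundary (s (+) odd (piece_pos p)) (strings_below p) (strings_above p) v u ->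
  reflect_piece (@pstar C P) (component (reflect_piece spin_star p) v u) = component p u v.
Proof.
case: p => //= i k e x /eqP ee buv; rewrite -ee in buv.
by rewrite entry_star // pstarK.
Qed.

(** A history of slices may be read upwards, since the compatibility of two
consecutive slices is symmetric ([boundary_sym]).  The labels are then
reflected. *)
Lemma state_sum_reflect (W : lmodType C) s n m (w : diagram Q) t b (F : diagram P -> W) :
  well_typed s n w m -> colouring s n t -> colouring s m b ->
  state_sum s w t (fun d b' => if b' == b then F d else 0) =
  state_sum s (reflect spin_star w) b
    (fun d t' => if t' == t then F (reflect (@pstar C P) d) else 0).
Proof.
elim: w n t F => [|p w IH] n t F; first by rewrite /state_sum /= [t == b]eq_sym.
move=> wt ct cb; have /and3P[fits sh wt1] := wt.
have [l [u [r [tE sl cu sr]]]] := colouring_cat ct fits.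
have su : size u = (strings_above p).+1 by case/andP: cu => /eqP.
rewrite reflect_cons -cats1 state_sum_cat [in LHS]tE state_sum_cons //.
rewrite tE in ct.
transitivity (\sum_(v <- next_slices (s (+) odd (piece_pos p)) (strings_above p) (strings_below p) u)
  state_sum s (reflect spin_star w) b (fun d t' => if t' == l ++ v ++ r then
     F (component p u v :: reflect (@pstar C P) d) else 0)).
  apply: eq_big_seq => v; rewrite mem_next_slices -sl => bv.
  have /and4P[_ ct1 _ _] := boundary_insert (odd_above_below p) ct bv.
  exact: IH wt1 ct1 cb.
rewrite exchange_state_sum.
apply: (eq_state_sum cb (well_typed_reflect _ wt1)) => d t' shd bt'.
have ct' : colouring s (n - strings_above p + strings_below p) t' by case/and4P: bt'.
have fits' : (piece_pos p + strings_below p <= n - strings_above p + strings_below p)%N.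
  by lia.
have [l' [v' [r' [tE' sl' cv' _]]]] := colouring_cat ct' fits'.
have sv' : size v' = (strings_below p).+1 by case/andP: cv' => /eqP.
rewrite tE' state_sum_cons ?reflect_pos ?reflect_above // reflect_below.
(* Downwards the piece leads from [t] to the slice [l' ++ v' ++ r'], upwards from
   that slice back to [t]: in both cases at most one term survives. *)
transitivity (if [&& l' == l, r' == r & v' \in next_slices (s (+) odd (piece_pos p))
    (strings_above p) (strings_below p) u]
  then F (component p u v' :: reflect (@pstar C P) d) else 0).
  case: ifP => [/and3P[/eqP-> /eqP-> v'o]|no].
    rewrite (bigD1_seq v') ?next_slices_uniq //= eqxx big1_seq ?addr0 // => v.
    rewrite mem_next_slices => /andP[vv' /and4P[_ /andP[/eqP sv _] _ _]].
    by rewrite eqseq_cat // eqxx eqseq_cat ?sv // eq_sym (negPf vv').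
  rewrite big1_seq // => v /= vo; case: eqP => // /eqP.
  have sv : size v = size v' by move: vo; rewrite mem_next_slices sv' => /and4P[_ /andP[/eqP->]].
  rewrite eqseq_cat ?sl // eqseq_cat // => /and3P[/eqP ll /eqP vv /eqP rr].
  by move: no; rewrite ll rr vv vo !eqxx.
transitivity (if [&& l' == l, r' == r & u \in next_slices (s (+) odd (piece_pos p))
    (strings_below p) (strings_above p) v']
  then F (component p u v' :: reflect (@pstar C P) d) else 0).
  by rewrite !mem_next_slices boundary_sym.
case: ifP => [/and3P[/eqP-> /eqP-> uo]|no].
  rewrite (bigD1_seq u) ?next_slices_uniq //= /state_sum /= tE eqxx big1_seq ?addr0.
    rewrite cats1 reflect_rcons; congr (F (_ :: _)).
    by rewrite (reflect_component sh) //; move: uo; rewrite mem_next_slices.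
  move=> v /andP[/negPf vu]; rewrite mem_next_slices => /and4P[_ /andP[/eqP sv _] _ _].
  by rewrite eqseq_cat // eqxx eqseq_cat ?vu // sv su.
rewrite big1_seq // => v /=; rewrite /state_sum mem_next_slices => bv.
case: eqP => // /eqP; rewrite tE.
have sv : size v = size u by rewrite su; case/and4P: bv => _ /andP[/eqP].
rewrite eqseq_cat ?sl' ?sl // eqseq_cat // => /and3P[/eqP ll /eqP vv /eqP rr].
by move: no; rewrite ll rr mem_next_slices -vv bv !eqxx.
Qed.

End Reflection.

(** * Scalars *)

Section Scalars.
Variables (C : numClosedFieldType) (R : planar_algebra C).

Lemma act_zero n s (a b : diagram R) i k e :
  tangle n s (a ++ Box i (0 : R k e) :: b) -> act n s (a ++ Box i (0 : R k e) :: b) = 0.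
Proof.
by move=> ta; have := act_linear (-1) 0 ta; rewrite scaler0 addr0 scaleN1r addNr.
Qed.

Lemma act_scale n s (a b : diagram R) i k e (c : C) (x : R k e) :
  tangle n s (a ++ Box i x :: b) ->
  act n s (a ++ Box i (c *: x) :: b) = c *: act n s (a ++ Box i x :: b).
Proof.
move=> ta; have := act_linear c 0 ta; rewrite addr0 => ->.
by rewrite act_zero ?addr0 // (@eq_shape_tangle _ _ _ _ _ _ (a ++ Box i x :: b)) // !map_cat.
Qed.

Lemma tangle_pmul n s (x y : R n s) : tangle n s [:: Box 0 x; Box 0 y].
Proof. by rewrite /tangle /= !add0n leqnn addbF eqxx subnn add0n leqnn subnn add0n eqxx. Qed.

(** Gluing the identity tangle into any tangle changes nothing, so if it vanished
so would every box. *)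
Lemma identity_neq0 n s (x : R n s) : x != 0 -> act (p := R) n s [::] != 0.
Proof.
apply: contra_neq => e0.
have := act_comp (n := n) (s := s) (a := [::]) (b := [:: Box 0 x]) (i := 0) (k := n) (e := s)
  (w := [::] : diagram R) (eqxx _) (tangle_pmul _ x).
by rewrite /= act_id e0 => <-; rewrite (act_zero (a := [::])) // tangle_pmul.
Qed.

Lemma dim1_identity n s : \dim {: R n s} = 1%N -> act (p := R) n s [::] != 0.
Proof.
move=> d1; have : (0 < \dim {: R n s})%N by rewrite d1.
by rewrite lt0n dimv_eq0 -vpick0 => nz; apply: identity_neq0 nz.
Qed.

Lemma dim1_scalar n s (x : R n s) : \dim {: R n s} = 1%N ->
  exists c, x = c *: act (p := R) n s [::].
Proof.
move=> d1; have : x \in <[act (p := R) n s [::]]>%VS.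
  have /eqP -> : <[act (p := R) n s [::]]>%VS == {: R n s}%VS.
    by rewrite eqEdim subvf d1 dim_vline dim1_identity.
  exact: memvf.
by case/vlineP=> c ->; exists c.
Qed.

Hypothesis dim0 : forall s, \dim {: R 0%N s} = 1%N.

Lemma scalar_ofE s c : scalar_of (c *: act (p := R) 0 s [::]) = c.
Proof.
have fr : free [tuple act (p := R) 0 s [::]] by rewrite /= seq1_free dim1_identity.
by rewrite /scalar_of linearZ /= (coord_free ord0 ord0 fr) mulr1.
Qed.

Lemma scalar_ofP s c (x y : R 0%N s) : scalar_of (c *: x + y) = c * scalar_of x + scalar_of y.
Proof. by rewrite /scalar_of linearP. Qed.

End Scalars.

(** * The subfactor planar algebra structure *)

Section SubfactorStructure.
Variables (C : numClosedFieldType) (H : finGroupType) (P : subfactor_planar_algebra C).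
Local Notation Q := (spin_planar H P).
Local Notation S := (tensor_planar H P).
Implicit Types (s e : bool) (t u v l r b : seq H) (h : H).

Lemma spin_star_act n s (w : diagram Q) : tangle n s w ->
  spin_star (act n s w) = act n s (reflect (@spin_star C H P) w).
Proof.
move=> tw; apply: spin_ext => u v buv.
have bvu : boundary s n n v u by rewrite boundary_sym.
rewrite entry_star // !spin_actE !entry_spin_act // pstarZ weight_conj weight_reflect.
congr (_ *: _); have /and4P[cu cv _ _] := buv.
rewrite /amplitude (@state_sum_additive _ _ _ _ _ (@pstar C P n s)); last exact: pstarD.
transitivity (state_sum s w v (fun d b' => if b' == u then
    act n s (reflect (@pstar C P) d) else 0)).
  apply: (eq_state_sum cv tw) => d b' shd _; case: eqP => _; last exact: pstar0.
  by rewrite pstar_act // (@eq_shape_tangle _ _ _ _ _ _ w).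
rewrite (state_sum_reflect (fun d => act n s (reflect (@pstar C P) d)) tw cv cu).
congr (state_sum _ _ _ _); apply: funext => d; apply: funext => b'.
by rewrite reflectK // => n' e'; apply: pstarK.
Qed.

Lemma invariant_star n e (x : Q n e) : translation_invariant x -> translation_invariant (spin_star x).
Proof.
move/invariantP=> ix; apply/invariantP=> h u v buv.
by rewrite !entry_star ?boundary_translate // ix // boundary_sym.
Qed.

Lemma generated_star n e (x : Q n e) :
  x \in generated_space (Q := Q) (@invariant_two_box C H P) n e ->
  spin_star x \in generated_space (Q := Q) (@invariant_two_box C H P) n e.
Proof.
apply: (generated_ind (Q := Q) (Pr := fun y => spin_star y \in generated_space (Q := Q) (@invariant_two_box C H P) n e)).
- have := spin_star_semilinear (-1) (0 : Q n e) 0.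
  by rewrite scaler0 addr0 rmorphN1 scaleN1r addNr => ->; rewrite mem0v.
- by move=> c y z hy hz; rewrite spin_star_semilinear rpredD // rpredZ.
move=> w /andP[tw lw]; rewrite spin_star_act //; apply: mem_generated.
rewrite /generating_tangle /tangle (well_typed_reflect _ tw) /=.
rewrite /labels_satisfy /reflect all_rev all_map; apply: sub_all lw => -[] //= i k f y.
by case/andP=> k2 iy; rewrite /invariant_two_box k2 invariant_star.
Qed.

Definition tensor_star n e (x : S n e) : S n e :=
  vsproj (generated_space (Q := Q) (@invariant_two_box C H P) n e) (spin_star (incl x)).

Lemma incl_star n e (x : S n e) : incl (tensor_star x) = spin_star (incl x).
Proof. by rewrite /incl vsprojK // generated_star // incl_mem. Qed.

Lemma tensor_entry_star n e (x : S n e) u v : boundary e n n u v ->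
  tensor_entry (tensor_star x) u v = pstar (tensor_entry x v u).
Proof. by move=> buv; rewrite /tensor_entry incl_star entry_star. Qed.

Lemma tensor_star_semilinear n e (c : C) (x y : S n e) :
  tensor_star (c *: x + y) = c^* *: tensor_star x + tensor_star y.
Proof. by apply: incl_inj; rewrite inclP !incl_star inclP spin_star_semilinear. Qed.

Lemma tensor_starK n e : involutive (@tensor_star n e).
Proof. by move=> x; apply: incl_inj; rewrite !incl_star spin_starK. Qed.

Lemma tensor_star_act n s (w : diagram S) : tangle n s w ->
  tensor_star (act n s w) = act n s (reflect tensor_star w).
Proof.
move=> tw; apply: incl_inj; rewrite incl_star.
have tr : tangle n s (reflect tensor_star w) := well_typed_reflect _ tw.
rewrite !(incl_sub_act (@generated_closed _ Q _)) // spin_star_act ?tangle_incl //.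
congr (act _ _ _); rewrite /reflect -map_rev -!map_rev -!map_comp; apply: eq_map.
by case=> //= i k e x; rewrite incl_star.
Qed.

End SubfactorStructure.

Lemma dim1_line (K : fieldType) (vT : vectType K) (v : vT) :
  v != 0 -> (forall x, exists c, x = c *: v) -> \dim {: vT} = 1%N.
Proof.
move=> v0 lv; have -> : {: vT}%VS = <[v]>%VS; last by rewrite dim_vline v0.
apply/eqP; rewrite eqEsubv subvf andbT; apply/subvP=> x _.
by have [c ->] := lv x; apply: memvZ; apply: memv_line.
Qed.

(** Typing of the closure of a box on the right, which defines the trace. *)
Section Closures.
Variables (C : numClosedFieldType) (V : nat -> bool -> vectType C).

Lemma well_typed_cap_cat s m j n (w : diagram V) m' : (j <= m)%N ->
  well_typed s (m + n.*2) w m' -> well_typed s m (caps V j n ++ w) m'.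
Proof.
elim: n j m => [|n IH] j m jm wt; first by rewrite addn0 in wt.
rewrite /= addn0 jm /= -/(caps V j.+1 n); apply: IH; first by lia.
by have -> : (m - 0 + 2 + n.*2 = m + n.+1.*2)%N by lia.
Qed.

Lemma well_typed_cups s m i n : (i <= m)%N ->
  well_typed s (m + n.*2) (cups V i n) m.
Proof.
elim: n i m => [|n IH] i m im; first by rewrite addn0 /=.
have /IH h : (i.+1 <= m + 2)%N by lia.
rewrite cups_recl well_typed_cat.
have -> : (m + n.+1.*2 = m + 2 + n.*2)%N by lia.
by rewrite (well_typed_after h) h /= addnK addn0 eqxx andbT; lia.
Qed.

Lemma tangle_closure s n (x : V n s) : tangle 0 s (caps V 0 n ++ Box 0 x :: cups V 0 n).
Proof.
apply: well_typed_cap_cat => //=; rewrite addbF eqxx add0n.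
have -> : (n <= n.*2)%N by lia.
by rewrite subnK; [apply: (@well_typed_cups s 0 0 n) | lia].
Qed.

End Closures.

Section TraceLinear.
Variables (C : numClosedFieldType) (R : planar_algebra C) (n : nat) (s : bool).

Lemma ptraceP (c : C) (x y : R n s) : ptrace (c *: x + y) = c * ptrace x + ptrace y.
Proof. by rewrite /ptrace act_linear ?tangle_closure // scalar_ofP. Qed.

Lemma ptrace0 : ptrace (0 : R n s) = 0.
Proof. by have := ptraceP (-1) 0 0; rewrite scaler0 addr0 mulN1r addNr. Qed.

Lemma ptrace_sum (I : Type) (r : seq I) (F : I -> R n s) :
  ptrace (\sum_(i <- r) F i) = \sum_(i <- r) ptrace (F i).
Proof.
apply: (big_morph (@ptrace C R n s)) => [x y|]; last exact: ptrace0.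
by have := ptraceP 1 x y; rewrite scale1r mul1r.
Qed.

Lemma pmul0 (x : R n s) : pmul x 0 = 0.
Proof. by rewrite /pmul (act_zero (a := [:: Box 0 x])) ?tangle_pmul. Qed.

End TraceLinear.

Section Structure.
Variables (C : numClosedFieldType) (H : finGroupType) (P : subfactor_planar_algebra C).
Local Notation Q := (spin_planar H P).
Local Notation S := (tensor_planar H P).
Implicit Types (s e : bool) (t u v l r b : seq H) (h : H).
Local Notation incl_d := (map (@incl_piece C Q (generated_space (Q := Q) (@invariant_two_box C H P)))).

Lemma boundary00 s : boundary s 0 0 [:: 1%g : H] [:: 1%g].
Proof. by rewrite /boundary /colouring /= eqxx !implybT. Qed.

(** A closed diagram has one outer region: its colours form a single orbit under
translation. *)
Lemma boundary0P s u v : boundary s 0 0 u v ->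
  exists h, u = translate s h [:: 1%g] /\ v = translate s h [:: 1%g].
Proof.
move=> /and4P[/andP[/eqP su sa] /andP[/eqP sv _] /eqP hh _].
case: u v su sv sa hh => [|a []] // [|b []] // _ _ /andP[sa _] /= <-; exists a.
by case: s sa => [/eqP->|_]; rewrite /= ?mulg1.
Qed.

Lemma entry_nil s : tensor_entry (act (p := S) 0 s [::]) [:: 1%g] [:: 1%g] =
  act (p := P) 0 s [::].
Proof.
rewrite tensor_entry_act ?boundary00 ?tangle_nil // /weight big_nil scale1r.
by rewrite /amplitude /state_sum /= eqxx.
Qed.

Lemma tensor_zero_box_scalar s (x : S 0%N s) c :
  tensor_entry x [:: 1%g] [:: 1%g] = c *: act (p := P) 0 s [::] ->
  x = c *: act (p := S) 0 s [::].
Proof.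
move=> xE; apply: tensor_ext => u v /boundary0P[h [-> ->]].
rewrite !tensor_entry_translate ?boundary00 // xE.
by rewrite tensor_entryZ entry_nil.
Qed.

Lemma tensor_dim0 s : \dim {: S 0%N s} = 1%N.
Proof.
have nz : act (p := P) 0 s [::] != 0 by apply/dim1_identity/dim_zero_boxes.
apply: (@dim1_line _ _ (act (p := S) 0 s [::])).
  by apply: contra_neq nz => e0; rewrite -entry_nil e0 tensor_entry0.
move=> x; have [c xE] := dim1_scalar (tensor_entry x [:: 1%g] [:: 1%g]) (dim_zero_boxes P s).
by exists c; apply: tensor_zero_box_scalar.
Qed.

(** By invariance a 0-box is determined by its value on the colour 1. *)
Lemma scalar_tensor s (x : S 0%N s) :
  scalar_of x = scalar_of (tensor_entry x [:: 1%g] [:: 1%g]).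
Proof.
have [c xE] := dim1_scalar (tensor_entry x [:: 1%g] [:: 1%g]) (dim_zero_boxes P s).
rewrite xE (tensor_zero_box_scalar xE) !scalar_ofE //; [exact: dim_zero_boxes | exact: tensor_dim0].
Qed.

Lemma incl_caps i n : incl_d (caps S i n) = caps Q i n.
Proof. by rewrite /caps -map_comp. Qed.
Lemma incl_cups i n : incl_d (cups S i n) = cups Q i n.
Proof. by rewrite /cups map_rev -map_comp. Qed.

(** The closing strings carry the colours [c] of the top of the box around to its
bottom, so only diagonal entries contribute, the region on the left keeping
colour 1. *)
Lemma entry_closure n s (x : S n s) :
  tensor_entry (act 0 s (caps S 0 n ++ Box 0 x :: cups S 0 n)) [:: 1%g] [:: 1%g] =
  (weight H s (caps S 0 n) * weight H s (cups S 0 n)) *: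
  \sum_(c <- colourings_from s n 1%g)
    act 0 s (caps P 0 n ++ Box 0 (tensor_entry x c c) :: cups P 0 n).
Proof.
rewrite tensor_entry_act ?boundary00 ?tangle_closure //.
rewrite weight_cat weight_cons /= mul1r; congr (_ *: _).
rewrite map_cat /= incl_caps incl_cups /amplitude state_sum_cat.
have s1 : s (+) odd 0 ==> (1%g == 1%g :> H) by rewrite eqxx implybT.
rewrite -[[:: 1%g]]/([::] ++ 1%g :: [::]) state_sum_caps // addbF in s1 *.
apply: eq_big_seq => c /(colourings_fromP s1)[sc ac hc].
rewrite cats0 state_sum_cons //= addbF.
have rc : rev c != [::] by rewrite -size_eq0 size_rev sc.
have scr : size (behead (rev c)) = n by rewrite size_behead size_rev sc.
transitivity (\sum_(v <- next_slices s n n c) if v == c then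
   act 0 s (caps P 0 n ++ Box 0 (tensor_entry x c c) :: cups P 0 n) else 0).
  apply: eq_big_seq => v; rewrite mem_next_slices => /and4P[_ /andP[/eqP sv av] /eqP hv /eqP lv].
  have rv : rev v != [::] by rewrite -size_eq0 size_rev sv.
  rewrite -[v ++ _]cat0s -[behead (rev c)]cats0 state_sum_cups //; last first.
    rewrite addbF admissible_cat av sv /=.
    have : admissible (s (+) odd n) (rev c) by rewrite admissible_rev sc /= negbK -addbA addbb addbF.
    by case: (rev c) rc => //= a w _ /andP[_]; rewrite addbN.
  have -> : (behead (rev c) == behead (rev v)) = (v == c).
    have rcE : rev c = last 1%g c :: behead (rev c) by rewrite -head_rev; case: (rev c) rc.
    have rvE : rev v = last 1%g c :: behead (rev v) by rewrite lv -head_rev; case: (rev v) rv.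
    by rewrite eq_sym -(inj_eq (inv_inj revK) v c) rcE rvE eqseq_cons eqxx.
  by case: eqP => // ->; rewrite hc eqxx.
by rewrite big_seq_if_eq ?next_slices_uniq // mem_next_slices boundary_refl /colouring sc eqxx ac.
by rewrite eqxx implybT.
Qed.

Lemma closure_weight_gt0 s n :
  0 < weight H s (caps S 0 n) * weight H s (cups S 0 n).
Proof. by rewrite mulr_gt0 ?weight_gt0. Qed.

Lemma ptrace_tensor n s (x : S n s) :
  ptrace x = weight H s (caps S 0 n) * weight H s (cups S 0 n) *
    \sum_(c <- colourings_from s n 1%g) ptrace (tensor_entry x c c).
Proof.
by rewrite /ptrace scalar_tensor entry_closure /scalar_of linearZ linear_sum.
Qed.

Lemma entry_pmul n s (x y : S n s) t b : boundary s n n t b ->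
  tensor_entry (pmul x y) t b =
  \sum_(v <- next_slices s n n t) pmul (tensor_entry x t v) (tensor_entry y v b).
Proof.
move=> tb; have /and4P[/andP[/eqP st at_] /andP[/eqP sb ab] _ _] := tb.
rewrite tensor_entry_act ?tangle_pmul //.
rewrite !weight_cons /weight big_nil /= !mulr1 scale1r /amplitude.
rewrite -[t in LHS]cats0 -[t ++ [::]]cat0s state_sum_cons //= addbF.
apply: eq_big_seq => v; rewrite mem_next_slices => tv; have /and4P[_ /andP[/eqP sv av] _ _] := tv.
rewrite -[v ++ _]cat0s state_sum_cons //= addbF.
have vb : b \in next_slices s n n v.
  by rewrite mem_next_slices; apply: boundary_trans tb; rewrite boundary_sym.
rewrite (bigD1_seq b) ?next_slices_uniq //= /state_sum /= cats0 eqxx big1 ?addr0 // => w /negPf wb.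
by rewrite cats0 wb.
Qed.

(** The trace is a positive combination of traces of [y^* y] in [P], over the
entries [y] of [x] whose bottom slice starts with colour 1; by invariance some
such entry is nonzero. *)
Lemma tensor_positive n s (x : S n s) : x != 0 -> 0 < ptrace (pmul (tensor_star x) x).
Proof.
move=> x0; rewrite ptrace_tensor mulr_gt0 ?closure_weight_gt0 //.
have nonneg m e (y : P m e) : 0 <= ptrace (pmul (pstar y) y).
  have [->|y0] := eqVneq y 0; last by rewrite ltW ?ptrace_positive.
  by rewrite pmul0 ptrace0.
have expand c : c \in colourings_from s n 1%g -> ptrace (tensor_entry (pmul (tensor_star x) x) c c) =
    \sum_(v <- next_slices s n n c) ptrace (pmul (pstar (tensor_entry x v c)) (tensor_entry x v c)).
  have s1 : s ==> (1%g == 1%g :> H) by rewrite eqxx implybT.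
  case/(colourings_fromP s1) => sc ac hc.
  have bcc : boundary s n n c c by rewrite boundary_refl /colouring sc eqxx ac.
  rewrite entry_pmul //.
  rewrite ptrace_sum; apply: eq_big_seq => v; rewrite mem_next_slices => cv.
  by rewrite tensor_entry_star.
rewrite (eq_big_seq _ expand).
have [u [v [buv hv nz]]] : exists u v, [/\ boundary s n n u v, head 1%g v = 1%g & tensor_entry x u v != 0].
  have [w [v [bwv nz]]] : exists w v, boundary s n n w v /\ tensor_entry x w v != 0.
    apply: contrapT => no; case/negP: x0; apply/eqP; apply: tensor_ext => u v buv.
    rewrite tensor_entry0; apply/eqP/negPn/negP => nz.
    by apply: no; exists u, v.
  have /and4P[_ /andP[/eqP sv av] _ _] := bwv.
  (* Translate the nonzero entry so that the bottom slice starts with 1; for [s] shaded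
   that colour is already 1. *)
  exists (translate s (head 1%g v)^-1%g w), (translate s (head 1%g v)^-1%g v); split.
  - exact: boundary_translate.
  - rewrite head_translate -?size_eq0 ?sv //; case: ifP => [sT|_]; last by rewrite mulVg.
    by case: v sv av {bwv nz} => //= a v _; rewrite sT => /andP[/eqP].
  - by rewrite tensor_entry_translate.
have s1 : s ==> (1%g == 1%g :> H) by rewrite eqxx implybT.
have pv : v \in colourings_from s n 1%g.
  by rewrite mem_colourings_from // hv eqxx andbT; case/and4P: buv.
rewrite (bigD1_seq v) ?colourings_from_uniq //= ltr_wpDr //.
  by apply: sumr_ge0 => c _; apply: sumr_ge0.
rewrite (bigD1_seq u) ?next_slices_uniq ?mem_next_slices //=; last by rewrite boundary_sym.
by rewrite ltr_wpDr ?ptrace_positive // sumr_ge0.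
Qed.

End Structure.

Section Spherical.
Variables (C : numClosedFieldType) (H : finGroupType) (P : subfactor_planar_algebra C).
Local Notation Q := (spin_planar H P).
Local Notation S := (tensor_planar H P).
Implicit Types (s e : bool) (t u v l r b : seq H) (h : H).
Local Notation incl_d := (map (@incl_piece C Q (generated_space (Q := Q) (@invariant_two_box C H P)))).

Local Notation m := (spin_weight C H).

Lemma spin_weight4 : m ^+ 2 * m ^+ 2 = #|H|%:R.
Proof. by rewrite /spin_weight sqrtCK -expr2 sqrtCK. Qed.

Lemma tangle_outer_closure s (x : S 1%N s) :
  tangle 0 (~~ s) [:: Cap 0; Box 1 x; Cup 0].
Proof. by rewrite /tangle /=; case: s x. Qed.

Lemma entry_outer_closure s (x : S 1%N s) :
  tensor_entry (act 0 (~~ s) [:: Cap 0; Box 1 x; Cup 0]) [:: 1%g] [:: 1%g] =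
  weight H (~~ s) [:: Cap (V := S) 0; Cup 0] *:
  \sum_(c <- colours H s)
    act 0 (~~ s) [:: Cap 0; Box 1 (tensor_entry x [:: c; 1%g] [:: c; 1%g]); Cup 0].
Proof.
rewrite tensor_entry_act ?boundary00 ?tangle_outer_closure //.
rewrite !weight_cons /= mul1r; congr (_ *: _); rewrite /amplitude /=.
rewrite -[[:: 1%g] in LHS]/([::] ++ [:: 1%g] ++ [::]) state_sum_cons //= addbF.
rewrite big_next_slices_cap ?eqxx ?implybT // negbK; apply: eq_big_seq => c; rewrite mem_colours => sc.
rewrite -[[:: 1%g; c; 1%g] ++ [::]]/([:: 1%g] ++ [:: c; 1%g] ++ [::]) state_sum_cons //=.
have cc : colouring s 1 [:: c; 1%g] by rewrite /colouring /= sc eqxx implybT.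
have -> : ~~ s (+) true = s by case: (s).
rewrite (bigD1_seq [:: c; 1%g]) ?next_slices_uniq ?mem_next_slices ?boundary_refl //=.
rewrite big1_seq ?addr0.
  rewrite -[[:: 1%g; c; 1%g]]/([::] ++ [:: 1%g; c; 1%g] ++ [::]) state_sum_cons //= addbF.
  rewrite big_next_slices_cup; first by rewrite eqxx /state_sum /= eqxx.
  by rewrite /colouring /= negbK sc eqxx implybT.
move=> v /andP[vc]; rewrite mem_next_slices => /and4P[_ /andP[/eqP sv _] /eqP hv /eqP lv].
case: v sv hv lv vc => [|a [|b []]] //= _ <- <-; by rewrite eqxx.
Qed.

Lemma big_colourings_fromS (W : nmodType) s n (a : H) (F : seq H -> W) :
  \sum_(u <- colourings_from s n.+1 a) F u =
  \sum_(c <- colours H (~~ s)) \sum_(u <- colourings_from (~~ s) n c) F (a :: u).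
Proof. exact: big_allpairs_dep. Qed.

Lemma big_colourings_from1 (W : nmodType) s (a : H) (F : seq H -> W) :
  \sum_(u <- colourings_from s 1 a) F u = \sum_(c <- colours H (~~ s)) F [:: a; c].
Proof. by rewrite big_colourings_fromS; apply: eq_bigr => c _; rewrite big_seq1. Qed.

(** On one side of the point at infinity a free colour is summed with weight
m^-2, on the other side no colour is free and the weight is m^2.  By
invariance the summands are all equal, and m^4 is their number. *)
Lemma tensor_spherical s (x : S 1%N s) :
  scalar_of (act 0 s [:: Cap 0; Box 0 x; Cup 0]) =
  scalar_of (act 0 (~~ s) [:: Cap 0; Box 1 x; Cup 0]).
Proof.
have sl : scalar_of (act 0 s [:: Cap 0; Box 0 x; Cup 0]) =
  weight H s [:: Cap (V := S) 0; Cup 0] * \sum_(c <- colours H (~~ s))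
    scalar_of (act 0 s [:: Cap 0; Box 0 (tensor_entry x [:: 1%g; c] [:: 1%g; c]); Cup 0]).
  have := entry_closure x; rewrite scalar_tensor -weight_cat /= => ->.
  by rewrite /scalar_of linearZ linear_sum big_colourings_from1.
(* The spherical axiom of [P] turns the closures on the left into closures on the
   right, so that the two sums have the same summands. *)
have sr : scalar_of (act 0 (~~ s) [:: Cap 0; Box 1 x; Cup 0]) =
  weight H (~~ s) [:: Cap (V := S) 0; Cup 0] * \sum_(c <- colours H s)
    scalar_of (act 0 s [:: Cap 0; Box 0 (tensor_entry x [:: c; 1%g] [:: c; 1%g]); Cup 0]).
  rewrite scalar_tensor entry_outer_closure /scalar_of linearZ linear_sum /=.
  by congr (_ * _); apply: eq_bigr => c _; rewrite -!/(scalar_of _) -spherical.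
have b11 : boundary s 1 1 [:: 1%g : H; 1%g] [:: 1%g; 1%g].
  by rewrite boundary_refl /colouring /= eqxx !implybT.
pose y := scalar_of (act 0 s [:: Cap 0; Box 0 (tensor_entry x [:: 1%g; 1%g] [:: 1%g; 1%g]); Cup 0]).
have card_sum c0 : m ^- 2 * \sum_(c <- enum H) c0 = m ^+ 2 * c0 :> C.
  rewrite big_enum /= sumr_const -[c0 *+ _]mulr_natl -spin_weight4 -mulrA.
  by rewrite mulKf // expf_neq0 ?spin_weight_neq0.
have m2 : m^-1 * m^-1 = m ^- 2 by rewrite -exprVn.
have tr c : tensor_entry x (translate s c [:: 1%g; 1%g]) (translate s c [:: 1%g; 1%g]) =
    tensor_entry x [:: 1%g; 1%g] [:: 1%g; 1%g] by rewrite tensor_entry_translate.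
rewrite sl sr !weight_cons /weight !big_nil /= !addbF !mulr1 {sl sr b11}.
case: s x @y tr => x y /= tr; rewrite m2 big_seq1.
  rewrite -[RHS](card_sum y); congr (_ * _); apply: eq_bigr => c _.
  by have := tr c; rewrite mulg1 => ->.
rewrite -[LHS](card_sum y); congr (_ * _); apply: eq_bigr => c _.
by have := tr c; rewrite mulg1 => ->.
Qed.

Definition group_tensor : subfactor_planar_algebra C :=
  SubfactorPlanarAlgebra (@tensor_star_semilinear C H P) (@tensor_starK C H P)
    (@tensor_star_act C H P) (@tensor_dim0 C H P) tensor_spherical
    (@tensor_positive C H P).

Lemma group_tensor_irreducible : irreducible_spa P -> irreducible_spa group_tensor.
Proof.
rewrite /irreducible_spa => dim1.
have nz := dim1_identity dim1.
have b11 : boundary false 1 1 [:: 1%g : H; 1%g] [:: 1%g; 1%g].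
  by rewrite boundary_refl /colouring /= eqxx.
have idE : tensor_entry (act (p := S) 1 false [::]) [:: 1%g; 1%g] [:: 1%g; 1%g] =
    act (p := P) 1 false [::].
  rewrite tensor_entry_act // /weight big_nil scale1r.
  by rewrite /amplitude /state_sum /= eqxx.
apply: (@dim1_line _ _ (act (p := S) 1 false [::])).
  by apply: contra_neq nz => e0; rewrite -idE e0 tensor_entry0.
move=> x; have [c xE] := dim1_scalar (tensor_entry x [:: 1%g; 1%g] [:: 1%g; 1%g]) dim1.
exists c; apply: tensor_ext => u v buv.
have [h [-> ->]] : exists h, u = translate false h [:: 1%g; 1%g] /\ v = translate false h [:: 1%g; 1%g].
  case/and4P: buv => /andP[/eqP su au] /andP[/eqP sv av] /eqP hh _.
  case: u su au hh => [|a [|b []]] // _ /and3P[_ /eqP-> _].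
  case: v sv av => [|a' [|b' []]] // _ /and3P[_ /eqP-> _] /= <-.
  by exists a; rewrite mulg1.
by rewrite !tensor_entry_translate // xE -idE tensor_entryZ.
Qed.

End Spherical.

(** * Two-boxes as functions on the group *)

Section TwoBoxes.
Variables (C : numClosedFieldType) (H : finGroupType) (P : subfactor_planar_algebra C).
Local Notation Q := (spin_planar H P).
Local Notation S := (tensor_planar H P).
Local Notation T := (group_tensor H P).
Local Notation m := (spin_weight C H).
Implicit Types (s e : bool) (t u v l r : seq H) (a b c g h : H).

(** The regions around a 2-box of V_{2,+}: unshaded on its left and on its right,
shaded above and below it. *)
Definition slice a b : seq H := [:: a; 1%g; b].

Lemma slice_colouring a b : colouring false 2 (slice a b).
Proof. by rewrite /colouring /= eqxx. Qed.

Lemma colouring2P u : colouring false 2 u -> exists a b, u = slice a b.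
Proof.
by case: u => [|a [|x [|b []]]] // /and3P[_ _ /andP[/eqP-> _]]; exists a, b.
Qed.

Lemma boundary2P u v : boundary false 2 2 u v -> exists a b, u = slice a b /\ v = slice a b.
Proof.
case/and4P=> /colouring2P[a [b ->]] /colouring2P[a' [b' ->]] /= /eqP-> /eqP->.
by exists a', b'.
Qed.

Lemma boundary_slice a b : boundary false 2 2 (slice a b) (slice a b).
Proof. by rewrite boundary_refl slice_colouring. Qed.

Lemma translate_slice h a b : translate false h (slice a b) = slice (h * a)%g (h * b)%g.
Proof. by []. Qed.

(** At the shadings at which 2-boxes of V_{2,+} occur, each piece has an explicit
effect on a slice; the diagrams of the operations on 2-boxes are then evaluated
piece by piece. *)
Section Steps.
Variable W : lmodType C.
Implicit Type F : diagram P -> seq H -> W.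

Lemma state_sum_box2 s i (x : Q 2%N false) w l a b r F : size l = i -> s (+) odd i = false ->
  state_sum s (Box i x :: w) (l ++ slice a b ++ r) F =
  state_sum s w (l ++ slice a b ++ r)
    (fun d => F (Box i (entry (P := P) x (slice a b) (slice a b)) :: d)).
Proof.
move=> sl si; rewrite state_sum_cons //= si.
rewrite (bigD1_seq (slice a b)) ?next_slices_uniq ?mem_next_slices ?boundary_slice //=.
rewrite big1_seq ?addr0 // => v /andP[/eqP vn]; rewrite mem_next_slices => /boundary2P[a' [b' [ab vE]]].
by case: vn; rewrite vE ab.
Qed.

Lemma state_sum_cap_shaded s i w l r F : size l = i -> s (+) odd i ->
  state_sum s (Cap (V := Q) i :: w) (l ++ [:: 1%g] ++ r) F =
  \sum_(c : H) state_sum s w (l ++ [:: 1%g; c; 1%g] ++ r) (fun d => F (Cap i :: d)).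
Proof.
move=> sl si; rewrite state_sum_cons // big_next_slices_cap ?eqxx ?implybT //= si.
by rewrite /colours big_enum.
Qed.

Lemma state_sum_cap_plain s i w l a r F : size l = i -> s (+) odd i = false ->
  state_sum s (Cap (V := Q) i :: w) (l ++ [:: a] ++ r) F =
  state_sum s w (l ++ slice a a ++ r) (fun d => F (Cap i :: d)).
Proof. by move=> sl si; rewrite state_sum_cons //= si big_next_slices_cap // big_seq1. Qed.

Lemma state_sum_cup_shaded s i w l c r F : size l = i -> s (+) odd i ->
  state_sum s (Cup (V := Q) i :: w) (l ++ [:: 1%g; c; 1%g] ++ r) F =
  state_sum s w (l ++ [:: 1%g] ++ r) (fun d => F (Cup i :: d)).
Proof.
move=> sl si; rewrite state_sum_cons //= big_next_slices_cup ?eqxx //.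
by rewrite /colouring /= eqxx si.
Qed.

Lemma state_sum_cup_plain s i w l a b r F : size l = i -> s (+) odd i = false ->
  state_sum s (Cup (V := Q) i :: w) (l ++ slice a b ++ r) F =
  if a == b then state_sum s w (l ++ [:: a] ++ r) (fun d => F (Cup i :: d)) else 0.
Proof.
move=> sl si; rewrite state_sum_cons //= si big_next_slices_cup //; exact: slice_colouring.
Qed.

End Steps.
Arguments state_sum_box2 {W s i x w l a b r F}.
Arguments state_sum_cap_shaded {W s i w l r F}.
Arguments state_sum_cap_plain {W s i w l a r F}.
Arguments state_sum_cup_shaded {W s i w l c r F}.
Arguments state_sum_cup_plain {W s i w l a b r F}.

(** By invariance a 2-box depends only on the quotient [a^-1 * b] of the colours on
its left and on its right; the colour on the left is normalized to 1. *)
Definition fibre (x : T 2%N false) g : P 2%N false := tensor_entry x (slice 1%g g) (slice 1%g g).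

Definition of_fibres (f : H -> P 2%N false) : T 2%N false :=
  vsproj (generated_space (Q := Q) (@invariant_two_box C H P) 2 false)
    (of_entries (P := P) (fun u _ => f ((nth 1%g u 0)^-1 * nth 1%g u 2)%g)).

Lemma entry_fibre (x : T 2%N false) a b :
  tensor_entry x (slice a b) (slice a b) = fibre x (a^-1 * b)%g.
Proof.
rewrite /fibre; have := tensor_entry_translate a x (boundary_slice 1%g (a^-1 * b)%g).
by rewrite !translate_slice mulg1 mulKVg.
Qed.

Lemma incl_of_fibres f : incl (of_fibres f) = of_entries (P := P) (fun u _ => f ((nth 1%g u 0)^-1 * nth 1%g u 2)%g)
  :> Q 2%N false.
Proof.
rewrite /incl vsprojK //; apply: generated_box; rewrite /invariant_two_box eqxx /=.
apply/invariantP => h u v buv.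
rewrite !entry_of ?boundary_translate //.
have [a [b [-> _]]] := boundary2P buv.
by rewrite /= invMg -mulgA mulKg.
Qed.

Lemma of_fibresK f g : fibre (of_fibres f) g = f g.
Proof. by rewrite /fibre /tensor_entry incl_of_fibres entry_of ?boundary_slice //= invg1 mul1g. Qed.

Lemma fibre_ext (x y : T 2%N false) : (forall g, fibre x g = fibre y g) -> x = y.
Proof.
by move=> xy; apply: tensor_ext => u v /boundary2P[a [b [-> ->]]]; rewrite !entry_fibre.
Qed.

Lemma fibreP (c : C) (x y : T 2%N false) g : fibre (c *: x + y) g = c *: fibre x g + fibre y g.
Proof. exact: tensor_entryP. Qed.

Lemma fibreZ (c : C) (x : T 2%N false) g : fibre (c *: x) g = c *: fibre x g.
Proof. exact: tensor_entryZ. Qed.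

Lemma fibre0 g : fibre 0 g = 0.
Proof. exact: tensor_entry0. Qed.

Lemma fibre_star (x : T 2%N false) g : fibre (pstar x) g = pstar (fibre x g).
Proof. by rewrite /fibre tensor_entry_star ?boundary_slice. Qed.

Lemma fibre_pmul (x y : T 2%N false) g : fibre (pmul x y) g = pmul (fibre x g) (fibre y g).
Proof.
rewrite /fibre entry_pmul ?boundary_slice //.
rewrite (bigD1_seq (slice 1%g g)) ?next_slices_uniq ?mem_next_slices ?boundary_slice //=.
rewrite big1_seq ?addr0 // => v /andP[/eqP vn]; rewrite mem_next_slices => /boundary2P[a' [b' [ab vE]]].
by case: vn; rewrite vE ab.
Qed.

Lemma circle_group_tensor : circle_value T = m ^+ 2 * circle_value P.
Proof.
rewrite /circle_value scalar_tensor tensor_entry_act ?boundary00 //.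
rewrite /amplitude /= (state_sum_cap_plain (l := [::]) (r := [::])) //.
rewrite (state_sum_cup_plain (l := [::]) (r := [::])) // eqxx /state_sum /= eqxx.
by rewrite /scalar_of linearZ !weight_cons /weight big_nil /= mulr1.
Qed.

Lemma fibre_jones g : fibre (jones_projection T) g = if g == 1%g then jones_projection P else 0.
Proof.
rewrite /jones_projection fibreZ /fibre tensor_entry_act ?boundary_slice //.
rewrite /amplitude /= (state_sum_cup_plain (l := [::]) (r := [::])) //.
rewrite eq_sym; case: eqP => [->|_]; last by rewrite !scaler0.
rewrite (state_sum_cap_plain (l := [::]) (r := [::])) // /state_sum /= eqxx.
rewrite !weight_cons /weight big_nil /= mulr1 scalerA circle_group_tensor; congr (_ *: _).
by rewrite invfM mulrAC mulVf ?mul1r // expf_neq0 ?spin_weight_neq0.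
Qed.

(** The string loop between the two factors encloses an unshaded region, whose
colour [h] is summed. *)
Lemma fibre_convolution (x y : T 2%N false) g :
  fibre (convolution x y) g =
  m ^- 2 *: \sum_(h : H) convolution (fibre x h) (fibre y (h^-1 * g)%g).
Proof.
rewrite /convolution /fibre tensor_entry_act ?boundary_slice // !weight_cons /weight big_nil /=.
rewrite !mulr1 !mul1r -invfM -expr2; congr (_ *: _).
rewrite /amplitude /= (state_sum_cap_shaded (l := [:: 1%g]) (r := [:: g])) //.
apply: eq_bigr => h _.
rewrite (state_sum_box2 (l := [::]) (r := [:: 1%g; g]) (a := 1%g) (b := h)) //.
rewrite (state_sum_box2 (l := [:: 1%g; 1%g]) (r := [::]) (a := h) (b := g)) //.
rewrite (state_sum_cup_shaded (l := [:: 1%g]) (r := [:: g])) // /state_sum /= eqxx.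
by rewrite -/(tensor_entry x _ _) -/(tensor_entry y _ _) !entry_fibre invg1 !mul1g.
Qed.

Lemma fibre_rotation180 (x : T 2%N false) g :
  fibre (rotation180 x) g = rotation180 (fibre x g^-1%g).
Proof.
rewrite /rotation180 /fibre tensor_entry_act ?boundary_slice //.
have wt : weight H false (half_turn_cw 0 x) = 1.
  rewrite /half_turn_cw weight_cat weight_cons mul1r /caps /cups /=.
  rewrite !weight_cons /weight big_nil /= !mulr1.
  by rewrite mulfV ?mul1r ?mulVf ?spin_weight_neq0.
rewrite wt scale1r.
have -> : map (@incl_piece C Q (generated_space (Q := Q) (@invariant_two_box C H P))) (half_turn_cw 0 x) =
    half_turn_cw 0 (incl x : Q 2%N false).
  by [].
rewrite /amplitude.
have cs : colouring false 2 ([::] ++ slice 1%g g ++ [::]) := slice_colouring 1%g g.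
rewrite (state_sum_half_turn_cw (incl x : Q 2%N false) _ (l := [::]) (u := slice 1%g g) (r := [::]) erefl _ cs) //=.
rewrite (bigD1_seq (slice 1%g g)) ?next_slices_uniq ?mem_next_slices ?boundary_slice //= eqxx.
rewrite big1_seq ?addr0; last first.
  move=> v /andP[/eqP vn]; rewrite mem_next_slices => /boundary2P[a' [b' [ab vE]]].
  by case: vn; rewrite vE ab.
by rewrite -/(tensor_entry x _ _) (entry_fibre x g 1%g) mulg1.
Qed.

Lemma ptrace_fibre (x : T 2%N false) : ptrace x = \sum_g ptrace (fibre x g).
Proof.
rewrite ptrace_tensor; have -> : weight H false (caps S 0 2) * weight H false (cups S 0 2) = 1.
  rewrite /caps /cups /= !weight_cons /weight big_nil /= !mulr1.
  by rewrite mulfV ?mul1r ?mulVf ?spin_weight_neq0.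
by rewrite mul1r big_colourings_fromS big_seq1 big_colourings_from1 big_enum.
Qed.

End TwoBoxes.
Arguments state_sum_box2 {C H P W s i x w l a b r F}.
Arguments state_sum_cap_shaded {C H P W s i w l r F}.
Arguments state_sum_cap_plain {C H P W s i w l a r F}.
Arguments state_sum_cup_shaded {C H P W s i w l c r F}.
Arguments state_sum_cup_plain {C H P W s i w l a b r F}.

(** * The exchange relation *)

Section EZero.
Variables (C : numClosedFieldType) (R : planar_algebra C).
Implicit Types x y : R 2%N false.

Lemma E1_indicator (b1 b2 : bool) x y :
  E1 (if b1 then x else 0) (if b2 then y else 0) = if b1 && b2 then E1 x y else 0.
Proof.
case: b1 b2 => [] [] //=; rewrite /E1 ?(act_zero (a := [::])) //.
exact: (act_zero (a := [:: Box 0 x; Cap 1])).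
Qed.

Lemma E2_indicator (b1 b2 : bool) x y :
  E2 (if b1 then x else 0) (if b2 then y else 0) = if b1 && b2 then E2 x y else 0.
Proof.
case: b1 b2 => [] [] //=; rewrite /E2 ?(act_zero (a := [::])) //.
exact: (act_zero (a := [:: Box 0 x; Cup 1; Cap 1])).
Qed.

Lemma E3_indicator (b1 b2 : bool) x y :
  E3 (if b1 then x else 0) (if b2 then y else 0) = if b1 && b2 then E3 x y else 0.
Proof.
case: b1 b2 => [] [] //=; rewrite /E3 /=.
- exact: (act_zero (a := [:: Cap 1; Box 2 x; Cup 3])).
- exact: (act_zero (a := [:: Cap 1])).
- exact: (act_zero (a := [:: Cap 1])).
Qed.

End EZero.

Section Exchange.
Variables (C : numClosedFieldType) (H : finGroupType) (P : subfactor_planar_algebra C).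
Local Notation Q := (spin_planar H P).
Local Notation S := (tensor_planar H P).
Local Notation T := (group_tensor H P).
Local Notation m := (spin_weight C H).
Implicit Types (s e : bool) (t u v l r : seq H) (a b c g h : H).

(** The regions met by a slice with three strings: the one on the left has a
colour [a] common to the top and the bottom slice, the one on the right is
shaded. *)
Definition slice3 a b : seq H := [:: a; 1%g; b; 1%g].

Lemma boundary3P u v : boundary false 3 3 u v ->
  exists a b c, u = slice3 a b /\ v = slice3 a c.
Proof.
case/and4P=> /andP[su au] /andP[sv av] /eqP hh _.
case: u v su sv au av hh => [|a [|x [|b [|y []]]]] // [|a' [|x' [|c [|y' []]]]] // _ _.
move=> /and4P[_ /eqP-> _ /andP[/eqP-> _]] /and4P[_ /eqP-> _ /andP[/eqP-> _]] /= <-.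
by exists a, b, c.
Qed.

Lemma boundary_slice3 a b c : boundary false 3 3 (slice3 a b) (slice3 a c).
Proof. by rewrite /boundary /colouring /= !eqxx. Qed.

Lemma eq_slice3 a b c : (slice3 a b == slice3 a c) = (b == c).
Proof. by rewrite /slice3 !eqseq_cons !eqxx /= !andbT. Qed.

(** On the boundary with left colour [a], upper colour [b] and lower colour [c],
each box of an E-diagram lies between two of the three coloured regions.  No
interior colour remains to be summed, and the common factor is the weight of
one maximum and one minimum with shaded outer region. *)
Lemma entry_E1 (x y : T 2%N false) a b c :
  tensor_entry (E1 x y) (slice3 a b) (slice3 a c) =
  m ^- 2 *: E1 (fibre x (a^-1 * b)%g) (fibre y (c^-1 * b)%g).
Proof.
rewrite tensor_entry_act ?boundary_slice3 // !weight_cons /weight big_nil /=.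
rewrite !mulr1 !mul1r -invfM -expr2; congr (_ *: _); rewrite /amplitude /=.
rewrite (state_sum_box2 (l := [::]) (r := [:: 1%g]) (a := a) (b := b)) //.
rewrite (state_sum_cap_shaded (l := [:: a]) (r := [:: b; 1%g])) //.
rewrite (bigD1 c) //= big1 ?addr0.
  rewrite (state_sum_box2 (l := [:: a; 1%g]) (r := [:: 1%g]) (a := c) (b := b)) //.
  rewrite (state_sum_cup_shaded (l := [:: a; 1%g; c]) (c := b) (r := [::])) // /state_sum /= eqxx.
  by rewrite -/(tensor_entry x _ _) -/(tensor_entry y _ _) !entry_fibre.
move=> d dc.
rewrite (state_sum_box2 (l := [:: a; 1%g]) (r := [:: 1%g]) (a := d) (b := b)) //.
rewrite (state_sum_cup_shaded (l := [:: a; 1%g; d]) (c := b) (r := [::])) // /state_sum /=.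
by rewrite eq_slice3 (negPf dc).
Qed.

Lemma entry_E2 (x y : T 2%N false) a b c :
  tensor_entry (E2 x y) (slice3 a b) (slice3 a c) =
  m ^- 2 *: E2 (fibre x (a^-1 * b)%g) (fibre y (a^-1 * c)%g).
Proof.
rewrite tensor_entry_act ?boundary_slice3 // !weight_cons /weight big_nil /=.
rewrite !mulr1 !mul1r -invfM -expr2; congr (_ *: _); rewrite /amplitude /=.
rewrite (state_sum_box2 (l := [::]) (r := [:: 1%g]) (a := a) (b := b)) //.
rewrite (state_sum_cup_shaded (l := [:: a]) (c := b) (r := [::])) //.
rewrite (state_sum_cap_shaded (l := [:: a]) (r := [::])) //.
rewrite (bigD1 c) //= big1 ?addr0.
  rewrite (state_sum_box2 (l := [::]) (r := [:: 1%g]) (a := a) (b := c)) // /state_sum /= eqxx.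
  by rewrite -/(tensor_entry x _ _) -/(tensor_entry y _ _) !entry_fibre.
move=> d dc.
rewrite (state_sum_box2 (l := [::]) (r := [:: 1%g]) (a := a) (b := d)) // /state_sum /=.
by rewrite eq_slice3 (negPf dc).
Qed.

Lemma entry_E3 (x y : T 2%N false) a b c :
  tensor_entry (E3 x y) (slice3 a b) (slice3 a c) =
  m ^- 2 *: E3 (fibre x (c^-1 * b)%g) (fibre y (a^-1 * c)%g).
Proof.
rewrite tensor_entry_act ?boundary_slice3 // !weight_cons /weight big_nil /=.
rewrite !mulr1 !mul1r -invfM -expr2; congr (_ *: _); rewrite /amplitude /=.
rewrite (state_sum_cap_shaded (l := [:: a]) (r := [:: b; 1%g])) //.
rewrite (bigD1 c) //= big1 ?addr0.
  rewrite (state_sum_box2 (l := [:: a; 1%g]) (r := [:: 1%g]) (a := c) (b := b)) //.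
  rewrite (state_sum_cup_shaded (l := [:: a; 1%g; c]) (c := b) (r := [::])) //.
  rewrite (state_sum_box2 (l := [::]) (r := [:: 1%g]) (a := a) (b := c)) // /state_sum /= eqxx.
  by rewrite -/(tensor_entry x _ _) -/(tensor_entry y _ _) !entry_fibre.
move=> d dc.
rewrite (state_sum_box2 (l := [:: a; 1%g]) (r := [:: 1%g]) (a := d) (b := b)) //.
rewrite (state_sum_cup_shaded (l := [:: a; 1%g; d]) (c := b) (r := [::])) //.
rewrite (state_sum_box2 (l := [::]) (r := [:: 1%g]) (a := a) (b := d)) // /state_sum /=.
by rewrite eq_slice3 (negPf dc).
Qed.

Definition delta_fibre g (x : P 2%N false) : T 2%N false := of_fibres (fun h => if h == g then x else 0).

Lemma fibre_delta g x h : fibre (delta_fibre g x) h = if h == g then x else 0.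
Proof. exact: of_fibresK. Qed.

Lemma sum_pair_if (W : nmodType) (I : finType) g (F : I -> W) :
  \sum_(k : H * I) (if k.1 == g then F k.2 else 0) = \sum_i F i.
Proof.
rewrite -(pair_bigA _ (fun h i => if h == g then F i else 0)) (bigD1 g) //= eqxx.
by rewrite [X in _ + X]big1 ?addr0 // => h /negPf->; apply: big1.
Qed.

Lemma sum_pair2_if (W : lmodType C) (I : finType) g h (al : I -> I -> C) (F : H * I -> H * I -> W) :
  \sum_(k : H * I) \sum_(k' : H * I)
     (if (k.1 == g) && (k'.1 == h) then al k.2 k'.2 else 0) *: F k k' =
  \sum_i \sum_j al i j *: F (g, i) (h, j).
Proof.
rewrite -(sum_pair_if g (fun i => \sum_j al i j *: F (g, i) (h, j))).
apply: eq_bigr => -[k i] _ /=; case: eqP => [->|_]; last by apply: big1 => k' _; rewrite scale0r.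
rewrite -(sum_pair_if h (fun j => al i j *: F (g, i) (h, j))).
by apply: eq_bigr => -[k' j] _ /=; case: eqP => [->|_]; rewrite ?scale0r.
Qed.

Lemma exchange_group_tensor (I : finType) (p : I -> P 2%N false) :
  exchange_relation p -> exchange_relation (fun k : H * I => delta_fibre k.1 (p k.2)).
Proof.
move=> ex [g i] [h j] /=; have [al [be E1ij]] := ex i j.
pose g' := (g * h^-1)%g.
(* The second box of E_2 and of E_3 sees [a^-1 * c], which is
   [(a^-1 * b) * (c^-1 * b)^-1 = g * h^-1] whenever E_1 does not vanish. *)
exists (fun k k' => if (k.1 == g) && (k'.1 == g') then al k.2 k'.2 else 0).
exists (fun k k' => if (k.1 == h) && (k'.1 == g') then be k.2 k'.2 else 0).
rewrite (sum_pair2_if g g' al (fun k k' => E2 (delta_fibre k.1 (p k.2)) (delta_fibre k'.1 (p k'.2)))).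
rewrite (sum_pair2_if h g' be (fun k k' => E3 (delta_fibre k.1 (p k.2)) (delta_fibre k'.1 (p k'.2)))) /=.
apply: tensor_ext => u v /boundary3P[a [b [c [-> ->]]]].
rewrite tensor_entryD !tensor_entry_sum entry_E1 !fibre_delta E1_indicator.
pose cond := (a^-1 * b == g)%g && (c^-1 * b == h)%g; rewrite -/cond.
have zE : (a^-1 * c = (a^-1 * b) * (c^-1 * b)^-1)%g by rewrite invMg invgK mulgA mulgK.
have c2 : (a^-1 * b == g)%g && (a^-1 * c == g')%g = cond.
  rewrite /cond zE; apply: andb_id2l => /eqP->.
  by rewrite (inj_eq (mulgI g)) (inj_eq invg_inj).
have c3 : (c^-1 * b == h)%g && (a^-1 * c == g')%g = cond.
  rewrite /cond zE [RHS]andbC; apply: andb_id2l => /eqP->.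
  by rewrite (inj_eq (mulIg _)).
transitivity (if cond then m ^- 2 *: E1 (p i) (p j) else 0).
  by case: (cond); rewrite ?scaler0.
have sum_if (F : I -> I -> S 3%N false) (G : I -> I -> P 3%N false) (z : I -> I -> C) :
    (forall k k', tensor_entry (F k k') (slice3 a b) (slice3 a c) =
       if cond then m ^- 2 *: G k k' else 0) ->
    \sum_k tensor_entry (\sum_k' z k k' *: F k k') (slice3 a b) (slice3 a c) =
    if cond then m ^- 2 *: \sum_k \sum_k' z k k' *: G k k' else 0.
  move=> FG; case: (cond) FG => FG.
    rewrite scaler_sumr; apply: eq_bigr => k _; rewrite tensor_entry_sum scaler_sumr.
    by apply: eq_bigr => k' _; rewrite tensor_entryZ FG !scalerA mulrC.
  apply: big1 => k _; rewrite tensor_entry_sum big1 // => k' _.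
  by rewrite tensor_entryZ FG scaler0.
rewrite (sum_if _ (fun k k' => E2 (p k) (p k'))); last first.
  move=> k k'; rewrite entry_E2 !fibre_delta E2_indicator c2.
  by case: (cond); rewrite ?scaler0.
rewrite (sum_if _ (fun k k' => E3 (p k) (p k'))); last first.
  move=> k k'; rewrite entry_E3 !fibre_delta E3_indicator c3.
  by case: (cond); rewrite ?scaler0.
by case: (cond); rewrite ?addr0 // E1ij scalerDr.
Qed.

End Exchange.

(** * Minimal projections and generation *)

Section MinimalProjections.
Variables (C : numClosedFieldType) (H : finGroupType) (P : subfactor_planar_algebra C).
Local Notation T := (group_tensor H P).

Lemma pmul0l (R : planar_algebra C) n s (x : R n s) : pmul 0 x = 0.
Proof. by rewrite /pmul (act_zero (a := [::])) ?tangle_pmul. Qed.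

Lemma projection0 n s : projection (0 : P n s).
Proof. by split; [rewrite pmul0 | rewrite pstar0]. Qed.

Lemma projection_fibre (q : T 2%N false) :
  projection q <-> forall g, projection (fibre q g).
Proof.
split=> [[qq qs] g|pq]; first by rewrite /projection -fibre_pmul -fibre_star qq qs.
split; apply: fibre_ext => g; have [qq qs] := pq g; first by rewrite fibre_pmul.
by rewrite fibre_star.
Qed.

Lemma projection_delta (g : H) (x : P 2%N false) : projection x -> projection (delta_fibre g x).
Proof.
by move=> px; apply/projection_fibre=> h; rewrite fibre_delta; case: eqP => // _; apply: projection0.
Qed.

Lemma delta_fibre0 (g : H) : delta_fibre g (0 : P 2%N false) = 0.
Proof. by apply: fibre_ext => h; rewrite fibre_delta fibre0 if_same. Qed.

Lemma delta_fibre_inj (g : H) : injective (@delta_fibre C H P g).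
Proof. by move=> x y /(congr1 (fun z => fibre z g)); rewrite !fibre_delta eqxx. Qed.

Lemma pmul_delta (q : T 2%N false) (g : H) x :
  pmul (fibre q g) x = x -> pmul q (delta_fibre g x) = delta_fibre g x.
Proof.
move=> qx; apply: fibre_ext => h; rewrite fibre_pmul !fibre_delta.
by case: eqP => [->|_]; rewrite ?pmul0.
Qed.

(** Multiplication is pointwise on the group: a projection splits into its fibres,
so a minimal one has a single nonzero fibre, itself minimal. *)
Lemma minimal_projectionP (q : T 2%N false) :
  minimal_projection q <-> exists (g : H) r, minimal_projection r /\ q = delta_fibre g r.
Proof.
split=> [[pq q0 mq]|[g [r [[pr r0 mr] ->]]]].
  have [g qg] : exists g, fibre q g != 0.
    apply: contrapT => no; case/negP: q0; apply/eqP; apply: fibre_ext => g; rewrite fibre0.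
    by apply/eqP/negPn/negP=> qg; apply: no; exists g.
  have pqg := (projection_fibre q).1 pq g.
  have qE : q = delta_fibre g (fibre q g).
    have [d0|//] := mq _ (projection_delta g pqg) (pmul_delta pqg.1).
    by move: qg; rewrite (delta_fibre_inj (etrans d0 (esym (delta_fibre0 g)))) eqxx.
  exists g, (fibre q g); split=> //; split=> // r pr rq.
  have [d0|dq] := mq _ (projection_delta g pr) (pmul_delta rq).
    by left; apply: (@delta_fibre_inj g); rewrite d0 delta_fibre0.
  by right; rewrite -dq fibre_delta eqxx.
split; first exact: projection_delta.
  by apply: contra_neq r0 => d0; apply: (@delta_fibre_inj g); rewrite d0 delta_fibre0.
move=> x px dx.
have xE h : fibre x h = if h == g then pmul r (fibre x g) else 0.
  rewrite -{1}dx fibre_pmul fibre_delta; case: eqP => [->|_] //; exact: pmul0l.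
have xg : pmul r (fibre x g) = fibre x g by rewrite [RHS]xE eqxx.
have [x0|xr] := mr _ ((projection_fibre x).1 px g) xg; [left|right]; apply: fibre_ext => h.
  by rewrite xE xg x0 if_same fibre0.
by rewrite xE xg xr fibre_delta.
Qed.

End MinimalProjections.

Lemma generated_group_tensor (C : numClosedFieldType) (H : finGroupType)
  (P : subfactor_planar_algebra C) : generated_by_two_boxes (group_tensor H P).
Proof.
move=> n s x; have [ws [hws xws]] := generated_by_generators x.
exists ws; split=> //; apply: sub_all hws => w /andP[-> hw] /=.
by apply: sub_all hw => -[] //= i k e y /andP[].
Qed.

(** * The group algebra with coefficients in an algebra *)

Section GroupAlgebra.
Variables (K : fieldType) (H : finGroupType) (A : falgType K).

(** An alias, because finite functions already carry the pointwise product. *)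
Definition group_algebra := {ffun H -> A}.
HB.instance Definition _ := Vector.on group_algebra.

Implicit Types x y z : group_algebra.

Definition ga_mul x y : group_algebra := [ffun g => \sum_h x h * y (h^-1 * g)%g].
Definition ga_one : group_algebra := [ffun g => if g == 1%g then 1 else 0].

Lemma ga_mulA : associative ga_mul.
Proof.
move=> x y z; apply/ffunP=> g; rewrite !ffunE.
under [LHS]eq_bigr do rewrite ffunE mulr_sumr.
under [RHS]eq_bigr do rewrite ffunE mulr_suml.
rewrite [RHS]exchange_big /=; apply: eq_bigr => h _.
rewrite [RHS](reindex_inj (mulgI h)) /=; apply: eq_bigr => k _.
by rewrite mulKg invMg mulrA mulgA.
Qed.

Lemma ga_mul1l : left_id ga_one ga_mul.
Proof.
move=> x; apply/ffunP=> g; rewrite ffunE (bigD1 1%g) //= big1 => [|h /negPf h1].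
  by rewrite ffunE eqxx mul1r invg1 mul1g addr0.
by rewrite ffunE h1 mul0r.
Qed.

Lemma ga_mul1r : right_id ga_one ga_mul.
Proof.
move=> x; apply/ffunP=> g; rewrite ffunE (bigD1 g) //= big1 => [|h hg].
  by rewrite ffunE mulVg eqxx mulr1 addr0.
rewrite ffunE; case: eqP => [e|_]; last by rewrite mulr0.
by case/eqP: hg; rewrite -[LHS]mulg1 -e mulKVg.
Qed.

Lemma ga_mulDl : left_distributive ga_mul +%R.
Proof.
move=> x y z; apply/ffunP=> g; rewrite !ffunE -big_split /=.
by apply: eq_bigr => h _; rewrite ffunE mulrDl.
Qed.

Lemma ga_mulDr : right_distributive ga_mul +%R.
Proof.
move=> x y z; apply/ffunP=> g; rewrite !ffunE -big_split /=.
by apply: eq_bigr => h _; rewrite ffunE mulrDr.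
Qed.

Lemma ga_one_neq0 : ga_one != 0.
Proof.
apply/eqP=> /ffunP/(_ 1%g); rewrite !ffunE eqxx => /eqP; apply/negP; exact: oner_neq0.
Qed.

HB.instance Definition _ := GRing.Zmodule_isNzRing.Build group_algebra
  ga_mulA ga_mul1l ga_mul1r ga_mulDl ga_mulDr ga_one_neq0.

Lemma ga_scalerAl (c : K) (x y : group_algebra) : c *: (x * y) = (c *: x) * y.
Proof.
apply/ffunP=> g; rewrite !ffunE scaler_sumr; apply: eq_bigr => h _.
by rewrite ffunE scalerAl.
Qed.

HB.instance Definition _ := GRing.Lmodule_isLalgebra.Build K group_algebra ga_scalerAl.

Lemma ga_scalerAr (c : K) (x y : group_algebra) : c *: (x * y) = x * (c *: y).
Proof.
apply/ffunP=> g; rewrite !ffunE scaler_sumr; apply: eq_bigr => h _.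
by rewrite ffunE scalerAr.
Qed.

HB.instance Definition _ := GRing.Lalgebra_isAlgebra.Build K group_algebra ga_scalerAr.
HB.instance Definition _ := Algebra_isFalgebra.Build K group_algebra.

Lemma ga_mulE x y g : (x * y) g = \sum_h x h * y (h^-1 * g)%g.
Proof. by rewrite ffunE. Qed.

End GroupAlgebra.

(** * The fusion bialgebra of the tensor product *)

(** Pairs in H * 'I_n are to be renumbered by ordinals so that the unit index has
number 0. *)
Lemma pointed_enumeration (I : finType) (i0 : I) :
  exists n (f : 'I_n.+1 -> I) (f' : I -> 'I_n.+1),
    [/\ cancel f f', cancel f' f & f ord0 = i0].
Proof.
have cardI : #|I| = #|I|.-1.+1 by rewrite prednK //; apply/card_gt0P; exists i0.
pose f0 (j : 'I_#|I|.-1.+1) : I := enum_val (cast_ord (esym cardI) j).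
pose f0' (i : I) : 'I_#|I|.-1.+1 := cast_ord cardI (enum_rank i).
have f0K : cancel f0 f0' by move=> j; rewrite /f0 /f0' enum_valK cast_ordKV.
have f0'K : cancel f0' f0 by move=> i; rewrite /f0 /f0' cast_ordK enum_rankK.
pose p : {perm I} := tperm (f0 ord0) i0.
exists #|I|.-1, (fun j => p (f0 j)), (fun i => f0' (p i)); split.
- by move=> j; rewrite tpermK f0K.
- by move=> i; rewrite f0'K tpermK.
by rewrite tpermL.
Qed.

Section TensorBialgebra.
Variables (C : numClosedFieldType) (H : finGroupType) (B : fusion_bialgebra C).
Variables (N : nat) (idx : 'I_N.+1 -> H * 'I_(frank B).+1)
  (xdi : H * 'I_(frank B).+1 -> 'I_N.+1).
Hypotheses (idxK : cancel idx xdi) (xdiK : cancel xdi idx) (idx0 : idx ord0 = (1%g, ord0)).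

Local Notation A := (group_algebra H B).
Implicit Types f : A.

Definition ga_delta (g : H) (x : B) : A := [ffun h => if h == g then x else 0].

Definition ga_star f : A := [ffun h => fstar (f h^-1%g)].

Lemma fstar0 : fstar (0 : B) = 0.
Proof. by have := fstar_semilinear (-1) (0 : B) 0; rewrite scaler0 addr0 rmorphN1 scaleN1r addNr. Qed.

Lemma fstarD (x y : B) : fstar (x + y) = fstar x + fstar y.
Proof. by have := fstar_semilinear 1 x y; rewrite rmorph1 !scale1r. Qed.

Lemma ga_star_semilinear (c : C) f1 f2 :
  ga_star (c *: f1 + f2) = c^* *: ga_star f1 + ga_star f2.
Proof. by apply/ffunP=> g; rewrite !ffunE fstar_semilinear. Qed.

Lemma ga_starM f1 f2 : ga_star (f1 * f2) = ga_star f2 * ga_star f1.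
Proof.
apply/ffunP=> g; rewrite ffunE !ga_mulE (big_morph (@fstar C B) fstarD fstar0).
rewrite [RHS](reindex_inj (mulgI g)) /=; apply: eq_bigr => h _.
by rewrite !ffunE fstarM !invMg !invgK mulKg.
Qed.

Lemma ga_starK : involutive ga_star.
Proof. by move=> f; apply/ffunP=> g; rewrite !ffunE invgK fstarK. Qed.

Definition ga_basis (j : 'I_N.+1) : A := ga_delta (idx j).1 (fbasis (idx j).2).

Lemma ga_sum_basis (k : 'I_N.+1 -> C) g :
  (\sum_j k j *: ga_basis j) g = \sum_i k (xdi (g, i)) *: fbasis i.
Proof.
rewrite (reindex_onto xdi idx) /= => [|j _]; last exact: idxK.
rewrite (eq_bigl xpredT) => [|i]; last by rewrite xdiK eqxx.
have -> : \sum_j k (xdi j) *: ga_basis (xdi j) =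
   \sum_h \sum_i k (xdi (h, i)) *: ga_delta h (fbasis i).
  rewrite pair_bigA; apply: eq_bigr => -[h i] _; by rewrite /ga_basis xdiK.
rewrite sum_ffunE (bigD1 g) //= [X in _ + X]big1 ?addr0 => [|h hg].
  by rewrite sum_ffunE; apply: eq_bigr => i _; rewrite !ffunE eqxx.
rewrite sum_ffunE big1 // => i _; rewrite !ffunE eq_sym (negPf hg) scaler0 //.
Qed.

Lemma ga_basisP : basis_of {: A} [tuple ga_basis j | j < N.+1].
Proof.
have bB := fbasisP B.
apply/andP; split.
  rewrite eqEsubv subvf /=; apply/subvP=> f _.
  have -> : f = \sum_j coord [tuple fbasis i | i < (frank B).+1] (idx j).2 (f (idx j).1) *: ga_basis j.
    apply/ffunP=> g; rewrite ga_sum_basis {1}(coord_basis bB (memvf (f g))).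
    by apply: eq_bigr => i _; rewrite xdiK -tnth_nth tnth_mktuple.
  apply: memv_suml => j _; apply/memvZ/memv_span.
  by apply/mapP; exists j; rewrite ?mem_enum.
apply/freeP=> k; under eq_bigr do rewrite -tnth_nth tnth_mktuple.
move=> k0 j; rewrite -[j]idxK; case: (idx j) => g i.
have /freeP/(_ (fun i => k (xdi (g, i)))) fB := basis_free bB; apply: (fB _ i).
under eq_bigr do rewrite -tnth_nth tnth_mktuple.
by rewrite -ga_sum_basis k0 ffunE.
Qed.

Lemma ga_basis0 : ga_basis ord0 = 1.
Proof. by apply/ffunP=> g; rewrite /ga_basis idx0 !ffunE fbasis0. Qed.

Definition ga_coef (j k s : 'I_N.+1) : C :=
  if (idx s).1 == ((idx j).1 * (idx k).1)%g then fcoef (idx j).2 (idx k).2 (idx s).2 else 0.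

Lemma ga_basisM j k : ga_basis j * ga_basis k = \sum_s ga_coef j k s *: ga_basis s.
Proof.
apply/ffunP=> g; rewrite ga_mulE ga_sum_basis (bigD1 (idx j).1) //=.
rewrite [X in _ + X]big1 ?addr0 => [|h /negPf hj]; last by rewrite /ga_basis ffunE hj mul0r.
rewrite {1 2}/ga_basis !ffunE eqxx /ga_coef; under [RHS]eq_bigr do rewrite xdiK /=.
rewrite -(inj_eq (mulgI (idx j).1)) mulKVg; case: eqP => _.
  by rewrite fbasisM.
by rewrite mulr0 big1 // => i _; rewrite scale0r.
Qed.

Lemma ga_coef_ge0 j k s : 0 <= ga_coef j k s.
Proof. by rewrite /ga_coef; case: ifP => // _; apply: fcoef_ge0. Qed.

Definition ga_dual (j : 'I_N.+1) : 'I_N.+1 := xdi ((idx j).1^-1%g, fdual (idx j).2).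

Lemma ga_dualK : involutive ga_dual.
Proof. by move=> j; rewrite /ga_dual xdiK /= invgK fdualK -surjective_pairing idxK. Qed.

Lemma ga_star_basis k : ga_star (ga_basis k) = ga_basis (ga_dual k).
Proof.
apply/ffunP=> g; rewrite /ga_basis /ga_dual xdiK /= !ffunE eq_invg_sym.
by case: eqP => _; rewrite ?fstar_fbasis ?fstar0.
Qed.

Lemma ga_coef0 j k : ga_coef j k ord0 = (j == ga_dual k)%:R.
Proof.
rewrite /ga_coef /ga_dual idx0 /= -(inj_eq (can_inj idxK)) xdiK.
rewrite -pair_eqE /= fcoef0 [(idx j).1 == _]eq_mulgV1 invgK eq_sym.
by case: eqP => // _; case: eqP.
Qed.

Definition group_bialgebra : fusion_bialgebra C :=
  @FusionBialgebra C A ga_star ga_star_semilinear ga_starM ga_starK N ga_basis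
    ga_basisP ga_basis0 ga_coef ga_basisM ga_coef_ge0 ga_dual ga_dualK ga_star_basis ga_coef0.

Section Realization.
Variables (P : subfactor_planar_algebra C) (p : 'I_(frank B).+1 -> P 2%N false).
Local Notation T := (group_tensor H P).
Local Notation m := (spin_weight C H).

Definition tensor_projection (j : 'I_N.+1) : T 2%N false := delta_fibre (idx j).1 (p (idx j).2).

Hypothesis rp : realizes p.

Lemma convolution_scale (R : planar_algebra C) (c d : C) (x y : R 2%N false) :
  convolution (c *: x) (d *: y) = (c * d) *: convolution x y.
Proof.
by rewrite /convolution (act_scale (a := [:: Cap 1])) // (act_scale (a := [:: Cap 1; Box 0 x])) // scalerA.
Qed.

Lemma rotation180_scale (R : planar_algebra C) (c : C) (x : R 2%N false) :
  rotation180 (c *: x) = c *: rotation180 x.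
Proof. by rewrite /rotation180 /half_turn_cw act_scale. Qed.

Lemma rotation180_0 (R : planar_algebra C) : rotation180 (0 : R 2%N false) = 0.
Proof. by rewrite /rotation180 /half_turn_cw act_zero. Qed.

Lemma tensor_projections : minimal_projections_of_two_boxes tensor_projection.
Proof.
have [_ _ [pI pP p0] _] := rp.
have p_neq0 i : p i != 0 by have [_ ->] : minimal_projection (p i) by apply/pP; exists i.
split.
- move=> j k /(congr1 (fun q => fibre q (idx j).1)); rewrite !fibre_delta eqxx.
  case: eqP => [g2|_ /eqP]; last by rewrite (negPf (p_neq0 _)).
  move/pI => i2; apply: (can_inj idxK).
  by rewrite [LHS]surjective_pairing [RHS]surjective_pairing g2 i2.
- move=> q; split=> [/minimal_projectionP[g [r [/pP[i ->] ->]]]|[j ->]].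
    by exists (xdi (g, i)); rewrite /tensor_projection xdiK.
  by apply/minimal_projectionP; exists (idx j).1, (p (idx j).2); split=> //; apply/pP; exists (idx j).2.
apply: fibre_ext => g; rewrite fibre_jones /tensor_projection idx0 fibre_delta p0.
by case: eqP.
Qed.

Section Phi.
Variable phi0 : {linear B -> P 2%N false}.

(** The factor m^2, the circle value of the group, turns the normalization
m^-2 of the convolution over H into that of the group algebra. *)
Definition tensor_phi (f : A) : T 2%N false := of_fibres (fun g => m ^+ 2 *: phi0 (f g)).

Lemma fibre_phi f g : fibre (tensor_phi f) g = m ^+ 2 *: phi0 (f g).
Proof. exact: of_fibresK. Qed.

Lemma tensor_phi_linear : linear tensor_phi.
Proof.
move=> c f1 f2; apply: fibre_ext => g; rewrite fibreP !fibre_phi !ffunE linearP scalerDr !scalerA.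
by rewrite [c * _]mulrC.
Qed.

HB.instance Definition _ := GRing.isLinear.Build C A (T 2%N false) _ tensor_phi tensor_phi_linear.

Lemma tensor_phi_spec :
  [/\ bijective phi0,
      forall a b : B, phi0 (a * b) = convolution (phi0 a) (phi0 b),
      forall j, phi0 (fstar (fbasis j)) = rotation180 (phi0 (fbasis j))
    & forall j, let delta := circle_value P in
        let d := ptrace (p j) / delta in
        phi0 (fbasis j) = sqrtC (delta / d) *: p j] ->
  [/\ bijective tensor_phi,
      forall a b : A, tensor_phi (a * b) = convolution (tensor_phi a) (tensor_phi b),
      forall j, tensor_phi (ga_star (ga_basis j)) = rotation180 (tensor_phi (ga_basis j))
    & forall j, let delta := circle_value T in
        let d := ptrace (tensor_projection j) / delta in
        tensor_phi (ga_basis j) = sqrtC (delta / d) *: tensor_projection j].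
Proof.
case=> -[psi phiK psiK] phiM phiS phiB.
have m2_neq0 : m ^+ 2 != 0 by rewrite expf_neq0 ?spin_weight_neq0.
split.
- exists (fun x : T 2%N false => [ffun g => psi (m ^- 2 *: fibre x g)] : A) => [f|x].
    by apply/ffunP=> g; rewrite ffunE fibre_phi scalerA mulVf // scale1r phiK.
  by apply: fibre_ext => g; rewrite fibre_phi ffunE psiK scalerA mulfV // scale1r.
- move=> a b; apply: fibre_ext => g.
  rewrite fibre_phi fibre_convolution ga_mulE linear_sum !scaler_sumr.
  apply: eq_bigr => h _; rewrite !fibre_phi convolution_scale phiM scalerA.
  by rewrite mulKf.
- move=> j; apply: fibre_ext => g; rewrite fibre_phi fibre_rotation180 fibre_phi rotation180_scale.
  congr (_ *: _); rewrite !ffunE; case: eqP => _; first exact: phiS.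
  by rewrite fstar0 !linear0 rotation180_0.
move=> j /=; apply: fibre_ext => g; rewrite fibre_phi fibreZ fibre_delta ffunE.
case: eqP => _; last by rewrite linear0 !scaler0.
rewrite phiB scalerA; congr (_ *: _).
have -> : ptrace (tensor_projection j) = ptrace (p (idx j).2).
  rewrite ptrace_fibre (bigD1 (idx j).1) //= fibre_delta eqxx big1 ?addr0 // => h /negPf hj.
  by rewrite fibre_delta hj ptrace0.
rewrite circle_group_tensor.
set t := ptrace _; set de := circle_value P.
(* Circle values multiply and the trace of the projection is that of its fibre, so
   delta / d is multiplied by m^4. *)
have -> : m ^+ 2 * de / (t / (m ^+ 2 * de)) = (m ^+ 2) ^+ 2 * (de / (t / de)).
  by rewrite !invfM !invrK; ring.
have m2_ge0 : 0 <= m ^+ 2 by apply: exprn_ge0; apply: ltW; apply: spin_weight_gt0.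
rewrite [RHS]rootCMl; last by rewrite exprn_ge0.
by rewrite sqrCK.
Qed.

End Phi.

Lemma tensor_realizes :
  realizes (P := T) (B := group_bialgebra) tensor_projection.
Proof.
have [irr com mp [phi phiP]] := rp.
split; [exact: group_tensor_irreducible | | exact: tensor_projections |].
  by move=> x y; apply: fibre_ext => g; rewrite !fibre_pmul com.
have [phi_bij phi_mul phi_star phi_basis] := tensor_phi_spec phiP.
by exists (tensor_phi phi).
Qed.

Lemma exchange_relation_reindex (R : planar_algebra C) (I J : finType) (q : I -> R 2%N false)
    (f : J -> I) (f' : I -> J) : cancel f f' -> cancel f' f ->
  exchange_relation q -> exchange_relation (q \o f).
Proof.
move=> fK f'K ex j k; have [al [be E]] := ex (f j) (f k).
exists (fun s t => al (f s) (f t)), (fun s t => be (f s) (f t)).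
have bij : {on xpredT, bijective f} by exists f' => [x _|x _].
rewrite [LHS]E; congr (_ + _).
  rewrite (reindex f) //; apply: eq_bigr => s _; exact: (reindex f).
rewrite (reindex f) //; apply: eq_bigr => s _; exact: (reindex f).
Qed.

Lemma tensor_exchange : exchange_relation p -> exchange_relation tensor_projection.
Proof.
move=> ex; exact: exchange_relation_reindex idxK xdiK (exchange_group_tensor (H := H) ex).
Qed.

End Realization.

Lemma group_bialgebra_exchange : has_exchange_relations B ->
  subfactorizable group_bialgebra /\ has_exchange_relations group_bialgebra.
Proof.
case=> P [p [rp _ ex]]; have rT := tensor_realizes rp.
split; first by exists (group_tensor H P), (tensor_projection p).
exists (group_tensor H P), (tensor_projection p); split=> //.
  exact: generated_group_tensor.
exact: tensor_exchange.
Qed.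

(** The structure constants are the products of those of H and of [B]. *)
Lemma group_bialgebra_graph : graph_family_iso
  (tensor_graph (group_graph H) (fusion_graph B)) (fusion_graph group_bialgebra).
Proof.
exists xdi; split.
- by exists idx.
- by rewrite /= -idx0 idxK.
- by case=> h i; rewrite /= /ga_dual xdiK.
case=> g k [h i] [h' j]; rewrite /= /ga_coef !xdiK /=.
by case: (h == (g * h')%g); rewrite ?eqxx.
Qed.

End TensorBialgebra.

Lemma graph_family_iso_trans G1 G2 G3 :
  graph_family_iso G1 G2 -> graph_family_iso G2 G3 -> graph_family_iso G1 G3.
Proof.
case=> f [bf f1 fd fe] [f' [bf' f'1 f'd f'e]]; exists (f' \o f); split=> /=.
- exact: bij_comp.
- by rewrite f1.
- by move=> i; rewrite fd f'd.
- by move=> k i j; rewrite fe f'e.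
Qed.

Theorem proposition5p11 (R : realType) (Gamma : graph_family) :
  is_fusion_graph R[i] Gamma ->
  forest Gamma ->
  (exists (H : finGroupType) (Bt : fusion_bialgebra R[i]),
     [/\ subfactorizable Bt, has_exchange_relations Bt,
         forest (fusion_graph Bt)
       & graph_family_iso Gamma (tensor_graph (group_graph H) (fusion_graph Bt))]) ->
  exists B : fusion_bialgebra R[i],
    [/\ subfactorizable B, has_exchange_relations B
      & graph_family_iso Gamma (fusion_graph B)].
Proof.
move=> _ _ [H [Bt [_ ex _ iso]]].
have [N [idx [xdi [idxK xdiK idx0]]]] :=
  pointed_enumeration ((1%g, ord0) : H * 'I_(frank Bt).+1).
exists (group_bialgebra idxK xdiK idx0).
have [sf ex'] := group_bialgebra_exchange idxK xdiK idx0 ex.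
split=> //; apply: graph_family_iso_trans iso _; exact: group_bialgebra_graph.
Qed.
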